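(* The following finite groups are $2$-reduced: (i) finite groups whose Sylow $2$-subgroups are either cyclic or elementary abelian; (ii) the symmetric groups $S_n$ and the alternating groups $A_n$; (iii) the dihedral groups; (iv) the general linear groups $\mathbf{GL}_n(\mathbf F_r)$ with $r\equiv 3 \bmod 4$; (v) the orthogonal groups $\mathbf O_n(\mathbf F_r)$ with $r\equiv 1 \bmod 4$; (vi) the Mathieu group $M_{12}$.
   Context: A finite group $G$ is called $2$-reduced if $H^2(G,\mathbf Z/2\mathbf Z)$ (trivial action) contains no non-zero nilpotent element of the mod $2$ cohomology ring $H^*(G,\mathbf Z/2\mathbf Z)$. $\mathbf F_r$ denotes the finite field with $r$ elements. $\mathbf O_n(\mathbf F_r)$ is the orthogonal group of the unit form $x_1^2+\cdots+x_n^2$ over $\mathbf F_r$. *)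

(* Defs.v *)
From HB Require Import structures.
From mathcomp Require Import all_boot all_order all_algebra all_fingroup all_solvable.
From mathcomp Require Import zify.

Set Implicit Arguments.
Unset Strict Implicit.
Unset Printing Implicit Defensive.

Import GRing.Theory.
Local Open Scope ring_scope.

(* H^*(G, Z/2) is computed by inhomogeneous cochains G^n -> Z/2.  The action  *)
(* on Z/2 is trivial and 2 = 0, so no action term and no signs occur.         *)

Section Cochains.

Variable gT : finGroupType.
Implicit Types m n : nat.

Definition cochain n := {ffun {ffun 'I_n -> gT} -> 'F_2}.

(* With x = (x_0, ..., x_n), face 0 x = (x_1, ..., x_n), face i x multiplies  *)
(* x_(i-1) and x_i for 0 < i <= n, and face n.+1 x = (x_0, ..., x_(n-1)).     *)
Definition face n (i : 'I_n.+2) (x : {ffun 'I_n.+1 -> gT}) :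
    {ffun 'I_n -> gT} :=
  [ffun j : 'I_n =>
    let a := x (lift ord_max j) in
    let b := x (lift ord0 j) in
    if (j.+1 < i)%N then a else if j.+1 == i then (a * b)%g else b].

Definition differential n (f : cochain n) : cochain n.+1 :=
  [ffun x => \sum_(i < n.+2) f (face i x)].

Definition cup_cochain m n (f : cochain m) (g : cochain n) :
    cochain (m + n) :=
  [ffun x : {ffun 'I_(m + n) -> gT} =>
    f [ffun i => x (lshift n i)] * g [ffun j => x (rshift m j)]].

Lemma differential_is_zmod_morphism n : zmod_morphism (@differential n).
Proof.
move=> f g; apply/ffunP=> x; rewrite !ffunE -sumrB.
by apply: eq_bigr => i _; rewrite !ffunE.
Qed.

HB.instance Definition _ n :=
  GRing.isZmodMorphism.Build (cochain n) (cochain n.+1) (@differential n)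
    (@differential_is_zmod_morphism n).

Definition cocycles n : {pred cochain n} := [pred f | differential f == 0].

Lemma cocycles_zmod_closed n : zmod_closed (@cocycles n).
Proof.
split=> [|f g]; first by rewrite inE raddf0.
by rewrite !inE raddfB /= => /eqP-> /eqP->; rewrite subrr.
Qed.

HB.instance Definition _ n :=
  GRing.isZmodClosed.Build (cochain n) (@cocycles n) (@cocycles_zmod_closed n).

Record cocycle n := Cocycle {
  cocycle_val :> cochain n;
  _ : cocycle_val \in @cocycles n
}.

HB.instance Definition _ n := [isSub for @cocycle_val n].
HB.instance Definition _ n := [Choice of cocycle n by <:].
HB.instance Definition _ n := [SubChoice_isSubZmodule of cocycle n by <:].

Definition is_coboundary n : cochain n -> bool :=
  match n with
  | 0 => fun f => f == 0
  | n'.+1 => fun f => [exists g : cochain n', f == differential g]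
  end.

Definition coboundaries n : {pred cocycle n} :=
  [pred f : cocycle n | is_coboundary (f : cochain n)].

Lemma coboundaries_zmod_closed n : zmod_closed (@coboundaries n).
Proof.
case: n => [|n]; split=> [|f g]; rewrite !inE /=.
- by rewrite eqxx.
- by move=> /eqP f0 /eqP g0; rewrite f0 g0 subrr.
- by apply/existsP; exists 0; rewrite raddf0.
move=> /existsP[f' /eqP fE] /existsP[g' /eqP gE].
by apply/existsP; exists (f' - g'); rewrite raddfB fE gE.
Qed.

HB.instance Definition _ n :=
  GRing.isZmodClosed.Build (cocycle n) (@coboundaries n)
    (@coboundaries_zmod_closed n).

Definition cohomology n : zmodType := Quotient.quot (@coboundaries n).


(* Evaluation of cochains at initial segments of sequences X : nat -> gT,     *)
(* used to prove the Leibniz rule without comparing ordinal types.            *)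
Let seg n (X : nat -> gT) : {ffun 'I_n -> gT} := [ffun j : 'I_n => X j].
Let ev n (f : cochain n) (X : nat -> gT) : 'F_2 := f (seg n X).
Let faceN (i : nat) (X : nat -> gT) (j : nat) : gT :=
  if (j.+1 < i)%N then X j else if j.+1 == i then (X j * X j.+1)%g else X j.+1.
Let shift m (X : nat -> gT) (j : nat) : gT := X (m + j)%N.

Let ev_ext n (f : cochain n) X Y :
  (forall j, (j < n)%N -> X j = Y j) -> ev f X = ev f Y.
Proof.
by move=> eqXY; congr (f _); apply/ffunP=> j; rewrite !ffunE eqXY.
Qed.

Let evP n (f g : cochain n) : (forall X, ev f X = ev g X) -> f = g.
Proof.
move=> eqfg; apply/ffunP=> x.
pose X j := if insub j is Some i then x i else 1%g.
suff <-: seg n X = x by apply: eqfg.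
by apply/ffunP=> j; rewrite ffunE /X valK.
Qed.

Let ev_differential n (f : cochain n) X :
  ev (differential f) X = \sum_(0 <= i < n.+2) ev f (faceN i X).
Proof.
rewrite /ev ffunE big_mkord; apply: eq_bigr => i _; congr (f _).
have bump_max (j : 'I_n) : bump n j = j by rewrite /bump leqNgt ltn_ord.
by apply/ffunP=> j; rewrite !ffunE /faceN /= bump_max.
Qed.

Let ev_cup m n (f : cochain m) (g : cochain n) X :
  ev (cup_cochain f g) X = ev f X * ev g (shift m X).
Proof.
by rewrite /ev ffunE; congr (f _ * g _); apply/ffunP=> j; rewrite !ffunE.
Qed.

Let F2_addxx (a : 'F_2) : a + a = 0.
Proof. by rewrite -mulr2n -mulr_natl pchar_Fp_0 ?mul0r. Qed.

Let leibniz m n N (f : cochain m) (g : cochain n) (h : cochain N) X :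
    N = (m + n)%N -> (forall Y, ev h Y = ev f Y * ev g (shift m Y)) ->
  ev (differential h) X = ev (differential f) X * ev g (shift m.+1 X)
     + ev f X * ev (differential g) (shift m X).
Proof.
move=> defN hE; rewrite !ev_differential.
rewrite (@big_cat_nat _ _ _ m.+1) //=; last by rewrite defN !ltnS leqW ?leq_addr.
rewrite [in RHS]big_nat_recr //= [X in _ + _ * X]big_nat_recl //=.
have ->: ev f (faceN m.+1 X) = ev f X.
  by apply: ev_ext => j ltjm; rewrite /faceN ltnS ltjm.
have ->: ev g (faceN 0 (shift m X)) = ev g (shift m.+1 X).
  by apply: ev_ext => j _; rewrite /faceN /shift /= addSnnS.
rewrite mulrDl mulrDr -addrA (addrA (ev f X * _)) F2_addxx add0r.
congr (_ + _).
  rewrite big_distrl; apply: eq_big_nat => i /andP[_ leim] /=.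
  rewrite hE; congr (_ * _); apply: ev_ext => j _.
  have ltij: (i < (m + j).+1)%N by rewrite (leq_trans leim) // ltnS leq_addr.
  by rewrite /shift /faceN ltnNge (ltnW ltij) /= gtn_eqF.
rewrite -[m.+1 in LHS]add0n big_addn big_distrr.
have ->: (N.+2 - m.+1)%N = n.+1 by rewrite defN subSS -addnS addKn.
apply: eq_big_nat => i _ /=; rewrite hE; congr (_ * _).
  apply: ev_ext => j ltjm; rewrite /faceN addnS ltnS.
  by rewrite (leq_trans ltjm) // leq_addl.
apply: ev_ext => j _; rewrite /faceN /shift (addnS m j).
have ->: ((m + j).+1 < i + m.+1)%N = (j.+1 < i.+1)%N.
  by rewrite addnS !ltnS addnC ltn_add2r.
by have ->: ((m + j).+1 == i + m.+1)%N = (j.+1 == i.+1)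
  by rewrite addnS !eqSS addnC eqn_add2r.
Qed.

Let sum_faces_eq0 (T : nat -> nat -> 'F_2) N :
    (forall i j, (j <= i)%N -> T i.+1 j = T j i) ->
  \sum_(0 <= i < N.+1) \sum_(0 <= j < N) T i j = 0.
Proof.
move=> TE; elim: N => [|N IHN].
  by rewrite big_nat1 big_geq.
rewrite big_nat_recr //=.
under eq_big_nat => i _ do rewrite big_nat_recr //=.
rewrite big_split IHN /= add0r.
rewrite [X in X + _](@eq_big_nat _ _ _ _ _ _ (T N.+1)) ?F2_addxx // => i.
by rewrite ltnS => /andP[_ /TE].
Qed.

Lemma coboundary_cocycles n (f : cochain n) :
  is_coboundary f -> f \in @cocycles n.
Proof.
case: n f => [|n] f; first by move/eqP->; rewrite inE raddf0.
case/existsP=> g /eqP->; rewrite inE; apply/eqP/evP => X.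
rewrite ev_differential {2}/ev ffunE.
under eq_big_nat => i _ do rewrite ev_differential.
apply: (sum_faces_eq0 (T := fun i j => ev g (faceN j (faceN i X)))) => i j leji.
apply: ev_ext => k _; rewrite /faceN.
by do ?[case: ifP => ?]; rewrite ?mulgA //; lia.
Qed.

Lemma cup_cocycles m n (f : cocycle m) (g : cocycle n) :
  cup_cochain f g \in @cocycles (m + n).
Proof.
case: f g => [f /eqP df] [g /eqP dg] /=; rewrite inE; apply/eqP/evP => X.
rewrite (leibniz X erefl (ev_cup f g)) df dg.
by rewrite /ev !ffunE mul0r mulr0 addr0.
Qed.

Definition cup_cocycle m n (f : cocycle m) (g : cocycle n) : cocycle (m + n) :=
  Cocycle (cup_cocycles f g).

Definition one_cochain : cochain 0 := [ffun=> 1].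

Lemma one_cocycles : one_cochain \in @cocycles 0.
Proof.
rewrite inE; apply/eqP/ffunP=> x.
by rewrite !ffunE big_ord_recl big_ord1 !ffunE F2_addxx.
Qed.

Local Open Scope quotient_scope.

Definition cohomology_class n (f : cocycle n) : cohomology n :=
  \pi_(Quotient.quot (@coboundaries n)) f.

(* The unit 1 and the cup product of the graded ring H^*(gT, Z/2); the latter *)
(* does not depend on the representatives by cup_class below.                 *)
Definition cohomology_one : cohomology 0 :=
  cohomology_class (Cocycle one_cocycles).

Definition cup m n (x : cohomology m) (y : cohomology n) : cohomology (m + n) :=
  cohomology_class (cup_cocycle (generic_quotient.repr x) (generic_quotient.repr y)).

Fixpoint cup_exp n (x : cohomology n) (k : nat) : cohomology (k * n) :=
  if k is k'.+1 then cup x (cup_exp x k') else cohomology_one.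

Lemma cohomology_classP n (f g : cocycle n) :
  reflect (cohomology_class f = cohomology_class g)
          (is_coboundary (cocycle_val f - cocycle_val g)).
Proof.
have ->: is_coboundary (cocycle_val f - cocycle_val g)
       = (f - g \in @coboundaries n) by [].
by rewrite Quotient.idealrBE; apply: eqP.
Qed.

Let coboundaryP N M (h : cochain N) (k : cochain M) : N = M.+1 ->
  (forall X, ev h X = ev (differential k) X) -> is_coboundary h.
Proof.
move=> defN; move: h; rewrite defN => h /evP->.
by apply/existsP; exists k.
Qed.

Let coboundary0 n : is_coboundary (0 : cochain n).
Proof.
by case: n => [|n] //=; apply/existsP; exists 0; rewrite raddf0.
Qed.

Let coboundaryD n (f g : cochain n) :
  is_coboundary f -> is_coboundary g -> is_coboundary (f + g).
Proof.
case: n f g => [|n] f g /=; first by move=> /eqP-> /eqP->; rewrite addr0.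
move=> /existsP[f' /eqP->] /existsP[g' /eqP->].
by apply/existsP; exists (f' + g'); rewrite raddfD.
Qed.

Let cup_coboundaryl m n (f : cochain m) (g : cochain n) :
  is_coboundary f -> g \in @cocycles n -> is_coboundary (cup_cochain f g).
Proof.
rewrite inE; case: m f => [|m] f cobf /eqP dg.
  rewrite (eqP cobf) (_ : cup_cochain 0 g = 0) ?coboundary0 //.
  by apply/ffunP=> x; rewrite !ffunE mul0r.
have /existsP[f' /eqP defF] := cobf.
apply: (@coboundaryP _ _ _ (cup_cochain f' g)) => // X.
rewrite (leibniz X erefl (ev_cup f' g)) dg -defF ev_cup.
by rewrite [X in _ = _ + _ * X]ffunE mulr0 addr0.
Qed.

Let cup_coboundaryr m n (f : cochain m) (g : cochain n) :
  f \in @cocycles m -> is_coboundary g -> is_coboundary (cup_cochain f g).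
Proof.
rewrite inE => /eqP df; case: n g => [|n] g cobg.
  rewrite (eqP cobg) (_ : cup_cochain f 0 = 0) ?coboundary0 //.
  by apply/ffunP=> x; rewrite !ffunE mulr0.
have /existsP[g' /eqP defG] := cobg.
apply: (@coboundaryP _ _ _ (cup_cochain f g')); first by rewrite addnS.
move=> X; rewrite (leibniz X erefl (ev_cup f g')) df -defG ev_cup.
by rewrite [X in _ = X * _ + _]ffunE mul0r add0r.
Qed.

Lemma cup_class m n (f : cocycle m) (g : cocycle n) :
  cup (cohomology_class f) (cohomology_class g)
    = cohomology_class (cup_cocycle f g).
Proof.
rewrite /cup; set f' := generic_quotient.repr _.
set g' := generic_quotient.repr _.
have /cohomology_classP cobf: cohomology_class f' = cohomology_class f.
  exact: reprK.
have /cohomology_classP cobg: cohomology_class g' = cohomology_class g.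
  exact: reprK.
apply/cohomology_classP => /=.
have ->: cup_cochain f' g' - cup_cochain f g
       = cup_cochain (cocycle_val f' - cocycle_val f) g'
         + cup_cochain f (cocycle_val g' - cocycle_val g).
  by apply/ffunP=> x; rewrite !ffunE mulrBl mulrBr addrA subrK.
apply: coboundaryD; first exact: cup_coboundaryl cobf (valP g').
exact: cup_coboundaryr (valP f) cobg.
Qed.

Definition nilpotent_class n (x : cohomology n) : Prop :=
  exists k : nat, cup_exp x k = 0.

End Cochains.

Definition two_reduced (gT : finGroupType) (G : {group gT}) : Prop :=
  forall x : cohomology (subg_of G) 2, nilpotent_class x -> x = 0.

Definition unit_form n (F : finFieldType) (x : 'rV[F]_n) : F :=
  \sum_(i < n) x 0 i ^+ 2.

(* Here {'GL_n[F]} consists of matrices of size n.-1.+1, which is n if n > 0. *)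
Definition orthogonal_set n (F : finFieldType) : {set {'GL_n[F]}} :=
  [set g : {'GL_n[F]} |
    [forall x : 'rV[F]_n.-1.+1, unit_form (x *m GLval g) == unit_form x]].

Lemma orthogonal_group_set n (F : finFieldType) : group_set (@orthogonal_set n F).
Proof.
apply/group_setP; split=> [|g h].
  by rewrite inE; apply/forallP=> x; rewrite GL_1E mulmx1.
rewrite !inE => /forallP gP /forallP hP; apply/forallP=> x.
by rewrite GL_MxE mulmxA (eqP (hP _)) gP.
Qed.

Definition orthogonal_group n (F : finFieldType) : {group {'GL_n[F]}} :=
  Group (orthogonal_group_set n F).

Local Close Scope ring_scope.
Local Open Scope group_scope.
Local Open Scope nat_scope.

(* The cycle (a b_1 ... b_k) is the product, taken from left to right, of the *)
(* transpositions (a b_1), ..., (a b_k).                                      *)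
Definition cycle_perm (s : seq nat) : 'S_12 :=
  if s is a :: s' then (\prod_(b <- s') tperm (inord a) (inord b))%g else 1%g.

Definition cycles_perm (c : seq (seq nat)) : 'S_12 :=
  (\prod_(s <- c) cycle_perm s)%g.

(* M_12 acts on the projective line over F_11, with 0, ..., 10 standing for   *)
(* the elements of F_11 and 11 for infinity; the generators are z + 1,        *)
(* 4 z^2 - 3 z^7 and - 1 / z.                                                 *)
Definition mathieu12 : {group 'S_12} :=
  let a := cycles_perm [:: iota 0 11] in
  let b := cycles_perm [:: [:: 2; 6; 10; 7]; [:: 3; 9; 4; 5]] in
  let c := cycles_perm
    [:: [:: 0; 11]; [:: 1; 10]; [:: 2; 5]; [:: 3; 7]; [:: 4; 8]; [:: 6; 9]] in
  <<[set a; b; c]>>%G.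

(* Main.v *)
(* A class in H^2(G, Z/2) restricts to a multiple of the square of the        *)
(* generator on a subgroup of order 2, whose cohomology is a polynomial ring; *)
(* so a nilpotent class vanishes on all subgroups of order 2.  It then        *)
(* corresponds to a central extension E of G by Z/2 in which involutions of G *)
(* lift to involutions, and we have to split E.                               *)
(*                                                                            *)
(* In E, relators that are squares w^2 lift for free, as do commutation       *)
(* relations between involutions.  This splits E for elementary abelian and   *)
(* dihedral groups, for the alternating groups in Carmichael's presentation   *)
(* (x_i^3, (x_i x_j)^2) and for the Sylow 2-subgroup of M_12.  By Gaschuetz'  *)
(* theorem it is enough to split E over a subgroup of odd index.  Splittings  *)
(* also pass to direct products and to wreath products with Z/2 of groups     *)
(* whose H^1(-, Z/2) is detected by involutions.  The linear groups of rank n *)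
(* contain, with odd index, such products of those of ranks 1 and 2.  The     *)
(* group O_2(F_r) is dihedral.  For GL_2(F_r), of which the normalizer of a   *)
(* nonsplit torus has odd index, -1 is not a square, and all square roots of  *)
(* the scalar -1 are conjugate, hence their lifts have the same square; this  *)
(* yields a lift of the group of scalars, modulo which one argues as for      *)
(* dihedral groups.                                                           *)
From HB Require Import structures.
Require Import Defs.
From mathcomp Require Import all_boot all_order all_algebra all_fingroup all_solvable.
From mathcomp Require Import finfield ring zify.

Set Implicit Arguments.
Unset Strict Implicit.
Unset Printing Implicit Defensive.

Import GRing.Theory.

Local Open Scope group_scope.

(** * Extensions in which involutions lift to involutions *)

(** A nilpotent class of degree 2 is represented by a normalized cocycle, hence by a central
    extension [E] of [G] by Z/2 = {1, z}. By [nilpotent_involution] every lift to [E] of an element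
    of square 1 has square 1 again, and a splitting of [E] writes the cocycle as a coboundary. So
    [H2_detected_two_reduced] leaves a statement on groups only: every [invol_ext] of [G] splits.

    Splittings come from presentations. Once the generators are lifted, each relator that is a
    square w^2 holds in [E] too. If the relators obtained in this way bound the order of the lifted
    subgroup by that of [G], this subgroup misses [z] ([ext_card]). This settles cyclic 2-groups,
    dihedral groups with a rotation of even order, alternating groups ([card_carmichael_leq]) and a
    Sylow 2-subgroup of M_12 ([H2_twisted_square]). Gaschuetz' theorem ([ext_odd_index]) passes from
    a subgroup of odd index to the whole group.

    The linear and orthogonal groups are treated by induction on the rank. Lifts of commuting
    factors commute as soon as H^1 is detected by involutions ([ext_cents]); hence [sq_detected]
    passes to direct products ([sq_dprod]) and to wreath products with Z/2 ([sq_wreath]), realized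
    by block matrices. The orders of the groups show that one of these has odd index
    ([tower_induction]), down to the ranks 1 and 2, where [H2_GL2] is the hard case and [sq_O2] is
    dihedral. *)

Lemma expg2 (gT : finGroupType) (x : gT) : x ^+ 2 = x * x.
Proof. by []. Qed.

(** Commutation of involutions is a relator of the form w^2, which is what makes it lift. *)
Lemma commute_involutions (gT : finGroupType) (x y : gT) :
  x ^+ 2 = 1 -> y ^+ 2 = 1 -> (commute x y <-> (x * y) ^+ 2 = 1).
Proof.
rewrite !expg2 => x2 y2; rewrite /commute; split=> [xy | xy2].
  by rewrite {2}xy -mulgA (mulgA y) y2 mul1g.
have invE (u : gT) : u * u = 1 -> u^-1 = u.
  by move=> u2; apply: (mulgI u); rewrite u2 mulgV.
by rewrite -{1}(invE _ xy2) invMg !invE.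
Qed.

(* [f] is the projection of a central extension of [G] by [Z/2 = <z>] whose   *)
(* class vanishes on the subgroups of order 2 of [G]: these are the classes   *)
(* that the theorem has to show to be zero.                                   *)
Record invol_ext (rT gT : finGroupType) (E : {group rT}) (G : {group gT})
    (f : rT -> gT) (z : rT) : Prop := InvolExt {
  extM : {in E &, {morph f : x y / x * y}};
  ext_im : f @: E = G;
  ext_zE : z \in E;
  ext_z1 : z != 1;
  ext_fz : f z = 1;
  ext_ker : forall x, x \in E -> f x = 1 -> x = 1 \/ x = z;
  ext_inv : forall x, x \in E -> f x ^+ 2 = 1 -> x ^+ 2 = 1
}.

(** As the kernel of [f] is {1, z}, the condition on [z] makes [f] an isomorphism from [K] onto [G]:
    [K] is the image of a section. *)
Definition H2_detected (gT : finGroupType) (G : {group gT}) : Prop :=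
  forall (rT : finGroupType) (E : {group rT}) (f : rT -> gT) (z : rT),
  invol_ext E G f z ->
  exists K : {group rT}, [/\ K \subset E, f @: K = G & z \notin K].

(* The subgroups [L] are the subgroups of [G] of index at most 2, so this     *)
(* says that H^1(G, Z/2) is detected on the subgroups of order 2.             *)
Definition H1_detected (gT : finGroupType) (G : {group gT}) : Prop :=
  forall L : {group gT}, L \subset G ->
  (forall x, x \in G -> x ^+ 2 = 1 -> x \in L) ->
  (forall x y, x \in G :\: L -> y \in G :\: L -> x * y \in L) ->
  L :=: G.

(** Products need both conditions: the second lifts the factors, the first makes the lifts
    commute. *)
Definition sq_detected (gT : finGroupType) (G : {group gT}) : Prop :=
  H1_detected G /\ H2_detected G.

Section Extension.

Variables (rT gT : finGroupType) (E : {group rT}) (G : {group gT}).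
Variables (f : rT -> gT) (z : rT).
Hypothesis extE : invol_ext E G f z.

Let fM := extM extE.

Lemma ext_f1 : f 1 = 1.
Proof. by apply: (mulgI (f 1)); rewrite -fM // !mulg1. Qed.

Lemma ext_fV : {in E, {morph f : x / x^-1}}.
Proof.
move=> x Ex; apply: (mulgI (f x)).
by rewrite -fM ?groupV // !mulgV ext_f1.
Qed.

Lemma ext_fX n : {in E, {morph f : x / x ^+ n}}.
Proof.
move=> x Ex; elim: n => [|n IHn]; first exact: ext_f1.
by rewrite !expgS fM ?groupX // IHn.
Qed.

Lemma ext_fJ : {in E &, {morph f : x y / x ^ y}}.
Proof. by move=> x y Ex Ey; rewrite /conjg !fM ?groupM ?groupV ?ext_fV. Qed.

Lemma ext_mem x : x \in E -> f x \in G.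
Proof. by move=> Ex; rewrite -(ext_im extE) imset_f. Qed.

Lemma ext_lift y : y \in G -> exists2 x, x \in E & f x = y.
Proof. by rewrite -(ext_im extE) => /imsetP[x Ex ->]; exists x. Qed.

Lemma ext_eq x y : x \in E -> y \in E -> f x = f y -> y = x \/ y = x * z.
Proof.
move=> Ex Ey fxy.
case: (ext_ker extE (_ : x^-1 * y \in E)); first by rewrite groupM ?groupV.
- by rewrite fM ?groupV // ext_fV // fxy mulVg.
- by move=> xy1; left; rewrite -[y](mulKVg x) xy1 mulg1.
- by move=> xyz; right; rewrite -xyz mulKVg.
Qed.

Lemma ext_zz : z * z = 1.
Proof.
rewrite -expg2; apply: (ext_inv extE (ext_zE extE)).
by rewrite (ext_fz extE) expg1n.
Qed.

Lemma ext_zC x : x \in E -> z * x = x * z.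
Proof.
move=> Ex; have Ez := ext_zE extE.
case: (ext_ker extE (_ : z ^ x \in E)); first by rewrite groupJ.
- by rewrite ext_fJ // (ext_fz extE) conj1g.
- by move/eqP; rewrite conjg_eq1 (negPf (ext_z1 extE)).
- by move=> zx; rewrite -{2}zx conjgC.
Qed.

Definition ext_preim (H : {set gT}) : {set rT} := [set x in E | f x \in H].

Lemma ext_preim_group_set (H : {group gT}) : group_set (ext_preim H).
Proof.
apply/group_setP; split=> [|x y]; first by rewrite inE group1 ext_f1 group1.
rewrite !inE => /andP[Ex Hx] /andP[Ey Hy].
by rewrite groupM // fM // groupM.
Qed.
Definition ext_preim_group (H : {group gT}) : {group rT} := Group (ext_preim_group_set H).

Lemma ext_preim_ext (H : {group gT}) : H \subset G -> invol_ext (ext_preim_group H) H f z.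
Proof.
move=> sHG; split.
- by move=> x y; rewrite !inE => /andP[Ex _] /andP[Ey _]; apply: fM.
- apply/setP=> y; apply/imsetP/idP=> [[x] | Hy].
    by rewrite inE => /andP[_ ?] ->.
  have [x Ex fx] := ext_lift (subsetP sHG y Hy).
  by exists x; rewrite // inE Ex fx.
- by rewrite inE (ext_zE extE) (ext_fz extE) group1.
- exact: ext_z1 extE.
- exact: ext_fz extE.
- by move=> x; rewrite inE => /andP[Ex _]; apply: ext_ker extE x Ex.
- by move=> x; rewrite inE => /andP[Ex _]; apply: ext_inv extE x Ex.
Qed.

Lemma ext_preim_sub H : ext_preim H \subset E.
Proof. by apply/subsetP=> x; rewrite inE => /andP[]. Qed.

Lemma ext_lift_in (H : {group gT}) : H \subset G -> H2_detected H ->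
  exists K : {group rT}, [/\ K \subset E, f @: K = H & z \notin K].
Proof.
move=> sHG H2H; have [K [sKE fK zK]] := H2H _ _ _ _ (ext_preim_ext sHG).
by exists K; split=> //; apply: subset_trans sKE (ext_preim_sub H).
Qed.

Lemma ext_inj (K : {group rT}) : K \subset E -> z \notin K ->
  {in K &, injective f}.
Proof.
move=> sKE zK x y Kx Ky fxy.
case: (ext_eq (subsetP sKE x Kx) (subsetP sKE y Ky) fxy) => [-> // | yE].
case/negP: zK; rewrite -(mulKg x z) -yE groupM ?groupV //.
Qed.

Lemma ext_im_group (K : {group rT}) : K \subset E ->
  exists H : {group gT}, f @: K = H.
Proof.
move=> sKE; suff gH: group_set (f @: K) by exists (Group gH).
apply/group_setP; split; first by rewrite -ext_f1 imset_f.
move=> _ _ /imsetP[x Kx ->] /imsetP[y Ky ->].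
by rewrite -fM ?(subsetP sKE) // imset_f // groupM.
Qed.

(** This is how presentations are used: an upper bound on the order of [K] forces [f] to be
    injective on [K], and [z] has the same image as 1. *)
Lemma ext_card (K : {group rT}) : K \subset E -> (#|K| <= #|f @: K|)%N ->
  z \notin K.
Proof.
move=> sKE leK; have /imset_injP injf: #|f @: K| == #|K|.
  by rewrite eqn_leq leK leq_imset_card.
apply: contra (ext_z1 extE) => Kz; apply/eqP/injf; rewrite ?group1 //.
by rewrite (ext_fz extE) ext_f1.
Qed.

Lemma ext_mem_lift (K : {group rT}) x : K \subset E -> z \notin K ->
  x \in E -> f x \in f @: K -> x \in K \/ x * z \in K.
Proof.
move=> sKE zK Ex /imsetP[y Ky fxy].
by case: (ext_eq Ex (subsetP sKE y Ky) fxy) => <-; auto.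
Qed.

Lemma ext_commute x y : x \in E -> y \in E ->
  f x ^+ 2 = 1 -> f y ^+ 2 = 1 -> commute (f x) (f y) -> commute x y.
Proof.
move=> Ex Ey fx2 fy2 cfxy.
have x2 := ext_inv extE Ex fx2; have y2 := ext_inv extE Ey fy2.
apply/commute_involutions => //; apply: (ext_inv extE); rewrite ?groupM //.
by rewrite fM //; apply/(commute_involutions fx2 fy2).
Qed.

Lemma ext_comm_z x y : x \in E -> y \in E -> commute (f x) (f y) ->
  x * y = y * x \/ x * y = y * x * z.
Proof.
by move=> Ex Ey cxy; apply: ext_eq; rewrite ?groupM // !fM.
Qed.

(* The commutator with [y] induces a morphism from [H] to [<z>], which        *)
(* vanishes as soon as it vanishes on involutions.                            *)
Lemma ext_cent_step (H : {group gT}) y : H \subset G -> H1_detected H ->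
    y \in E -> {in H, forall h, commute h (f y)} ->
    (forall x, x \in E -> f x \in H -> f x ^+ 2 = 1 -> commute x y) ->
  forall x, x \in E -> f x \in H -> commute x y.
Proof.
move=> sHG H1H Ey cHy cinv.
have Ez := ext_zE extE.
have [L defL]: exists L : {group gT}, f @: 'C_(ext_preim_group H)[y] = L.
  apply: ext_im_group; apply: subset_trans (subsetIl _ _) (ext_preim_sub _).
have LP x : x \in E -> (f x \in L) = (f x \in H) && (x * y == y * x).
  move=> Ex; rewrite -defL; apply/imsetP/andP=> [[x'] | [Hx cxy]]; last first.
    by exists x => //; rewrite inE inE Ex Hx /=; apply/cent1P/eqP.
  rewrite inE => /andP[]; rewrite inE => /andP[Ex' Hx'] /cent1P cx'y fx.
  rewrite fx; split=> //.
  case: (ext_eq Ex' Ex (esym fx)) => ->; first by rewrite cx'y.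
  by rewrite -mulgA ext_zC // !mulgA cx'y.
have defLH: L :=: H.
  apply: H1H.
  - rewrite -defL; apply/subsetP=> _ /imsetP[x + ->].
    by rewrite inE => /andP[]; rewrite inE => /andP[].
  - move=> h Hh h2; have [x Ex fx] := ext_lift (subsetP sHG h Hh).
    rewrite -fx LP // fx Hh /=; apply/eqP/cinv; rewrite ?fx //.
  (* Two elements whose commutator with [y] is [z] have a product that commutes with [y], because
     [z * z = 1]. *)
  move=> h1 h2 /setDP[Hh1 +] /setDP[Hh2].
  have [x1 Ex1 fx1] := ext_lift (subsetP sHG h1 Hh1).
  have [x2 Ex2 fx2] := ext_lift (subsetP sHG h2 Hh2).
  rewrite -fx1 -fx2 -fM // !LP ?groupM // fM // fx1 fx2 groupM // Hh1 Hh2 /=.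
  have cy i (x : rT) : x \in E -> f x = i -> i \in H -> x * y != y * x ->
      x * y = y * x * z.
    move=> Ex fx Hi /eqP; case: (@ext_comm_z x y Ex Ey) => //.
    by rewrite fx; apply: cHy.
  move=> nc1 nc2; apply/eqP.
  rewrite -mulgA (cy _ _ Ex2 fx2 Hh2 nc2) !mulgA (cy _ _ Ex1 fx1 Hh1 nc1).
  rewrite -!mulgA; congr (_ * (_ * _)).
  by rewrite mulgA ext_zC // -mulgA ext_zz mulg1.
move=> x Ex Hx; have: f x \in L by rewrite defLH.
by rewrite LP // => /andP[_ /eqP].
Qed.

Lemma ext_cent_invol (H : {group gT}) y : H \subset G -> H1_detected H ->
    y \in E -> f y ^+ 2 = 1 -> {in H, forall h, commute h (f y)} ->
  forall x, x \in E -> f x \in H -> commute x y.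
Proof.
move=> sHG H1H Ey fy2 cHy; apply: (ext_cent_step sHG H1H Ey cHy).
move=> x Ex Hx fx2; apply: ext_commute => //; exact: cHy.
Qed.

(** Detection is applied in one variable after the other: it is enough that [x] and [y] commute when
    [f x] has square 1, and then only when [f y] has square 1 too, which is [ext_commute]. *)
Lemma ext_cents (H1 H2 : {group gT}) : H1 \subset G -> H2 \subset G ->
    H1_detected H1 -> H1_detected H2 -> H1 \subset 'C(H2) ->
  forall x y, x \in E -> y \in E -> f x \in H1 -> f y \in H2 -> commute x y.
Proof.
move=> sH1 sH2 d1 d2 cH x y Ex Ey Hx Hy.
apply: (ext_cent_step sH1 d1 Ey) => // [h Hh | {}x {}Ex {}Hx x2].
  by apply: (centsP cH).
apply/commute_sym; apply: (ext_cent_invol sH2 d2 Ex x2) => // h Hh.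
by apply/commute_sym/(centsP cH).
Qed.

(** The join is the union of [K] and [K :* t]; if [z = k * t], then [f t] is the inverse of
    [f k]. *)
Lemma ext_adjoin (K : {group rT}) t : K \subset E -> z \notin K ->
    t \in E -> t \in 'N(K) -> t ^+ 2 \in K -> f t \notin f @: K ->
  z \notin K <*> <[t]>.
Proof.
move=> sKE zK Et nKt Kt2 Kft.
have defKt: K <*> <[t]> = K :|: K :* t.
  apply/eqP; rewrite eqEsubset; apply/andP; split; last first.
    apply/subUsetP; split; first exact: joing_subl.
    apply/subsetP=> _ /rcosetP[k Kk ->].
    by rewrite groupM // mem_gen // inE ?cycle_id ?Kk ?orbT.
  rewrite norm_joinEr ?cycle_subG //.
  apply/subsetP=> u /mulsgP[k c Kk] /= /cycleP[i ->] ->.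
  have -> : t ^+ i = t ^+ 2 ^+ i./2 * t ^+ (odd i).
    by rewrite -expgM -expgD mul2n addnC odd_double_half.
  have Kk' : k * t ^+ 2 ^+ i./2 \in K by apply: groupM => //; apply: groupX.
  rewrite mulgA inE; case: (odd i); last by rewrite mulg1 Kk'.
  by rewrite mem_rcoset mulgK Kk' orbT.
rewrite defKt inE (negPf zK) /=; apply: contra Kft => /rcosetP[k Kk zE].
have Ek := subsetP sKE k Kk.
apply/imsetP; exists k^-1; rewrite ?groupV // ext_fV //.
apply: (mulgI (f k)); rewrite -fM // -zE (ext_fz extE) mulgV //.
Qed.

End Extension.

Lemma card_joing_cycle_leq (gT : finGroupType) (K : {group gT}) u n :
  (0 < n)%N -> u \in 'N(K) -> u ^+ n \in K -> (#|K <*> <[u]>| <= #|K| * n)%N.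
Proof.
move=> n_gt0 nKu Kun; rewrite norm_joinEr ?cycle_subG //.
pose g (p : gT * 'I_n) := p.1 * u ^+ p.2.
have <-: #|setX K [set: 'I_n]| = (#|K| * n)%N by rewrite cardsX cardsT card_ord.
apply: leq_trans (leq_imset_card g _); apply/subset_leq_card/subsetP => v.
case/mulsgP=> k c Kk /= /cycleP[i ->] ->; apply/imsetP.
exists (k * u ^+ n ^+ (i %/ n), Ordinal (ltn_pmod i n_gt0)).
  rewrite !inE /= andbT; apply: groupM => //; exact: groupX.
by rewrite /g /= -mulgA -expgM -expgD mulnC -divn_eq.
Qed.

Section Extension.

Variables (rT gT : finGroupType) (E : {group rT}) (G : {group gT}).
Variables (f : rT -> gT) (z : rT).
Hypothesis extE : invol_ext E G f z.

Let phi := Morphism (extM extE).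

Lemma ext_order_z : #[z] = 2.
Proof. by apply: nt_prime_order; rewrite ?expg2 ?(ext_zz extE) ?(ext_z1 extE). Qed.

Let cycle_z : <[z]> = [set 1; z].
Proof. exact: cycle2g ext_order_z. Qed.

Lemma ext_ker_phi : 'ker phi = <[z]>.
Proof.
apply/setP=> x; rewrite cycle_z !inE /=; apply/idP/idP => [/andP[Ex /eqP fx]|].
  by case: (ext_ker extE Ex fx) => ->; rewrite eqxx ?orbT.
case/orP=> /eqP ->; first by rewrite group1 (ext_f1 extE) eqxx.
by rewrite (ext_zE extE) (ext_fz extE) eqxx.
Qed.

Lemma ext_index (H : {group gT}) : #|E : ext_preim_group extE H| = #|G : H|.
Proof.
have imE : phi @* E = G by rewrite morphimEdom (ext_im extE).
rewrite -[RHS](index_morphpre (f := phi)); last by rewrite imE.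
rewrite -imE; congr (#|_ : _|); last by apply/setP=> x; rewrite !inE.
by rewrite morphimGK // ext_ker_phi cycle_subG (ext_zE extE).
Qed.

Lemma ext_imY (A B : {set rT}) : A \subset E -> B \subset E ->
  f @: (A <*> B) = (f @: A) <*> (f @: B).
Proof.
move=> sAE sBE; have := morphimY phi sAE sBE.
by rewrite !morphimEsub // join_subG sAE.
Qed.

Lemma ext_im_cycle x : x \in E -> f @: <[x]> = <[f x]>.
Proof.
by move=> Ex; have := morphim_cycle phi Ex; rewrite morphimEsub // cycle_subG.
Qed.

Lemma ext_splits : [splits E, over <[z]>] ->
  exists K : {group rT}, [/\ K \subset E, f @: K = G & z \notin K].
Proof.
case/splitsP=> C /complP[tiZC defE]; exists C.
have sCE: C \subset E by rewrite -defE mulG_subr.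
split=> //; last first.
  apply/negP=> Cz; case/negP: (ext_z1 extE).
  by rewrite -in_set1 -set1gE -tiZC inE cycle_id.
apply/eqP; rewrite eqEsubset; apply/andP; split.
  apply/subsetP=> _ /imsetP[x Cx ->]; apply: (ext_mem extE).
  exact: (subsetP sCE).
rewrite -(ext_im extE) -defE.
apply/subsetP=> _ /imsetP[_ /mulsgP[u c + Cc ->] ->].
rewrite cycle_z !inE => /orP[] /eqP ->; first by rewrite mul1g imset_f.
rewrite (extM extE) ?(ext_zE extE) ?(subsetP sCE c Cc) //.
by rewrite (ext_fz extE) mul1g imset_f.
Qed.

(** The subgroup [L] is a complement of [<[z]>] in the preimage of [H]. The index of this preimage
    is odd, hence prime to the order of the abelian normal subgroup [<[z]>], and Gaschuetz' theorem
    applies. *)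
Lemma ext_odd_index (H : {group gT}) (L : {group rT}) :
    H \subset G -> odd #|G : H| -> L \subset E -> f @: L = H -> z \notin L ->
  exists K : {group rT}, [/\ K \subset E, f @: K = G & z \notin K].
Proof.
move=> sHG oddGH sLE fL zL; pose Z := <[z]>%G.
have zz := ext_zz extE; have Ez := ext_zE extE.
have cEZ: E \subset 'C(Z).
  rewrite centsC cycle_subG; apply/centP=> x Ex; exact: ext_zC extE x Ex.
have nsZE: Z <| E by rewrite /normal cycle_subG Ez cents_norm.
have sZP: Z \subset ext_preim_group extE H.
  by rewrite cycle_subG !inE Ez (ext_fz extE) group1.
have oZ: #|Z| = 2.
  by rewrite -orderE ext_order_z.
have abZ: abelian Z := cycle_abelian z.
have coZ: coprime #|Z| #|E : ext_preim_group extE H|.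
  by rewrite oZ ext_index coprime2n.
have splitP: [splits ext_preim_group extE H, over Z].
  apply/splitsP; exists L; apply/complP; split.
    apply/trivgP/subsetP=> x; rewrite !inE /= cycle_z !inE.
    by case/andP=> /orP[/eqP-> // | /eqP->]; rewrite (negPf zL).
  apply/eqP; rewrite eqEsubset mul_subG //=; last first.
    by apply/subsetP=> x Lx; rewrite !inE (subsetP sLE) //= -fL imset_f.
  apply/subsetP=> x; rewrite inE -fL => /andP[Ex fx].
  case: (ext_mem_lift extE sLE zL Ex fx) => [Lx | Lxz].
    by rewrite -[x]mul1g mem_mulg.
  apply/mulsgP; exists z (x * z); rewrite ?cycle_id //.
  by rewrite -(ext_zC extE) // mulgA zz mul1g.
by apply: ext_splits; rewrite (Gaschutz_split nsZE sZP _ abZ coZ) ?ext_preim_sub.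
Qed.

(** Modulo [M] the elements [s] and [t] satisfy the relations of a dihedral group of order 2n, which
    bounds the order of the join. [M] is trivial for dihedral groups, and a lift of the scalars for
    GL_2. *)
Lemma ext_dihedral (M : {group rT}) s t n :
    (0 < n)%N -> M \subset E -> E \subset 'N(M) -> s \in E -> t \in E ->
    s ^+ 2 \in M -> (s * t) ^+ 2 \in M -> t ^+ n \in M ->
    (#|M| * n * 2 <= #|f @: (M <*> <[t]> <*> <[s]>)|)%N ->
  z \notin M <*> <[t]> <*> <[s]>.
Proof.
move=> n_gt0 sME nME Es Et Ms2 Mst2 Mtn leK.
have sKE: M <*> <[t]> <*> <[s]> \subset E by rewrite !join_subG sME !cycle_subG Es Et.
apply: (ext_card extE sKE); apply: leq_trans leK.
have ntM := subsetP nME t Et; have nsM := subsetP nME s Es.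
have Mt : t \in M <*> <[t]> by rewrite mem_gen // inE cycle_id orbT.
have sMMt : M \subset M <*> <[t]> := joing_subl _ _.
apply: leq_trans (@card_joing_cycle_leq _ _ _ 2 _ _ _) _ => //.
- rewrite inE; apply/subsetP=> _ /imsetP[x + ->].
  rewrite /= {1}norm_joinEr ?cycle_subG // => /mulsgP[m c Mm /= /cycleP[i ->] ->].
  rewrite conjMg conjXg groupM ?groupX //.
    by apply: (subsetP sMMt); rewrite memJ_norm.
  (* So [s] inverts [t] modulo [M]. *)
  have -> : t ^ s = s ^- 2 * (s * t) ^+ 2 * t^-1.
    by rewrite conjgE !expg2 invMg !mulgA mulgK mulgKV.
  by rewrite groupM ?groupV // groupM ?groupV // (subsetP sMMt).
- exact: (subsetP sMMt _ Ms2).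
by rewrite leq_mul2r /=; apply: card_joing_cycle_leq.
Qed.

End Extension.

(** * Subgroups of odd index, direct products and wreath products *)

Lemma H2_odd_index (gT : finGroupType) (G H : {group gT}) :
  H \subset G -> odd #|G : H| -> H2_detected H -> H2_detected G.
Proof.
move=> sHG oddGH dH rT E f z extE.
have [K [sKE fK zK]] := ext_lift_in extE sHG dH.
exact: ext_odd_index extE _ _ sHG oddGH sKE fK zK.
Qed.

(** By detection [L] contains [H], so its index is odd; a proper [L] would have index 2. *)
Lemma H1_odd_index (gT : finGroupType) (G H : {group gT}) :
  H \subset G -> odd #|G : H| -> H1_detected H -> H1_detected G.
Proof.
move=> sHG oddGH dH L sLG Linv L2.
have sHL: H \subset L.
  rewrite -(dH (H :&: L)%G) ?subsetIr ?subsetIl // => [x Hx x2 | x y].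
    by rewrite inE Hx Linv // (subsetP sHG).
  rewrite !inE => /andP[nLx Hx] /andP[nLy Hy]; rewrite groupM //=.
  rewrite Hx /= in nLx; rewrite Hy /= in nLy.
  by apply: L2; rewrite !inE ?nLx ?nLy (subsetP sHG).
apply/eqP; rewrite eqEsubset sLG; apply/subsetP=> x Gx.
have [// | nLx] := boolP (x \in L).
have iGL: #|G : L| = 2.
  have ->: #|G : L| = #|[set L :* x; gval L]|.
    congr #|pred_of_set _|; apply/setP=> C; rewrite !inE.
    apply/rcosetsP/orP => [[y Gy ->] | [] /eqP->]; last 2 first.
    - by exists x.
    - by exists 1; rewrite ?rcoset1.
    have [Ly | nLy] := boolP (y \in L); first by right; rewrite rcoset_id.
    left; apply/eqP/rcoset_eqP; rewrite mem_rcoset; apply: L2.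
      by rewrite !inE nLy.
    by rewrite !inE !groupV nLx.
  rewrite cards2; case: eqP => // defL; case/negP: nLx.
  by rewrite -defL rcoset_refl.
have: #|G : L| %| #|G : H|.
  by apply/dvdnP; exists #|L : H|; rewrite mulnC Lagrange_index.
by rewrite iGL => /dvdn_odd /(_ oddGH).
Qed.

Lemma sq_odd_index (gT : finGroupType) (G H : {group gT}) :
  H \subset G -> odd #|G : H| -> sq_detected H -> sq_detected G.
Proof.
by move=> sHG oGH [d1 d2]; split; [apply: H1_odd_index d1 | apply: H2_odd_index d2].
Qed.

Lemma H2_injm (gT aT : finGroupType) (G : {group gT})
    (h : {morphism G >-> aT}) : 'injm h -> H2_detected G -> H2_detected (h @* G).
Proof.
move=> injh dG rT E f z extE.
pose f' x := invm injh (f x).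
have fE x : x \in E -> f x \in h @* G by apply: ext_mem extE _.
have hf' x : x \in E -> h (f' x) = f x by move=> Ex; rewrite /f' invmK ?fE.
have f'1 x : x \in E -> f' x = 1 -> f x = 1.
  by move=> Ex f'x; rewrite -hf' // f'x morph1.
have ext' : invol_ext E G f' z.
  split.
  - by move=> x y Ex Ey; rewrite /f' (extM extE) // morphM ?fE.
  - apply/setP=> y; apply/imsetP/idP=> [[x Ex ->] | Gy].
      by rewrite /f' -(im_invm injh) mem_morphim ?fE.
    have [x Ex fx] := ext_lift extE (mem_morphim h Gy Gy).
    by exists x => //; rewrite /f' fx invmE.
  - exact: ext_zE extE.
  - exact: ext_z1 extE.
  - by rewrite /f' (ext_fz extE) morph1.
  - by move=> x Ex f'x; apply: (ext_ker extE) => //; apply: f'1.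
  move=> x Ex f'x2; apply: (ext_inv extE) => //.
  rewrite -(ext_fX extE) //; apply: f'1; rewrite ?groupX //.
  by rewrite /f' (ext_fX extE) // morphX ?fE.
have [K [sKE fK zK]] := dG _ _ _ _ ext'; exists K; split=> //.
rewrite /= morphimEdom; rewrite -{2}fK; apply/setP=> y; apply/imsetP/imsetP=> [[x Kx ->] | [_ /imsetP[x Kx ->] ->]].
  by exists (f' x); rewrite ?imset_f // hf' // (subsetP sKE).
by exists x; rewrite // hf' // (subsetP sKE).
Qed.

Lemma H1_injm (gT aT : finGroupType) (G : {group gT})
    (h : {morphism G >-> aT}) : 'injm h -> H1_detected G -> H1_detected (h @* G).
Proof.
move=> injh dG L sLG Linv L2.
have hL x : x \in G -> (h x \in L) = (x \in h @*^-1 L).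
  by move=> Gx; rewrite !inE Gx.
have sLh : L \subset h @* G := sLG.
rewrite -(morphpreK sLh); congr (h @* _).
apply: (dG (h @*^-1 L)%G); first exact: subsetIl.
  move=> x Gx x2; rewrite /= -hL //; apply: Linv; first exact: mem_morphim.
  by rewrite -morphX // x2 morph1.
move=> x y /setDP[Gx +] /setDP[Gy]; rewrite /= -!hL ?groupM // morphM //.
by move=> nLx nLy; apply: L2; rewrite !inE ?nLx ?nLy mem_morphim.
Qed.

Lemma sq_injm (gT aT : finGroupType) (G : {group gT})
    (h : {morphism G >-> aT}) : 'injm h -> sq_detected G -> sq_detected (h @* G).
Proof. by move=> injh [d1 d2]; split; [apply: H1_injm | apply: H2_injm]. Qed.

Lemma H1_sub (gT : finGroupType) (G H L : {group gT}) : H \subset G ->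
    H1_detected H -> 
    (forall x, x \in G -> x ^+ 2 = 1 -> x \in L) ->
    (forall x y, x \in G :\: L -> y \in G :\: L -> x * y \in L) ->
  H \subset L.
Proof.
move=> sHG dH Linv L2.
rewrite -(dH (H :&: L)%G) ?subsetIr ?subsetIl // => [x Hx x2 | x y].
  by rewrite inE Hx Linv // (subsetP sHG).
rewrite !inE => /andP[nLx Hx] /andP[nLy Hy]; rewrite groupM //=.
rewrite Hx /= in nLx; rewrite Hy /= in nLy.
by apply: L2; rewrite !inE ?nLx ?nLy (subsetP sHG).
Qed.

Lemma ext_mul (rT gT : finGroupType) (E : {group rT}) (G : {group gT})
    (f : rT -> gT) (z : rT) (K1 K2 : {group rT}) (H1 H2 : {set gT}) :
    invol_ext E G f z ->
    K1 \subset E -> f @: K1 = H1 -> z \notin K1 ->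
    K2 \subset E -> f @: K2 = H2 -> z \notin K2 ->
    K2 \subset 'C(K1) -> H1 :&: H2 = 1 ->
  [/\ K1 <*> K2 \subset E, f @: (K1 <*> K2) = H1 * H2 & z \notin K1 <*> K2].
Proof.
move=> extE sK1 fK1 zK1 sK2 fK2 zK2 cK tiH12.
rewrite join_subG sK1 cent_joinEr //; split=> //.
  rewrite -fK1 -fK2; apply/setP=> v; apply/imsetP/mulsgP.
    case=> _ /mulsgP[x y Kx Ky ->] ->.
    exists (f x) (f y); rewrite ?imset_f //.
    by rewrite (extM extE) ?(subsetP sK1 x) ?(subsetP sK2 y).
  case=> _ _ /imsetP[x Kx ->] /imsetP[y Ky ->] ->.
  exists (x * y); first exact: mem_mulg.
  by rewrite (extM extE) ?(subsetP sK1 x) ?(subsetP sK2 y).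
apply/mulsgP=> [[x y Kx Ky zE]].
have Ex := subsetP sK1 x Kx; have Ey := subsetP sK2 y Ky.
have fxy: f x * f y = 1 by rewrite -(extM extE) // -zE (ext_fz extE).
have fx1: f x = 1.
  apply/set1P; rewrite -set1gE -tiH12 inE -{1}fK1 imset_f //=.
  have -> : f x = f y^-1.
    by rewrite (ext_fV extE) //; apply: (mulIg (f y)); rewrite fxy mulVg.
  by rewrite -fK2 imset_f ?groupV.
case: (ext_ker extE Ex fx1) => x1; last by rewrite -x1 Kx in zK1.
by move: zK2; rewrite zE x1 mul1g Ky.
Qed.

(** The lifts of the two factors centralize each other by [ext_cents], so their product is a lift of
    [G]. *)
Lemma sq_dprod (gT : finGroupType) (H1 H2 G : {group gT}) :
  H1 \x H2 = G -> sq_detected H1 -> sq_detected H2 -> sq_detected G.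
Proof.
case/dprodP=> _ defG cH12 tiH12 [d1 d2] [e1 e2].
have sH1 : H1 \subset G by rewrite -defG mulG_subl.
have sH2 : H2 \subset G by rewrite -defG mulG_subr.
split=> [L sLG Linv L2 | rT E f z extE].
  apply/eqP; rewrite eqEsubset sLG -defG mul_subG //.
    exact: (H1_sub sH1).
  exact: (H1_sub sH2).
have [K1 [sK1 fK1 zK1]] := ext_lift_in extE sH1 d2.
have [K2 [sK2 fK2 zK2]] := ext_lift_in extE sH2 e2.
have cK : K2 \subset 'C(K1).
  apply/centsP=> y Ky x Kx; apply/commute_sym.
  apply: (ext_cents extE sH1 sH2 d1 e1); first by rewrite centsC.
  - exact: (subsetP sK1).
  - exact: (subsetP sK2).
  - by rewrite -fK1 imset_f.
  by rewrite -fK2 imset_f.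
have [sKE fK zK] := ext_mul extE sK1 fK1 zK1 sK2 fK2 zK2 cK tiH12.
by exists (K1 <*> K2)%G; rewrite /= fK.
Qed.

(** With [K1] a lift of [H] and [u] a lift of [t], the conjugate [K1 :^ u] is taken as the lift of
    the second factor. Then [u], which is still an involution, exchanges the two lifts and
    normalizes their product. *)
Lemma sq_wreath (gT : finGroupType) (H N G : {group gT}) t :
    H \x H :^ t = N -> t ^+ 2 = 1 -> t \notin N -> N <*> <[t]> = G ->
  sq_detected H -> sq_detected G.
Proof.
move=> defN t2 nNt defG dH.
have [_ defN' cH tiH] := dprodP defN.
have sHN : H \subset N by rewrite -defN' mulG_subl.
have sHtN : H :^ t \subset N by rewrite -defN' mulG_subr.
have sNG : N \subset G by rewrite -defG joing_subl.
have Gt : t \in G by rewrite -defG mem_gen // inE cycle_id orbT.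
have dHt : sq_detected (H :^ t)%G.
  have -> : (H :^ t)%G = (conjgm H t @* H)%G.
    by apply/val_inj; rewrite /= morphim_conj setIid.
  exact: sq_injm (injm_conj H t) dH.
have [dN _] := sq_dprod (defN : H \x (H :^ t)%G = N) dH dHt.
have [[d1 d2] [e1 _]] := (dH, dHt).
split=> [L sLG Linv L2 | rT E f z extE].
  apply/eqP; rewrite eqEsubset sLG -defG join_subG cycle_subG Linv // andbT.
  exact: (H1_sub sNG).
have sHG := subset_trans sHN sNG; have sHtG := subset_trans sHtN sNG.
have [K1 [sK1 fK1 zK1]] := ext_lift_in extE sHG d2.
have [u Eu fu] := ext_lift extE Gt.
have u2 : u ^+ 2 = 1 by apply: (ext_inv extE); rewrite // fu.
have Ez := ext_zE extE.
have sK2 : K1 :^ u \subset E by rewrite -(conjGid Eu) conjSg.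
have fK2 : f @: (K1 :^ u) = H :^ t.
  rewrite -fK1 -fu; apply/setP=> y; apply/imsetP/imsetP.
    case=> _ /imsetP[x Kx ->] ->; exists (f x); rewrite ?imset_f //.
    by rewrite (ext_fJ extE) ?(subsetP sK1 x).
  case=> _ /imsetP[x Kx ->] ->; exists (x ^ u); rewrite ?memJ_conjg //.
  by rewrite (ext_fJ extE) ?(subsetP sK1 x).
have zK2 : z \notin K1 :^ u.
  rewrite mem_conjg (_ : z ^ u^-1 = z) //.
  by apply/conjg_fixP/commgP/(ext_zC extE); rewrite groupV.
have cK : K1 :^ u \subset 'C(K1).
  apply/centsP=> y Ky x Kx; apply/commute_sym.
  apply: (ext_cents (H2 := (H :^ t)%G) extE sHG _ d1 e1) => //.
  - by rewrite centsC.
  - exact: (subsetP sK1).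
  - by apply: (subsetP sK2).
  - by rewrite -fK1 imset_f.
  by rewrite /= -fK2 imset_f.
pose K := (K1 <*> K1 :^ u)%G.
have [sKE fK zK] := ext_mul extE sK1 fK1 zK1 sK2 fK2 zK2 cK tiH.
have nKu : u \in 'N(K).
  by rewrite inE conjYg join_subG -conjsgM -expg2 u2 conjsg1 joing_subr joing_subl.
exists (K <*> <[u]>)%G; split; first by rewrite join_subG sKE cycle_subG.
  by rewrite (ext_imY extE) ?cycle_subG // fK (ext_im_cycle extE) // defN' fu.
apply: (ext_adjoin extE); rewrite ?u2 //.
by rewrite fK fu defN'.
Qed.

(** * Cyclic, elementary abelian and dihedral groups *)

(** As the order of [t] is even, all three relators are squares. For H^1, the group is generated by
    the involutions [s] and [s * t]. *)
Lemma sq_dihedral (gT : finGroupType) (G : {group gT}) s t :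
    <[t]> <*> <[s]> = G -> s ^+ 2 = 1 -> (s * t) ^+ 2 = 1 ->
    ~~ odd #[t] -> #|G| = (#[t] * 2)%N ->
  sq_detected G.
Proof.
move=> defG s2 st2 evt oG.
have [Gt Gs] : t \in G /\ s \in G.
  by rewrite -defG; split; rewrite mem_gen // inE cycle_id ?orbT.
split=> [L sLG Linv L2 | rT E f z extE].
  have Ls : s \in L by apply: Linv.
  have Lst : s * t \in L by apply: Linv; rewrite ?groupM.
  have Lt : t \in L by rewrite -(mulKg s t) groupM ?groupV.
  by apply/eqP; rewrite eqEsubset sLG -defG join_subG !cycle_subG Ls Lt.
have [u Eu fu] := ext_lift extE Gt; have [v Ev fv] := ext_lift extE Gs.
pose K := (1%G <*> <[u]> <*> <[v]>)%G.
have sKE : K \subset E by rewrite /= joing1G join_subG !cycle_subG Eu.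
have fK : f @: K = G.
  by rewrite /= joing1G (ext_imY extE) ?cycle_subG // !(ext_im_cycle extE) // fu fv.
exists K; split=> //.
apply: (ext_dihedral extE (n := #[t])) => //; rewrite ?sub1G ?norms1 //.
- by rewrite (ext_inv extE) ?group1 // fv.
- by rewrite (ext_inv extE) ?group1 ?groupM // (extM extE) // fv fu.
- have oh : (#[t]./2 * 2)%N = #[t] by rewrite muln2 even_halfK.
  rewrite -oh expgM (ext_inv extE) ?group1 ?groupX //.
  by rewrite (ext_fX extE) // -expgM oh fu expg_order.
by rewrite fK oG cards1 mul1n.
Qed.

(** Here [E] has exponent 2 itself, so it is elementary abelian and every subgroup has a
    complement. *)
Lemma sq_abelem (gT : finGroupType) (G : {group gT}) :
  2.-abelem G -> sq_detected G.
Proof.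
case/(abelemP (isT : prime 2))=> _ expG; split=> [L sLG Linv _ | rT E f z extE].
  apply/eqP; rewrite eqEsubset sLG; apply/subsetP=> x Gx.
  by rewrite Linv ?expG.
apply: (ext_splits extE); apply: (@abelem_splits _ 2).
  apply: exponent2_abelem; apply/exponentP=> x Ex.
  by rewrite (ext_inv extE) // expG // (ext_mem extE).
by rewrite cycle_subG (ext_zE extE).
Qed.

(** The only relator is g^n with n even, a square; so a lift of [g] generates a group of order at
    most n. *)
Lemma H2_cyclic (gT : finGroupType) (G : {group gT}) :
  2.-group G -> cyclic G -> H2_detected G.
Proof.
move=> pG cycG; have [G1 | ntG] := eqVneq (gval G) 1.
  by apply: (sq_abelem _).2; rewrite G1 abelem1.
case/cyclicP: cycG ntG => g defG ntG rT E f z extE.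
have [_ dv2 _] := pgroup_pdiv pG ntG.
have Gg : g \in G by rewrite defG cycle_id.
have [u Eu fu] := ext_lift extE Gg.
have fK : f @: <[u]> = G by rewrite (ext_im_cycle extE) // fu -defG.
exists <[u]>%G; rewrite cycle_subG; split=> //.
apply: (ext_card extE); first by rewrite cycle_subG.
rewrite fK dvdn_leq // -orderE order_dvdn -(divnK dv2) expgM.
rewrite (ext_inv extE) ?groupX // (ext_fX extE) // -expgM divnK // fu.
by rewrite expg_cardG.
Qed.

Lemma odd_index_Sylow (gT : finGroupType) (G P : {group gT}) :
  2.-Sylow(G) P -> odd #|G : P|.
Proof. by case/and3P=> _ _; rewrite odd_2'nat. Qed.

Lemma H2_Sylow (gT : finGroupType) (G P : {group gT}) :
  2.-Sylow(G) P -> cyclic P \/ 2.-abelem P -> H2_detected G.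
Proof.
move=> sylP dP.
apply: (H2_odd_index (pHall_sub sylP) (odd_index_Sylow sylP)).
case: dP => [cycP | /sq_abelem[] //].
exact: H2_cyclic (pHall_pgroup sylP) cycP.
Qed.

Lemma sq_order2odd (gT : finGroupType) (G : {group gT}) n :
  #|G| = (2 * n)%N -> odd n -> sq_detected G.
Proof.
move=> oG oddn; have [P sylP] := Sylow_exists 2 G.
apply: (sq_odd_index (pHall_sub sylP) (odd_index_Sylow sylP)).
apply: sq_abelem; apply: prime_abelem => //.
have n_gt0 := odd_gt0 oddn.
rewrite (card_Hall sylP) oG p_part lognM // logn_prime //.
by rewrite logn_coprime ?coprime2n.
Qed.

(** For odd [n] the relator x^n is not a square, but then the Sylow 2-subgroups have order 2. *)
Lemma H2_dihedral n : (1 < n)%N -> H2_detected 'D_(n.*2)%G.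
Proof.
move=> n_gt1; have oD : #|'D_(n.*2)%G| = n.*2 by apply: card_dihedral.
have [odd_n | even_n] := boolP (odd n).
  by have [] := @sq_order2odd _ 'D_(n.*2)%G n _ odd_n; rewrite // oD mul2n.
have /existsP[[x y] /= /eqP[defG xn y2 xy]] :
    'D_(n.*2) \homg Grp (x : y : x ^+ n, y ^+ 2, x ^ y = x^-1).
  by rewrite -(Grp_dihedral n_gt1) homg_refl.
have yV : y^-1 = y by apply/eqP; rewrite eq_invg_mul -expg2 y2.
have yx2 : (y * x) ^+ 2 = 1.
  by move: xy; rewrite conjgE yV => xy; rewrite expg2 mulgA -(mulgA y) xy mulVg.
have ox : #[x] = n.
  apply/eqP; rewrite eqn_leq dvdn_leq ?(ltnW n_gt1) ?order_dvdn ?xn //=.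
  have ox2 : (#|<[x]> <*> <[y]>| <= #[x] * 2)%N.
    by apply: card_joing_cycle_leq; rewrite ?y2 // inE -cycleJ xy cycleV.
  rewrite -(leq_pmul2r (isT : 0 < 2)%N); apply: leq_trans ox2.
  by rewrite defG oD muln2.
have [] // := @sq_dihedral _ 'D_(n.*2)%G y x defG y2 yx2; first by rewrite ox.
by rewrite oD ox muln2.
Qed.

Lemma odd_index_logn (gT : finGroupType) (G H : {group gT}) :
  H \subset G -> logn 2 #|H| = logn 2 #|G| -> odd #|G : H|.
Proof.
move=> sHG; rewrite -(Lagrange sHG) lognM ?cardG_gt0 //.
rewrite -[LHS]addn0 => /addnI/esym/eqP; rewrite -leqn0 leqNgt logn_gt0.
rewrite mem_primes /= indexg_gt0 /= => /negbTE ev.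
by rewrite -[odd _]negbK -dvdn2 ev.
Qed.

Local Close Scope group_scope.

(* [v n] stands for the 2-adic valuation of the order of the n-th group of a  *)
(* tower and [c] for its increments.  Writing n = 2^k + b with b < 2^k, the   *)
(* product of the groups of rank 2^k and b has odd index in that of rank n;   *)
(* for rank 2^k.+1 it is the wreath product that has odd index.               *)
Lemma tower_induction (P : nat -> Prop) (v c : nat -> nat) :
    (forall n, v n.+1 = v n + c n.+1) -> v 0 = 0 ->
    (forall k j, 0 < j < 2 ^ k -> c (2 ^ k + j) = c j) ->
    (forall k, 0 < k -> c (2 ^ k.+1) = (c (2 ^ k)).+1) ->
    P 1%N -> P 2 ->
    (forall a b, 0 < a -> 0 < b -> v (a + b) = v a + v b -> P a -> P b -> P (a + b)) ->
    (forall a, 0 < a -> v (a + a) = (v a + v a).+1 -> P a -> P (a + a)) ->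
  (forall n, 0 < n -> P n).
Proof.
move=> vS v0 cadd c2 P1 P2 Padd Pdbl.
have vadd k b : (b < 2 ^ k) -> v (2 ^ k + b) = (v (2 ^ k) + v b).
  elim: b => [|b IHb] ltb; first by rewrite addn0 v0 addn0.
  by rewrite addnS !vS IHb ?(ltnW ltb) // -addnS cadd // addnA.
have vdbl k : (0 < k) -> v (2 ^ k + 2 ^ k) = (v (2 ^ k) + v (2 ^ k)).+1.
  move=> k_gt0; have [m def2k] : exists m, (2 ^ k = m.+1).
    by exists (2 ^ k).-1; rewrite prednK // expn_gt0.
  rewrite {2}def2k addnS vS vadd ?def2k // -addnS -def2k.
  rewrite addnn -mul2n -expnS c2 // addnS -addnA; congr (_ + _).+1.
  by rewrite def2k vS.
have P2k k : P (2 ^ k).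
  elim: k => [//|k IHk]; have [-> // | k_gt0] := posnP k.
  by rewrite expnS mul2n -addnn; apply: Pdbl; rewrite ?expn_gt0 ?vdbl.
move=> n; have [m] := ubnP n; elim: m n => // m IHm n /ltnSE len n_gt0.
have /andP[le2n ltn2] := trunc_log_bounds (isT : 1 < 2) n_gt0.
set k := trunc_log 2 n in le2n ltn2.
have [<- // | ne] := eqVneq (2 ^ k) n.
have lt2n : (2 ^ k < n) by rewrite ltn_neqAle ne.
rewrite -(subnKC le2n); apply: Padd => //; rewrite ?expn_gt0 ?subn_gt0 //.
  by apply: vadd; rewrite ltn_subLR // addnn -mul2n -expnS.
apply: IHm; rewrite ?subn_gt0 //.
by apply: leq_trans len; rewrite ltn_subrL expn_gt0.
Qed.

Local Open Scope ring_scope.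

(** * Nilpotent classes of degree two and extensions *)

Lemma F2_addxx (a : 'F_2) : a + a = 0.
Proof. by rewrite -mulr2n -mulr_natl pchar_Fp_0 ?mul0r. Qed.

Lemma F2_opp (a : 'F_2) : - a = a.
Proof. by apply/eqP; rewrite eq_sym -addr_eq0 F2_addxx. Qed.

Lemma F2_addI (a b : 'F_2) : a + b = 0 -> a = b.
Proof. by move/eqP; rewrite addr_eq0 F2_opp => /eqP. Qed.

Section Evaluation.

Variable gT : finGroupType.
Implicit Types (s : seq gT) (phi : seq gT -> 'F_2).

(** Evaluation at lists, padded by 1, makes faces computable by recursion without casts between
    ordinal types. *)
Definition ev n (f : cochain gT n) s : 'F_2 := f [ffun j : 'I_n => nth 1%g s j].

(** The i-th face on lists: index 0 drops the first entry, and an index equal to the size drops the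
    last. *)
Fixpoint merge_at i s : seq gT :=
  match i, s with
  | 0, _ => behead s
  | 1, [:: a, b & t] => (a * b)%g :: t
  | i'.+1, a :: t => if t is [::] then [::] else a :: merge_at i' t
  | _, [::] => [::]
  end.

Lemma nth_merge_at i s j : (i <= size s)%N -> (j.+1 < size s)%N ->
  nth 1%g (merge_at i s) j =
    if (j.+1 < i)%N then nth 1%g s j
    else if j.+1 == i then (nth 1 s j * nth 1 s j.+1)%g else nth 1%g s j.+1.
Proof.
elim: i s j => [|i IHi] s j; first by rewrite nth_behead.
case: s => [|a s] //= les ltj.
case: s les ltj => [|b s] // les ltj.
case: i IHi les => [|i] IHi les; first by case: j ltj.
case: j ltj => [|j] ltj //.
by rewrite -[LHS]/(nth 1%g (merge_at i.+1 (b :: s)) j) IHi.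
Qed.

Lemma ev_differential n (f : cochain gT n) s : size s = n.+1 ->
  ev (differential f) s = \sum_(0 <= i < n.+2) ev f (merge_at i s).
Proof.
move=> sz_s; rewrite /ev ffunE big_mkord; apply: eq_bigr => i _; congr (f _).
apply/ffunP=> j; have bump_max : bump n j = j by rewrite /bump leqNgt ltn_ord.
rewrite !ffunE /= bump_max.
by rewrite nth_merge_at ?sz_s ?ltnS // -ltnS ltn_ord.
Qed.

(* The sum of the inner faces, [inner_sum] below, in recursive form.          *)
Fixpoint inner phi s : 'F_2 :=
  match s with
  | [::] => 0
  | a :: t => if t is b :: u then phi ((a * b)%g :: u) + inner (fun v => phi (a :: v)) t
              else phi [::]
  end.

Lemma inner_sum phi s : inner phi s = \sum_(1 <= i < (size s).+1) phi (merge_at i s).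
Proof.
elim: s phi => [|a s IHs] phi; first by rewrite big_geq.
case: s IHs => [|b s] IHs; first by rewrite big_nat1.
rewrite -[LHS]/(phi ((a * b)%g :: s) + inner (fun v => phi (a :: v)) (b :: s)).
rewrite IHs [RHS]big_ltn // [in RHS]big_add1; congr (_ + _).
by apply: eq_big_nat => [[|i]].
Qed.

Arguments inner : simpl never.

Lemma ev_differential_inner n (f : cochain gT n) s : size s = n.+1 ->
  ev (differential f) s = ev f (behead s) + inner (ev f) s.
Proof.
move=> sz_s; rewrite ev_differential // inner_sum sz_s big_nat_recl //.
by case: s sz_s => // a s _; rewrite big_add1.
Qed.

Section Involution.

Variable g : gT.
Hypothesis gg : (g * g = 1)%g.

(* The image of the generator of degree 2k of the periodic resolution of the  *)
(* group <[g]> in its bar resolution is sum_i [g^i_1 | g | ... | g^i_k | g].  *)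
Fixpoint sum_cycle k phi : 'F_2 :=
  if k is k'.+1 then
    sum_cycle k' (fun s => phi [:: 1%g, g & s] + phi [:: g, g & s])
  else phi [::].

Lemma eq_sum_cycle k phi psi : (forall s, size s = k.*2 -> phi s = psi s) ->
  sum_cycle k phi = sum_cycle k psi.
Proof.
elim: k phi psi => [|k IHk] phi psi eq_phi /=; first exact: eq_phi.
by apply: IHk => s sz_s; rewrite !eq_phi //= sz_s.
Qed.

Lemma sum_cycleD k phi psi :
  sum_cycle k (fun s => phi s + psi s) = sum_cycle k phi + sum_cycle k psi.
Proof.
elim: k phi psi => [|k IHk] phi psi //=; rewrite -IHk.
by apply: eq_sum_cycle => s _; rewrite addrACA.
Qed.

Lemma sum_cycle_inner_cons k phi :
  sum_cycle k (fun s => phi s + inner phi (g :: s))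
    = sum_cycle k (inner (fun s => phi (g :: s))).
Proof.
case: k => [|k] /=; first by rewrite F2_addxx.
apply: eq_sum_cycle => s _.
have innerE a b t : inner phi [:: a, b & t]
  = phi ((a * b)%g :: t) + inner (fun v => phi (a :: v)) (b :: t) by [].
rewrite /= !innerE mulg1 gg; set x := phi _; set y := phi _.
by rewrite (addrCA y x) addrACA F2_addxx add0r addrACA F2_addxx add0r.
Qed.

(** The first inner products of [1|g|s] and [g|g|s] are g and 1. Exchanged between the two words,
    they supply the terms that [sum_cycle_inner_cons] needs to shorten each sum by a pair of
    letters. *)
Lemma sum_cycle_inner k phi : sum_cycle k (inner phi) = 0.
Proof.
elim: k phi => [//|k IHk] phi.
have innerE a b t : inner phi [:: a, b & t]
  = phi ((a * b)%g :: t) + inner (fun v => phi (a :: v)) (b :: t) by [].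
have -> : sum_cycle k.+1 (inner phi) =
    sum_cycle k (fun s => phi (1%g :: s) + inner (fun v => phi (1%g :: v)) (g :: s))
    + sum_cycle k (fun s => phi (g :: s) + inner (fun v => phi (g :: v)) (g :: s)).
  rewrite /= -sum_cycleD; apply: eq_sum_cycle => s _; rewrite /= !innerE mul1g gg.
  by rewrite addrACA [in LHS](addrC (phi _)) -addrACA.
by rewrite !sum_cycle_inner_cons !IHk addr0.
Qed.

(** The chain behind [sum_cycle] is a cycle modulo 2, so coboundaries vanish on it: inner and last
    faces cancel by [sum_cycle_inner], and the first faces of [1|g|s] and [g|g|s] agree. *)
Lemma sum_cycle_differential k n (f : cochain gT n) : k.*2 = n.+1 ->
  sum_cycle k (ev (differential f)) = 0.
Proof.
move=> def_n.
rewrite (@eq_sum_cycle _ _ (fun s => ev f (behead s) + inner (ev f) s)).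
  rewrite sum_cycleD sum_cycle_inner addr0.
  case: k def_n => //= k _; rewrite sum_cycleD F2_addxx //.
by move=> s sz_s; rewrite ev_differential_inner // sz_s.
Qed.

(** The value of the k-th cup power of a 2-cochain [F] on a list of length 2k. *)
Fixpoint pair_power (F : gT -> gT -> 'F_2) k s : 'F_2 :=
  if k is k'.+1 then
    if s is [:: a, b & t] then F a b * pair_power F k' t else 0
  else 1.

Lemma sum_cycle_pair_power (F : gT -> gT -> 'F_2) k :
  sum_cycle k (pair_power F k) = (F 1%g g + F g g) ^+ k.
Proof.
elim: k => [|k IHk] //; rewrite exprS -IHk.
transitivity (sum_cycle k (fun s => (F 1%g g + F g g) * pair_power F k s)).
  by rewrite /=; apply: eq_sum_cycle => s _; rewrite /= mulrDl.
elim: {IHk} k (pair_power F k) => [|k IHk] phi //=.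
by rewrite -IHk; apply: eq_sum_cycle => s _; rewrite mulrDr.
Qed.

End Involution.

Definition ev2 (f : cochain gT 2) (a b : gT) : 'F_2 := ev f [:: a; b].

Lemma cup_exp_rep (f : cocycle gT 2) k : exists h : cocycle gT (k * 2),
  cup_exp (cohomology_class f) k = cohomology_class h /\
  (forall s, size s = k.*2 -> ev h s = pair_power (ev2 f) k s).
Proof.
elim: k => [|k [h [hE evh]]].
  exists (Cocycle (one_cocycles gT)); split=> // s _.
  by rewrite /ev ffunE.
exists (cup_cocycle f h); split.
  by rewrite -[LHS]/(cup (cohomology_class f) (cup_exp (cohomology_class f) k)) hE cup_class.
case=> [|a [|b s]] //= [] sz_s; rewrite -evh //.
have evE n (u : cochain gT n) x y : x = y -> u x = u y by move->.
rewrite /ev2 /ev /= ffunE; congr (_ * _); apply: evE; apply/ffunP=> i; rewrite !ffunE //=.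
by case: i => [[|[|i]]].
Qed.

Lemma cohomology_class0 n : cohomology_class (0 : cocycle gT n) = 0.
Proof. by rewrite /cohomology_class raddf0. Qed.

(** The sum of both sides is the value of the class on the 2-cycle of <[g]>. Its k-th power is the
    value of the k-th cup power on the 2k-cycle, by [sum_cycle_pair_power]; that is 0 if the power
    is a coboundary, and F_2 is reduced. *)
Lemma nilpotent_involution (f : cocycle gT 2) g :
    Defs.nilpotent_class (cohomology_class f) -> (g * g = 1)%g ->
  ev2 f 1%g g = ev2 f g g.
Proof.
move=> [k xk0] gg; apply: F2_addI.
have [h [hE evh]] := cup_exp_rep f k.
suff: (ev2 f 1%g g + ev2 f g g) ^+ k = 0.
  by move/eqP; rewrite expf_eq0 => /andP[_ /eqP].
rewrite -sum_cycle_pair_power -(eq_sum_cycle _ evh).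
have: is_coboundary (cocycle_val h).
  rewrite -[cocycle_val h]subr0; apply/(cohomology_classP h 0).
  by rewrite cohomology_class0 -hE.
case: k h {xk0 hE evh} => [|k] h /=; first by move/eqP=> ->; rewrite /ev ffunE.
case/existsP=> u /eqP ->; apply: (sum_cycle_differential gg (k := k.+1)).
by rewrite doubleS -muln2.
Qed.

Lemma ev2_cocycle (f : cocycle gT 2) a b c :
  ev2 f b c + ev2 f (a * b)%g c + ev2 f a (b * c)%g + ev2 f a b = 0.
Proof.
have: ev (differential f) [:: a; b; c] = 0.
  by case: f => f /= /eqP ->; rewrite /ev ffunE.
by rewrite ev_differential // !big_nat_recr //= big_geq // add0r.
Qed.

Lemma ev2_coboundary (f : cochain gT 2) (s : gT -> 'F_2) :
  (forall a b, ev2 f a b = s a + s b + s (a * b)%g) -> is_coboundary f.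
Proof.
move=> fE; apply/existsP; exists [ffun x : {ffun 'I_1 -> gT} => s (x 0)].
apply/eqP/ffunP => x.
have eq_ev n (h : cochain gT n) (y : {ffun 'I_n -> gT}) :
    h y = ev h [seq y i | i <- enum 'I_n].
  congr (h _); apply/ffunP=> i; rewrite ffunE (nth_map i) ?size_enum_ord //.
  by rewrite nth_ord_enum.
rewrite !eq_ev; case: [seq x i | i <- _] (size_map x (enum 'I_2)) => [|a [|b [|]]] //=;
  rewrite ?size_enum_ord // => _.
rewrite ev_differential // !big_nat_recr //= big_geq // add0r.
rewrite -/(ev2 f a b) fE /ev !ffunE /=.
by rewrite [RHS]addrC addrA.
Qed.

End Evaluation.

Record normalized_cocycle (gT : finGroupType) := NormalizedCocycle {
  ncocycle_val :> gT -> gT -> 'F_2;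
  ncocycleP : forall a b c, ncocycle_val b c + ncocycle_val (a * b)%g c
    + ncocycle_val a (b * c)%g + ncocycle_val a b = 0;
  ncocycle1l : forall b, ncocycle_val 1%g b = 0
}.

(** The set underlying the central extension with cocycle [c]; the alias carries the twisted group
    law instead of the componentwise one. *)
Definition twisted (gT : finGroupType) (c : normalized_cocycle gT) : Type :=
  (gT * 'F_2)%type.

Section Twisted.

Variables (gT : finGroupType) (c : normalized_cocycle gT).

HB.instance Definition _ := Finite.on (twisted c).

Definition tw_mul (x y : twisted c) : twisted c :=
  ((x.1 * y.1)%g, x.2 + y.2 + c x.1 y.1).
Definition tw_one : twisted c := (1%g, 0).
Definition tw_inv (x : twisted c) : twisted c :=
  (x.1^-1%g, x.2 + c x.1^-1%g x.1).

Lemma tw_mulA : associative tw_mul.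
Proof.
move=> [a r] [b s] [d t]; congr (_, _) => /=; first exact: mulgA.
have := ncocycleP c a b d.
set u := c b d; set v := c _ d; set w := c a _; set p := c a b => uvwp.
rewrite -!addrA; congr (r + (s + _)).
rewrite [in RHS]addrCA; congr (t + _).
apply: F2_addI; rewrite -uvwp -!addrA; congr (u + _).
by rewrite addrA addrC.
Qed.

Lemma tw_mul1g : left_id tw_one tw_mul.
Proof.
by case=> [a r]; rewrite /tw_mul /= mul1g ncocycle1l addr0 add0r.
Qed.

Lemma tw_mulVg : left_inverse tw_one tw_inv tw_mul.
Proof.
case=> [a r]; rewrite /tw_mul /tw_inv /tw_one /= mulVg; congr (_, _).
by rewrite -addrA F2_addxx.
Qed.

HB.instance Definition _ :=
  Finite_isGroup.Build (twisted c) tw_mulA tw_mul1g tw_mulVg.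

Lemma tw_mulE (x y : twisted c) :
  (x * y)%g = ((x.1 * y.1)%g, x.2 + y.2 + c x.1 y.1).
Proof. by []. Qed.

End Twisted.

(** Adding the constant [ev2 f 1 1] normalizes the cocycle. In the resulting extension the square of
    [(a, r)] over an involution [a] is [(1, F a a)], which is trivial by [nilpotent_involution]. A
    splitting [K] is the graph of a function [s] with coboundary [F]. *)
Lemma H2_detected_two_reduced_setT (gT : finGroupType) :
  H2_detected [set: gT]%G ->
  forall x : cohomology gT 2, Defs.nilpotent_class x -> x = 0.
Proof.
move=> dG x nilx; rewrite -[x]reprK in nilx *.
set f := generic_quotient.repr x in nilx *.
rewrite -/(cohomology_class f) in nilx *.
have F1l b : ev2 f 1%g b = ev2 f 1%g 1%g.
  have := ev2_cocycle f 1%g 1%g b; rewrite !mul1g F2_addxx add0r.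
  exact: F2_addI.
pose F a b := ev2 f a b + ev2 f 1%g 1%g.
have FP a b d : F b d + F (a * b)%g d + F a (b * d)%g + F a b = 0.
  rewrite -(ev2_cocycle f a b d) /F; set u := ev2 f 1%g 1%g.
  set p := ev2 f b d; set q := ev2 f _ d; set r := ev2 f a _; set s := ev2 f a b.
  by rewrite [p + u + _]addrACA F2_addxx addr0 -!addrA (addrCA u) F2_addxx addr0.
have F1 b : F 1%g b = 0 by rewrite /F F1l F2_addxx.
pose c := NormalizedCocycle FP F1.
pose T : finGroupType := twisted c.
pose z : T := (1%g, 1).
have extT : invol_ext [set: T]%G [set: gT]%G (fun x : T => x.1) z.
  split=> //.
  - apply/setP=> a; rewrite inE; apply/imsetP.
    by exists ((a, 0) : T); rewrite ?inE.
  - by rewrite inE.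
  - by apply/eqP=> /(congr1 snd).
  - case=> a r _ /= a1; rewrite a1; case: r => [[|[|r]] ltr].
    + by left; congr (_, _); apply/val_inj.
    + by right; congr (_, _); apply/val_inj.
    by [].
  case=> a r _ aa0; have aa : (a * a = 1)%g := aa0.
  rewrite expg2 tw_mulE /= aa; congr (_, _).
  rewrite F2_addxx add0r /F -(F1l a) -(nilpotent_involution nilx aa).
  by rewrite F2_addxx.
have [K [_ fK zK]] := dG _ _ _ _ extT.
have sP a : {r : 'F_2 | (a, r) \in K}.
  apply: sigW; have: a \in [set x.1 | x in K] by rewrite fK inE.
  by case/imsetP=> [[a' r] Kr /= ->]; exists r.
pose s a := sval (sP a); have Ks a : ((a, s a) : T) \in K by apply: (svalP (sP a)).
rewrite -cohomology_class0; apply/cohomology_classP; rewrite subr0.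
(* The normalizing constant is the coboundary of the constant 1-cochain with the same value. *)
pose s' a := s a + ev2 f 1%g 1%g.
apply: (ev2_coboundary (s := s')) => a b.
have Ksab : (((a, s a) : T) * ((b, s b) : T))%g \in K by apply: groupM.
have sab : s (a * b)%g = s a + s b + F a b.
  have := ext_inj extT (subsetT _) zK (Ks (a * b)%g) Ksab erefl.
  by case.
rewrite /s' sab /F; set u := ev2 f 1%g 1%g; set v := ev2 f a b.
rewrite [s a + u + _]addrACA F2_addxx addr0.
by rewrite -(addrA (s a + s b) (v + u) u) -(addrA v) F2_addxx addr0 addrA F2_addxx add0r.
Qed.

Lemma H2_detected_two_reduced (gT : finGroupType) (G : {group gT}) :
  H2_detected G -> two_reduced G.
Proof.
move=> dG; apply: H2_detected_two_reduced_setT.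
have -> : [set: subg_of G]%G = (subg G @* G)%G.
  by apply/val_inj/eqP; rewrite /= eqEsubset subsetT im_subg subxx.
exact: H2_injm (injm_subg G) dG.
Qed.

Local Close Scope ring_scope.
Local Open Scope group_scope.

(** * Symmetric and alternating groups *)

Lemma gen_closed_sub (gT : finGroupType) (S B : {set gT}) :
  1 \in B -> (forall b g, b \in B -> g \in S -> b * g \in B) -> <<S>> \subset B.
Proof.
move=> B1 BS; apply/subsetP=> _ /gen_prodgP[n [c Sc ->]].
elim: n c Sc => [|n IHn] c Sc; first by rewrite big_ord0.
by rewrite big_ord_recr /= BS // IHn.
Qed.

(** Coset enumeration: the union of the cosets [H :* x] contains 1 and is stable under right
    multiplication by [S]. *)
Lemma card_coset_cover (gT : finGroupType) (H : {group gT}) (S : {set gT}) (r : seq gT) :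
    1 \in r ->
    (forall x g, x \in r -> g \in S -> exists2 y, y \in r & x * g * y^-1 \in H) ->
  (#|<<S>>| <= size r * #|H|)%N.
Proof.
move=> r1 rS; pose B := [set b | has (fun x => b \in H :* x) r].
have sSB : <<S>> \subset B.
  apply: gen_closed_sub => [|b g].
    by rewrite inE; apply/hasP; exists 1; rewrite // rcoset1.
  rewrite !inE => /hasP[x rx /rcosetP[h Hh ->]] Sg; apply/hasP.
  have [y ry Hy] := rS x g rx Sg; exists y => //.
  by rewrite mem_rcoset -mulgA -!mulgA groupM // mulgA.
apply: leq_trans (subset_leq_card sSB) _.
elim: r @B {r1 rS sSB} => [|x r IHr] /=.
  by rewrite (_ : [set b | _] = set0) ?cards0 //; apply/setP=> b; rewrite !inE.
rewrite mulSn (_ : [set b | _] = H :* x :|: [set b | has (fun x => b \in H :* x) r]).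
  by apply: leq_trans (leq_card_setU _ _) _; rewrite card_rcoset leq_add2l.
by apply/setP=> b; rewrite !inE.
Qed.

(* Carmichael's presentation of the alternating group of degree m + 2, by     *)
(* enumeration of the cosets of the subgroup of degree m + 1: with y = x m,   *)
(* they are those of 1, y, y^-1 and the y (x j)^-1.                           *)
Lemma card_carmichael_leq (gT : finGroupType) (x : nat -> gT) m :
    (forall i, (i < m)%N -> x i ^+ 3 = 1) ->
    (forall i j, (i < m)%N -> (j < m)%N -> i != j -> (x i * x j) ^+ 2 = 1) ->
  (#|<<[set y in [seq x i | i <- iota 0 m]]>>| * 2 <= (m.+2)`!)%N.
Proof.
elim: m => [|m IHm] x3 xx.
  have -> : [set y in [seq x i | i <- iota 0 0]] = set0.
    by apply/setP=> y; rewrite !inE.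
  by rewrite gen0 cards1.
set S := [set y in _]; set H := <<[set y in [seq x i | i <- iota 0 m]]>>%G in IHm.
have Hx i : (i < m)%N -> x i \in H.
  by move=> ltim; apply: mem_gen; rewrite inE map_f // mem_iota add0n ltim.
pose y := x m; have y3 : y ^+ 3 = 1 by apply: x3.
have {}IHm : (#|H| * 2 <= (m.+2)`!)%N.
  by apply: IHm => [i lti | i j lti ltj]; [apply: x3 | apply: xx]; rewrite ltnS ltnW.
have rel i j : (i < m.+1)%N -> (j < m.+1)%N -> i != j -> x i * x j = (x j)^-1 * (x i)^-1.
  move=> lti ltj neij; rewrite -invMg; apply: (mulgI (x i * x j)).
  by rewrite mulgV; apply: xx.
have inv3 i : (i < m.+1)%N -> (x i)^-1 * (x i)^-1 = x i.
  move=> lti; apply: (mulgI (x i)); apply: (mulgI (x i)).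
  by rewrite mulKVg mulgV; apply/esym/x3.
have sq3 i : (i < m.+1)%N -> x i * x i = (x i)^-1.
  by move=> lti; rewrite -[in RHS](inv3 i lti) invMg !invgK.
have yx j : (j < m)%N -> y * x j = (x j)^-1 * y^-1.
  by move=> ltj; rewrite (rel m j) ?gtn_eqF // ltnW.
have xyx j : (j < m)%N -> y * x j * y = (x j)^-1 by move=> ltj; rewrite yx ?mulgKV.
pose r := [:: 1, y, y^-1 & [seq y * (x j)^-1 | j <- iota 0 m]].
have -> : (m.+3)`! = (size r * (m.+2)`!)%N by rewrite /= size_map size_iota factS.
suff: (#|<<S>>| <= size r * #|H|)%N.
  move=> leS; apply: (leq_trans (_ : _ <= size r * #|H| * 2)%N).
    by rewrite leq_mul2r leS orbT.
  by rewrite -mulnA leq_mul2l IHm orbT.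
apply: card_coset_cover => [|u g]; first by rewrite inE eqxx.
have rP v : reflect (exists2 j, (j < m)%N & v = y * (x j)^-1)
                    (v \in [seq y * (x j)^-1 | j <- iota 0 m]).
  apply: (iffP mapP) => [[j] | [j ltj ->]]; last by exists j; rewrite ?mem_iota.
  by rewrite mem_iota => /andP[_ ltj] ->; exists j.
have ry2 j : (j < m)%N -> y * (x j)^-1 \in r.
  by move=> ltj; rewrite !inE; apply/or4P/Or44/rP; exists j.
have r1 : 1 \in r by rewrite inE eqxx.
have ry : y \in r by rewrite !inE eqxx orbT.
have ryV : y^-1 \in r by rewrite !inE eqxx !orbT.
move=> ru; rewrite inE => /mapP[i]; rewrite mem_iota leq0n add0n ltnS leq_eqVlt => lei ->.
have {}lei : i = m \/ (i < m)%N by case/orP: lei => [/eqP|]; auto.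
move: ru; rewrite !inE; case/or4P=> [/eqP-> | /eqP-> | /eqP-> | /rP[j ltj ->]];
  case: lei => [-> | lti]; rewrite -/y.
- by exists y; rewrite // mul1g mulgV.
- by exists 1; rewrite // mul1g invg1 mulg1 Hx.
- by exists y^-1; rewrite // invgK -mulgA -[_ * _]/(y ^+ 3) y3.
- by exists y^-1; rewrite // invgK xyx // groupV Hx.
- by exists 1; rewrite // mulVg invg1 mulg1.
- exists (y * (x i)^-1); rewrite ?ry2 // invMg invgK mulgA.
  rewrite -(mulgA y^-1) sq3 ?ltnS 1?ltnW // -invMg -invMg mulgA.
  by rewrite xyx // invgK Hx.
- exists (y * (x j)^-1); rewrite ?ry2 // invMg invgK !mulgA.
  have -> : y * (x j)^-1 * y * x j * y^-1 = y * (x j)^-1 * (y * x j * y^-1).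
    by rewrite !mulgA.
  rewrite yx // -(mulgA _ y^-1) inv3 // !mulgA -(mulgA y) inv3 ?ltnS 1?ltnW //.
  by rewrite xyx // groupV Hx.
- have [-> | neij] := eqVneq i j.
    by exists y; rewrite // mulgKV mulgV.
  exists (y * (x j)^-1); rewrite ?ry2 // invMg invgK.
  have [lti' ltj'] : (i < m.+1 /\ j < m.+1)%N by split; apply: ltnW.
  have -> : y * (x j)^-1 * x i * (x j * y^-1) = y * ((x j)^-1 * (x i * x j)) * y^-1.
    by rewrite !mulgA.
  rewrite rel // (mulgA (x j)^-1) inv3 // !mulgA -(mulgA _ (x i)^-1) -invMg !yx //.
  by rewrite invMg !invgK mulgA mulgKV groupM ?groupV ?Hx.
Qed.

Lemma ext_imG (rT gT : finGroupType) (E : {group rT}) (G : {group gT}) f z (A : {set rT}) :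
  invol_ext E G f z -> A \subset E -> f @: <<A>> = <<f @: A>>.
Proof.
move=> extE sAE; have := morphim_gen (Morphism (extM extE)) sAE.
by rewrite !morphimEsub // gen_subG.
Qed.

(** The two lifts of [y] are [x] and [x * z]; their cubes differ by [z], so one of them is 1. *)
Lemma ext_lift3 (rT gT : finGroupType) (E : {group rT}) (G : {group gT}) f z y :
    invol_ext E G f z -> y \in G -> y ^+ 3 = 1 ->
  exists x, [/\ x \in E, f x = y & x ^+ 3 = 1].
Proof.
move=> extE Gy y3; have [x Ex fx] := ext_lift extE Gy.
have Ez := ext_zE extE.
case: (ext_ker extE (_ : x ^+ 3 \in E)); rewrite ?groupX // ?(ext_fX extE) ?fx //.
  by move=> x3; exists x.
move=> x3; exists (x * z); split; rewrite ?groupM // ?(extM extE) ?(ext_fz extE) ?mulg1 //.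
rewrite expgMn; last by apply/esym/(ext_zC extE).
by rewrite x3 expgS expg2 (ext_zz extE) mulg1 (ext_zz extE).
Qed.

Section ThreeCycles.

Variable m : nat.
Local Notation I := 'I_m.+2.
Let p : I := inord m.
Let q : I := ord_max.

(** Carmichael's generators: the 3-cycle sending i to m, m to m + 1 and m + 1 to i. *)
Definition cycle3 (i : nat) : {perm I} := tperm (inord i) p * tperm (inord i) q.

Let val_p : p = m :> nat.
Proof. by rewrite inordK. Qed.

Let val_inord i : (i < m)%N -> (inord i : I) = i :> nat.
Proof. by move=> lti; rewrite inordK // ltnW // ltnW. Qed.

Let pq : p != q.
Proof. by rewrite -val_eqE /= val_p ltn_eqF. Qed.

Let inord_p i : (i < m)%N -> (inord i : I) != p.
Proof. by move=> lti; rewrite -val_eqE /= val_p val_inord // ltn_eqF. Qed.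

Let inord_q i : (i < m)%N -> (inord i : I) != q.
Proof. by move=> lti; rewrite -val_eqE /= val_inord // ltn_eqF // ltnW. Qed.

Let inord_neq i j : (i < m)%N -> (j < m)%N -> i != j -> (inord i : I) != inord j.
Proof. by move=> lti ltj neij; rewrite -val_eqE /= !val_inord. Qed.

Lemma cycle3_i i : (i < m)%N -> cycle3 i (inord i) = p.
Proof. by move=> lti; rewrite permM tpermL tpermD ?inord_p // eq_sym pq. Qed.

Lemma cycle3_p i : (i < m)%N -> cycle3 i p = q.
Proof. by move=> lti; rewrite permM tpermR tpermL. Qed.

Lemma cycle3_q i : (i < m)%N -> cycle3 i q = inord i.
Proof. by move=> lti; rewrite permM (tpermD (inord_q lti) pq) tpermR. Qed.

Lemma cycle3_fix i (x : I) : x != inord i -> x != p -> x != q -> cycle3 i x = x.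
Proof. by move=> xi xp xq; rewrite permM (tpermD (z := x)) 1?eq_sym // tpermD // eq_sym. Qed.

Lemma cycle3_cube i : (i < m)%N -> cycle3 i ^+ 3 = 1.
Proof.
move=> lti; apply/permP=> x; rewrite permX perm1 /=.
have [-> | xi] := eqVneq x (inord i); first by rewrite cycle3_i ?cycle3_p ?cycle3_q.
have [-> | xp] := eqVneq x p; first by rewrite cycle3_p ?cycle3_q ?cycle3_i.
have [-> | xq] := eqVneq x q; first by rewrite cycle3_q ?cycle3_i ?cycle3_p.
by rewrite !cycle3_fix.
Qed.

Lemma cycle3_mul_sqr i j : (i < m)%N -> (j < m)%N -> i != j ->
  (cycle3 i * cycle3 j) ^+ 2 = 1.
Proof.
move=> lti ltj neij; apply/permP=> x; rewrite permX perm1 /=.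
have cE y : (cycle3 i * cycle3 j) y = cycle3 j (cycle3 i y) by rewrite permM.
have ji := inord_neq ltj lti; have ij := inord_neq lti ltj neij.
have fix_ij : cycle3 i (inord j) = inord j.
  by rewrite cycle3_fix ?inord_p ?inord_q // ji // eq_sym.
have fix_ji : cycle3 j (inord i) = inord i.
  by rewrite cycle3_fix ?inord_p ?inord_q.
rewrite !cE; have [-> | xi] := eqVneq x (inord i).
  by rewrite cycle3_i // cycle3_p // cycle3_q // fix_ji.
have [-> | xj] := eqVneq x (inord j).
  by rewrite fix_ij cycle3_i // cycle3_p // cycle3_q.
have [-> | xp] := eqVneq x p.
  by rewrite cycle3_p // cycle3_q // fix_ij cycle3_i.
have [-> | xq] := eqVneq x q.
  by rewrite cycle3_q // fix_ji cycle3_i // cycle3_p.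
by rewrite !(@cycle3_fix i x, @cycle3_fix j x).
Qed.

Definition cycles3 : {set {perm I}} := [set y in [seq cycle3 i | i <- iota 0 m]].

Lemma cycle3_in i : (i < m)%N -> cycle3 i \in cycles3.
Proof. by move=> lti; rewrite inE map_f // mem_iota add0n. Qed.

Lemma cycles3_sub : cycles3 \subset 'Alt_I.
Proof.
apply/subsetP=> c; rewrite inE => /mapP[i]; rewrite mem_iota => /andP[_ lti] ->.
by rewrite Alt_even odd_permM !odd_tperm inord_p ?inord_q.
Qed.

(** By induction on [k]: if [g * c] fixes all points below [k] and sends [k] to [j], then [j] is
    sent back to [k] by 3-cycles that fix these points. *)
Lemma cycles3_to_fix k (g : {perm I}) : (k <= m)%N ->
  exists2 c, c \in <<cycles3>> & forall x : I, (x < k)%N -> (g * c) x = x.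
Proof.
elim: k => [|k IHk] ltkm; first by exists 1.
have [c Cc gcx] := IHk (ltnW ltkm).
have Ck i : (i < m)%N -> cycle3 i \in <<cycles3>> by move=> lti; rewrite mem_gen ?cycle3_in.
pose j := (g * c) (inord k).
have fixk i (x : I) : (k <= i < m)%N -> (x < k)%N -> cycle3 i x = x.
  case/andP=> leki lti ltx; apply: cycle3_fix; rewrite -val_eqE /= ltn_eqF //.
  - by rewrite val_inord // (leq_trans ltx).
  - by rewrite val_p (ltn_trans ltx).
  by rewrite (ltn_trans ltx) // ltnW.
suff [d [Cd dj dx]] : exists d, [/\ d \in <<cycles3>>, d j = inord k
    & forall x : I, (x < k)%N -> d x = x].
  exists (c * d); first exact: groupM.
  move=> x; rewrite ltnS leq_eqVlt => /orP[/eqP xk | ltx].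
    rewrite mulgA permM; have -> : x = inord k by apply/val_inj; rewrite /= val_inord.
    by rewrite -/j dj.
  by rewrite mulgA permM gcx // dx.
have kmm : (k <= k < m)%N by rewrite leqnn.
have [jp | jp] := eqVneq j p.
  exists (cycle3 k * cycle3 k); split; first by rewrite groupM ?Ck.
    by rewrite permM jp cycle3_p // cycle3_q.
  by move=> x ltx; rewrite permM !fixk.
have [jq | jq] := eqVneq j q.
  exists (cycle3 k); split; [exact: Ck | by rewrite jq cycle3_q |].
  by move=> x ltx; rewrite fixk.
have ltjm : (j < m)%N.
  have := ltn_ord j; rewrite ltnS leq_eqVlt => /orP[/eqP jm|].
    by case/eqP: jq; apply/val_inj.
  rewrite ltnS leq_eqVlt => /orP[/eqP jm|//].
  by case/eqP: jp; apply/val_inj; rewrite /= val_p.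
have lekj : (k <= j)%N.
  rewrite leqNgt; apply/negP=> ltjk; have := gcx j ltjk.
  by rewrite {2}/j => /perm_inj jk; move: ltjk; rewrite jk val_inord ?ltnn.
clearbody j; exists (cycle3 j * (cycle3 k * cycle3 k)); split; first by apply: groupM; [exact: Ck | apply: groupM; exact: Ck].
  have cj : cycle3 j j = p by have := cycle3_i ltjm; rewrite inord_val.
  by rewrite permM cj permM cycle3_p // cycle3_q.
by move=> x ltx; rewrite permM (fixk j) ?lekj // permM !fixk.
Qed.

(** With [k = m] in [cycles3_to_fix], only the last two points can still be moved, and parity
    excludes their transposition. *)
Lemma gen_cycles3 : <<cycles3>> = 'Alt_I.
Proof.
apply/eqP; rewrite eqEsubset gen_subG cycles3_sub; apply/subsetP=> g Ag.
have [c Cc gcx] := cycles3_to_fix g (leqnn m).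
have Agc : g * c \in 'Alt_I.
  by rewrite groupM // (subsetP _ c Cc) // gen_subG cycles3_sub.
have xpq (x : I) : ~~ (x < m)%N -> x = p \/ x = q.
  have := ltn_ord x; rewrite -leqNgt ltnS leq_eqVlt => /orP[/eqP xm _|].
    by right; apply/val_inj.
  by rewrite ltnS => lexm lemx; left; apply/val_inj; rewrite /= val_p; apply/eqP; rewrite eqn_leq lexm.
have gpq (x : I) : ~~ (x < m)%N -> ~~ ((g * c)%g x < m)%N.
  by apply: contra => /[dup] lt /gcx/perm_inj xE; rewrite xE in lt.
have pm : ~~ (p < m)%N by rewrite val_p ltnn.
have qm : ~~ (q < m)%N by rewrite -leqNgt /=.
suff gc1 : g * c = 1 by rewrite -(mulgK c g) gc1 mul1g groupV.
have [gp | gp] := xpq _ (gpq p pm).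
  have gq : (g * c) q = q.
    have [gq | //] := xpq _ (gpq q qm).
    by case/eqP: pq; apply: perm_inj (etrans gp (esym gq)).
  apply/permP=> x; rewrite perm1; have [/gcx // | /xpq[] -> //] := boolP (x < m)%N.
have gq : (g * c) q = p.
  have [// | gq] := xpq _ (gpq q qm).
  by case/eqP: pq; apply: perm_inj (etrans gp (esym gq)).
have gcE : g * c = tperm p q.
  apply/permP=> x; have [ltx | /xpq[] ->] := boolP (x < m)%N.
  - by rewrite gcx // tpermD //; [apply: contra pm | apply: contra qm] => /eqP ->.
  - by rewrite tpermL.
  by rewrite tpermR.
by move: Agc; rewrite gcE Alt_even odd_tperm pq.
Qed.

(** The cubes in Carmichael's presentation lift by the choice in [ext_lift3], the other relators
    because they are squares. *)
Lemma H2_Alt_gt1 : H2_detected 'Alt_I.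
Proof.
move=> rT E f z extE.
have lift3 i : exists x, (i < m)%N ==> [&& x \in E, f x == cycle3 i & x ^+ 3 == 1].
  case: (ltnP i m) => [lti | _]; last by exists 1.
  have Ac : cycle3 i \in 'Alt_I by rewrite /= -gen_cycles3 mem_gen ?cycle3_in.
  have [x [Ex fx x3]] := ext_lift3 extE Ac (cycle3_cube lti).
  by exists x; rewrite Ex fx x3 !eqxx.
pose x i := xchoose (lift3 i).
have xP i : (i < m)%N -> [/\ x i \in E, f (x i) = cycle3 i & x i ^+ 3 = 1].
  by move=> lti; have /implyP/(_ lti)/and3P[? /eqP ? /eqP ?] := xchooseP (lift3 i).
pose S := [set y in [seq x i | i <- iota 0 m]].
have sSE : S \subset E.
  apply/subsetP=> y; rewrite inE => /mapP[i]; rewrite mem_iota => /andP[_ lti] ->.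
  by have [] := xP i lti.
have fS : f @: S = cycles3.
  apply/setP=> c; rewrite inE; apply/imsetP/mapP => [[y] | [i]].
    rewrite inE => /mapP[i mi ->] ->; exists i => //.
    by move: mi; rewrite mem_iota => /andP[_ /xP[]].
  move=> mi ->; exists (x i); first by rewrite inE map_f.
  by move: mi; rewrite mem_iota => /andP[_ /xP[]].
have fK : f @: <<S>> = 'Alt_I by rewrite (ext_imG extE sSE) fS gen_cycles3.
have sKE : <<S>> \subset E by rewrite gen_subG.
exists <<S>>%G; split=> //; apply: (ext_card extE) => //.
rewrite fK -(leq_pmul2r (isT : 0 < 2)%N) [X in (_ <= X)%N]mulnC card_Alt ?card_ord //.
apply: card_carmichael_leq => [i lti | i j lti ltj neij].
  by have [] := xP i lti.
have [[Ei fi _] [Ej fj _]] := (xP i lti, xP j ltj).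
by apply: (ext_inv extE); rewrite ?groupM // (extM extE) // fi fj cycle3_mul_sqr.
Qed.

End ThreeCycles.

Lemma H2_trivial (gT : finGroupType) (G : {group gT}) :
  (forall x : gT, x = 1) -> H2_detected G.
Proof.
move=> all1; apply: (sq_abelem _).2; rewrite (_ : gval G = 1) ?abelem1 //.
by apply/trivgP/subsetP=> x _; rewrite inE [x]all1.
Qed.

Lemma perm_ord_le1 n (s : 'S_n) : (n <= 1)%N -> s = 1.
Proof.
case: n s => [|[|//]] s _; apply/permP=> i; first by case: i.
by rewrite !ord1.
Qed.

Lemma H2_Alt n : H2_detected 'Alt_('I_n).
Proof.
case: n => [|[|m]]; last exact: H2_Alt_gt1.
  by apply: H2_trivial => s; apply: perm_ord_le1.
by apply: H2_trivial => s; apply: perm_ord_le1.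
Qed.

(** The elements of [E] with cube 1 generate a normal subgroup, which is a lift of the alternating
    group. A lift of a transposition is an involution and normalizes it, so [ext_adjoin] applies. *)
Lemma H2_Sym n : H2_detected [set: 'S_n]%G.
Proof.
case: n => [|[|m]].
- by apply: H2_trivial => s; apply: perm_ord_le1.
- by apply: H2_trivial => s; apply: perm_ord_le1.
move=> rT E f z extE.
have sA : 'Alt_('I_m.+2) \subset [set: 'S_m.+2]%G := subsetT _.
have [KA [sKA fKA zKA]] := ext_lift_in extE sA (@H2_Alt m.+2).
pose S := [set x in E | x ^+ 3 == 1].
have sSE : S \subset E by apply/subsetP=> x; rewrite inE => /andP[].
have sSK : <<S>> \subset KA.
  rewrite gen_subG; apply/subsetP=> x; rewrite inE => /andP[Ex /eqP x3].
  have fx3 : f x ^+ 3 = 1 by rewrite -(ext_fX extE) // x3 (ext_f1 extE).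
  have Afx : f x \in f @: KA.
    rewrite fKA Alt_even; have := congr1 (@odd_perm _) fx3.
    by rewrite !expgS expg0 mulg1 !odd_permM odd_perm1; case: (odd_perm _).
  (* Otherwise [x * z] lies in [KA], and so does its cube [z]. *)
  case: (ext_mem_lift extE sKA zKA Ex Afx) => // Kxz; case/negP: zKA.
  have := groupX 3 Kxz; rewrite expgMn; last by apply/esym/(ext_zC extE).
  by rewrite x3 mul1g expgS expg2 (ext_zz extE) mulg1.
have zK : z \notin <<S>> by apply: contra zKA => /(subsetP sSK).
have fK : f @: <<S>> = 'Alt_('I_m.+2).
  apply/eqP; rewrite eqEsubset -{1}fKA imsetS //= -gen_cycles3 (ext_imG extE sSE).
  rewrite genS //; apply/subsetP=> c; rewrite inE => /mapP[i].
  rewrite mem_iota => /andP[_ lti] ->.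
  have [x [Ex fx x3]] := ext_lift3 extE (in_setT (cycle3 m i)) (cycle3_cube lti).
  by rewrite -fx imset_f // inE Ex x3 eqxx.
pose t : 'S_m.+2 := tperm ord0 ord_max.
have odd_t : odd_perm t by rewrite odd_tperm.
have [u Eu fu] := ext_lift extE (in_setT t).
have u2 : u ^+ 2 = 1 by apply: (ext_inv extE); rewrite // fu expg2 tperm2.
have sKE : <<S>> \subset E by rewrite gen_subG.
exists (<<S>> <*> <[u]>)%G; split.
- by rewrite join_subG sKE cycle_subG.
- rewrite (ext_imY extE) ?cycle_subG // fK (ext_im_cycle extE) // fu.
  apply/setP=> g; rewrite !inE; have [odd_g | even_g] := boolP (odd_perm g).
    rewrite -(mulgK t g) groupM ?groupV //; last by rewrite mem_gen // inE cycle_id orbT.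
    by rewrite mem_gen // inE Alt_even odd_permM odd_g odd_t.
  by rewrite mem_gen // inE Alt_even even_g.
apply: (ext_adjoin extE) => //.
- apply: (subsetP (norm_gen _)) => //; rewrite inE; apply/subsetP=> _ /imsetP[x + ->].
  by rewrite !inE => /andP[Ex /eqP x3]; rewrite groupJ // -conjXg x3 conj1g eqxx.
- by rewrite u2 group1.
by rewrite fK fu Alt_even odd_t.
Qed.

(** * The Mathieu group *)

Section TwistedSquare.

Variables (rT : finGroupType) (x i t : rT).
Hypotheses (x4 : x ^+ 4 = 1) (i2 : i ^+ 2 = 1) (t2 : t ^+ 2 = 1).
Hypotheses (ix2 : (i * x) ^+ 2 = 1) (it2 : (i * t) ^+ 2 = 1).
Hypothesis ixx2 : (i * (x * x ^ t)) ^+ 2 = 1.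

(* A presentation of the Sylow 2-subgroup (Z/4 x Z/4) : (Z/2 x Z/2) of M_12   *)
(* in which, except for x ^+ 4, all relators are squares of words.            *)
Lemma card_twisted_square_leq :
  (#|<[x]> <*> <[x ^ t]> <*> <[i]> <*> <[t]>| <= 64)%N.
Proof.
have invE (u : rT) : u ^+ 2 = 1 -> u^-1 = u.
  by move=> u2; apply: (mulgI u); rewrite mulgV -u2.
have invol_conj (u : rT) : (i * u) ^+ 2 = 1 -> u ^ i = u^-1.
  move/invE; rewrite invMg (invE _ i2) => iu.
  by rewrite conjgE (invE _ i2) ?mulgA -iu -mulgA -expg2 i2 mulg1.
have cit : commute i t by apply/commute_involutions.
have it : i ^ t = i by apply/conjg_fixP/commgP.
have ti : t ^ i = t by apply/conjg_fixP/commgP/commute_sym.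
set y := x ^ t.
have y4 : y ^+ 4 = 1 by rewrite /y -conjXg x4 conj1g.
have xi : x ^ i = x^-1 by apply: invol_conj.
have yi : y ^ i = y^-1 by rewrite /y -conjgM -cit conjgM xi conjVg.
have yt : y ^ t = x by rewrite /y -conjgM -expg2 t2 conjg1.
(* Conjugation by [i] inverts [x], [y] and [x * y], which forces [x] and [y] to commute. *)
have cxy : commute x y.
  have := invol_conj _ ixx2; rewrite -/y conjMg xi yi -invMg => /invg_inj.
  exact: esym.
have nX : y \in 'N(<[x]>).
  by apply: (subsetP (cent_sub _)); rewrite cent_cycle; apply/cent1P/commute_sym.
have card1 : (#|<[x]> <*> <[y]>| <= 4 * 4)%N.
  apply: leq_trans (@card_joing_cycle_leq _ <[x]>%G y 4 _ _ _) _ => //.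
    by rewrite y4 group1.
  rewrite leq_mul2r /= -orderE; apply: dvdn_leq => //.
  by rewrite order_dvdn x4.
have [Ax Ay] : x \in <[x]> <*> <[y]> /\ y \in <[x]> <*> <[y]>.
  by split; rewrite mem_gen // inE cycle_id ?orbT.
have normXY (u : rT) : x ^ u \in <[x]> <*> <[y]> -> y ^ u \in <[x]> <*> <[y]> ->
    u \in 'N(<[x]> <*> <[y]>).
  by move=> xu yu; rewrite inE conjYg -!cycleJ join_subG !cycle_subG xu.
have nXYi : i \in 'N(<[x]> <*> <[y]>) by rewrite normXY ?xi ?yi ?groupV.
have nXYt : t \in 'N(<[x]> <*> <[y]>) by rewrite normXY ?yt.
apply: leq_trans (@card_joing_cycle_leq _ (<[x]> <*> <[y]> <*> <[i]>)%G t 2 _ _ _) _ => //.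
- rewrite inE conjYg -cycleJ it; apply/genS/setSU.
  by move: nXYt; rewrite inE.
- by rewrite t2 group1.
rewrite -[64]/(32 * 2)%N leq_mul2r /=.
apply: leq_trans (@card_joing_cycle_leq _ (<[x]> <*> <[y]>)%G i 2 _ _ _) _ => //.
  by rewrite i2 group1.
by rewrite -[32]/(4 * 4 * 2)%N leq_mul2r /=.
Qed.

End TwistedSquare.

Lemma H2_twisted_square (gT : finGroupType) (G : {group gT}) x i t :
    <[x]> <*> <[x ^ t]> <*> <[i]> <*> <[t]> = G -> x ^+ 4 = 1 ->
    i ^+ 2 = 1 -> t ^+ 2 = 1 -> (i * x) ^+ 2 = 1 -> (i * t) ^+ 2 = 1 ->
    (i * (x * x ^ t)) ^+ 2 = 1 -> (64 <= #|G|)%N ->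
  H2_detected G.
Proof.
move=> defG x4 i2 t2 ix2 it2 ixx2 oG rT E f z extE.
have [Gx Gi Gt] : [/\ x \in G, i \in G & t \in G].
  have sG A : A \subset <[x]> <*> <[x ^ t]> <*> <[i]> <*> <[t]> -> A \subset G.
    by rewrite -defG.
  split; rewrite -cycle_subG; apply: sG; last exact: joing_subr.
    do 2 apply: subset_trans (joing_subl _ _).
    exact: joing_subl.
  apply: subset_trans (joing_subl _ _).
  exact: joing_subr.
have [u Eu fu] := ext_lift extE Gx; have [v Ev fv] := ext_lift extE Gi.
have [w Ew fw] := ext_lift extE Gt.
have fuw : f (u ^ w) = x ^ t by rewrite (ext_fJ extE) // fu fw.
have Euw : u ^ w \in E by rewrite groupJ.
pose K := (<[u]> <*> <[u ^ w]> <*> <[v]> <*> <[w]>)%G.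
have sKE : K \subset E by rewrite !join_subG !cycle_subG Eu Euw Ev Ew.
have fK : f @: K = G.
  rewrite -defG !(ext_imY extE) ?join_subG ?cycle_subG ?Eu ?Euw ?Ev ?Ew //.
  by rewrite !(ext_im_cycle extE) // fuw fu fv fw.
exists K; split=> //; apply: (ext_card extE) => //; rewrite fK.
apply: leq_trans oG; apply: card_twisted_square_leq.
(* This relator lifts too, as the square of [x ^+ 2]. *)
- rewrite -[4]/(2 * 2)%N expgM; apply: (ext_inv extE); rewrite ?groupX //.
  by rewrite (ext_fX extE) // fu -expgM; exact: x4.
- by apply: (ext_inv extE); rewrite ?fv.
- by apply: (ext_inv extE); rewrite ?fw.
- by apply: (ext_inv extE); rewrite ?groupM // (extM extE) // fv fu.
- by apply: (ext_inv extE); rewrite ?groupM // (extM extE) // fv fw.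
have Euu : u * u ^ w \in E by rewrite groupM.
apply: (ext_inv extE); first exact: groupM.
by rewrite (extM extE) // (extM extE) // fv fuw fu.
Qed.

(* Permutation tables, stabilizer chains and a Sylow 2-subgroup of M_12 *)
Local Close Scope group_scope.

(* A permutation of [0, 12) is tabulated as the list of its values, so that   *)
(* identities in M_12 can be checked by computation.                          *)
Definition valid (l : seq nat) := [&& size l == 12, all (fun i => i < 12) l & uniq l].
Definition tid : seq nat := iota 0 12.
Definition tmul (l m : seq nat) := [seq nth 0 m i | i <- l].
Definition tinv (l : seq nat) := [seq index i l | i <- tid].

Definition tab_fun (l : seq nat) : {ffun 'I_12 -> 'I_12} := [ffun i : 'I_12 => inord (nth 0 l i)].
Definition of_tab (l : seq nat) : 'S_12 := insubd (1%g : 'S_12) (tab_fun l).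

Lemma valid_lt l i : valid l -> i < 12 -> nth 0 l i < 12.
Proof. by case/and3P=> /eqP sz_l /all_nthP lt12 _ lti; apply: lt12; rewrite sz_l. Qed.

Lemma of_tabE l (i : 'I_12) : valid l -> of_tab l i = nth 0 l i :> nat.
Proof.
move=> val_l; have inj_l : injectiveb (tab_fun l).
  apply/injectiveP=> j k; rewrite !ffunE => /(congr1 val) /=.
  rewrite !inordK ?valid_lt // => /eqP; case/and3P: val_l => /eqP sz_l _ uniq_l.
  by rewrite nth_uniq ?sz_l // => /eqP/val_inj.
by rewrite -pvalE /= val_insubd inj_l ffunE inordK // valid_lt.
Qed.

Lemma of_tab_eq l (s : 'S_12) : valid l ->
  all (fun i => nth 0 l i == s (inord i)) (iota 0 12) -> s = of_tab l.
Proof.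
move=> val_l /allP ls; apply/permP=> i; apply/val_inj; rewrite /= of_tabE //.
by rewrite (eqP (ls i _)) ?inord_val // mem_iota ltn_ord.
Qed.

Lemma of_tabM l m : valid l -> valid m -> of_tab (tmul l m) = (of_tab l * of_tab m)%g.
Proof.
move=> val_l val_m.
have val_lm : valid (tmul l m).
  case/and3P: (val_l) => /eqP sz_l /allP lt_l uniq_l.
  case/and3P: (val_m) => /eqP sz_m _ uniq_m.
  rewrite /valid size_map sz_l map_inj_in_uniq ?uniq_l ?andbT /=.
    by apply/allP=> _ /mapP[i /lt_l lti ->]; apply: valid_lt.
  move=> i j /lt_l lti /lt_l ltj /eqP.
  by rewrite nth_uniq ?sz_m // => /eqP.
apply/esym/of_tab_eq => //; apply/allP=> i; rewrite mem_iota => /andP[_ lti].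
case/and3P: (val_l) => /eqP sz_l _ _.
by rewrite permM of_tabE // of_tabE // inordK // (nth_map 0) ?sz_l.
Qed.

Lemma of_tab1 : of_tab tid = 1%g.
Proof.
apply/esym/of_tab_eq => //; apply/allP=> i; rewrite mem_iota => /andP[_ lti].
by rewrite perm1 inordK // nth_iota.
Qed.

Lemma of_tab_inj l m : valid l -> valid m -> of_tab l = of_tab m -> l = m.
Proof.
move=> val_l val_m eq_lm.
case/and3P: (val_l) (val_m) => /eqP sz_l _ _ /and3P[/eqP sz_m _ _].
apply: (@eq_from_nth _ 0) => [|i]; rewrite sz_l ?sz_m // => lti.
have := congr1 (fun s : 'S_12 => val (s (inord i))) eq_lm.
by rewrite /= !of_tabE // inordK.
Qed.

(* A stabilizer chain: each level (b, T) lists representatives T of the cosets *)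
(* of the stabilizer of the base point b, generated by the remaining levels.  *)
Definition chain := seq (nat * seq (seq nat)).

Fixpoint chain_set (c : chain) : {set 'S_12} :=
  if c is (b, T) :: c' then (chain_set c' * [set s in map of_tab T])%g else [set 1%g].

(** Strips off the representative with the same image of [b] and sifts the quotient through the next
    level. The test [tmul u t == l] spares any proof about [tinv]. *)
Fixpoint sifts (c : chain) (l : seq nat) : bool :=
  if c is (b, T) :: c' then
    let i := find (fun t => nth 0 t b == nth 0 l b) T in
    let t := nth tid T i in
    let u := tmul l (tinv t) in
    [&& i < size T, valid u, tmul u t == l & sifts c' u]
  else l == tid.

(** The last clause is the closure test: a representative of the top level times one of any level
    sifts through the chain. The clause before it says that the deeper levels fix [b]. *)
Fixpoint chain_ok (c : chain) : bool :=
  if c is (b, T) :: c' then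
    [&& chain_ok c', b < 12, tid \in T, all valid T,
        uniq [seq nth 0 t b | t <- T],
        all (fun bT => all (fun t => nth 0 t b == b) bT.2) c' &
        all (fun bT => all (fun t' => all (fun t => sifts c (tmul t t')) T) bT.2) c]
  else true.

Lemma siftsP c l : chain_ok c -> sifts c l -> of_tab l \in chain_set c.
Proof.
elim: c l => [|[b T] c IHc] l /=.
  by move=> _ /eqP->; rewrite of_tab1 set11.
case/and5P=> ok_c _ _ /allP valT _ /and4P[lti val_u /eqP defl sift_u].
have Tt := mem_nth tid lti; have val_t := valT _ Tt.
rewrite -defl of_tabM //; apply: mem_mulg; first exact: IHc.
by rewrite inE map_f.
Qed.

Lemma chain_set1 c : chain_ok c -> 1%g \in chain_set c.
Proof.
elim: c => [|[b T] c IHc] /=; first by rewrite set11.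
case/and5P=> /IHc c1 _ T1 _ _; rewrite -(mulg1 1%g) mem_mulg // inE.
by rewrite -of_tab1 map_f.
Qed.

(** Elements of the chain set are products of representatives, so it is enough to multiply on the
    right by one of them: the closure test rewrites its product with the top factor, and induction
    absorbs the rest. *)
Lemma chain_set_mul c : chain_ok c -> (chain_set c * chain_set c \subset chain_set c)%g.
Proof.
elim: c => [|[b T] c IHc] ok; first by rewrite /= mulg1.
have /and5P[ok_c _ _ /allP valT /and3P[_ _ clT]] := ok.
have {}IHc := IHc ok_c.
pose Lc := chain_set ((b, T) :: c).
have mulT b' T' t : (b', T') \in (b, T) :: c -> t \in T' -> valid t ->
    (Lc :* of_tab t \subset Lc)%g.
  move=> cT' T't val_t; apply/subsetP=> _ /rcosetP[_ /mulsgP[h s Lh + ->] ->].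
  rewrite inE => /mapP[u Tu ->]; have val_u := valT u Tu.
  rewrite -mulgA -of_tabM //.
  have := siftsP ok (allP (allP (allP clT _ cT') _ T't) _ Tu).
  case/mulsgP=> h' s' Lh' Ts' ->; rewrite mulgA; apply: mem_mulg; last exact: Ts'.
  by apply: (subsetP IHc); apply: mem_mulg.
have valc c' : chain_ok c' -> forall bT t, bT \in c' -> t \in bT.2 -> valid t.
  elim: c' => [|[b1 T1] c1 IH1] //= /and5P[ok1 _ _ /allP val1 _] bU v.
  by rewrite inE => /orP[/eqP-> /val1 //|]; apply: IH1.
suff mulS : forall c' : chain, {subset c' <= (b, T) :: c} -> (Lc * chain_set c' \subset Lc)%g.
  exact: mulS.
elim=> [|[b1 T1] c1 IH1] sc /=; first by rewrite mulg1.
rewrite mulgA; apply/subsetP=> _ /mulsgP[h s Lh + ->].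
rewrite inE => /mapP[t Tt ->].
have cT1 : (b1, T1) \in (b, T) :: c by rewrite sc ?mem_head.
apply: (subsetP (mulT _ _ _ cT1 Tt (valc _ ok _ _ cT1 Tt))).
rewrite mem_rcoset mulgK (subsetP (IH1 _)) // => x c1x.
by rewrite sc // inE c1x orbT.
Qed.

Lemma chain_fix c b s : b < 12 -> chain_ok c ->
    all (fun bT => all (fun t => nth 0 t b == b) bT.2) c ->
  s \in chain_set c -> s (inord b) = inord b.
Proof.
move=> ltb; elim: c s => [|[b' T] c IHc] s /=.
  by move=> _ _ /set1P ->; rewrite perm1.
case/and5P=> ok_c _ _ /allP valT _ /andP[/allP fixT fixc].
case/mulsgP=> h u Lh + ->; rewrite inE => /mapP[t Tt ->].
rewrite permM IHc //; apply/val_inj; rewrite /= of_tabE ?valT // inordK //.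
exact/eqP/fixT.
Qed.

(** The lower levels fix [b], so the image of [b] determines the representative at the top. *)
Lemma card_chain_set c : chain_ok c ->
  #|chain_set c| = \prod_(bT <- c) size bT.2.
Proof.
elim: c => [|[b T] c IHc] ok; first by rewrite big_nil cards1.
have /and5P[ok_c ltb _ /allP valT /and3P[uniqT fixc _]] := ok.
rewrite big_cons /= -IHc // mulnC.
have inj_T : {in T &, forall t t', nth 0 t b = nth 0 t' b -> t = t'}.
  move=> t t' Tt Tt' eqb.
  have lt i : i \in T -> index i T < size T by rewrite index_mem.
  rewrite -(nth_index t Tt) -(nth_index t Tt'); congr nth.
  apply/eqP; rewrite -(nth_uniq (nth 0 t b) _ _ uniqT) ?size_map ?lt //.
  by rewrite !(nth_map t) ?lt // !nth_index // eqb.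
have inj_ofT : {in T &, injective of_tab}.
  by move=> t t' Tt Tt'; apply: of_tab_inj; apply: valT.
have <- : #|[set s in map of_tab T]| = size T.
  rewrite cardsE -(size_map of_tab); apply/card_uniqP.
  rewrite map_inj_in_uniq //; apply: (map_uniq (f := fun t => nth 0 t b)).
  exact: uniqT.
rewrite -cardsX /mulg /= /set_mulg curry_imset2X card_in_imset //.
move=> [h s] [h' s'] /setXP[/= Lh]; rewrite inE => /mapP[t Tt ->].
case/setXP=> /= Lh'; rewrite inE => /mapP[t' Tt' ->] eq_hs.
suff eqt : t = t' by move: eq_hs; rewrite eqt => /mulIg ->.
apply: inj_T => //.
have := congr1 (fun g : 'S_12 => val (g (inord b))) eq_hs.
have [val_t val_t'] := (valT t Tt, valT t' Tt').
rewrite /= !permM (chain_fix ltb ok_c fixc Lh) (chain_fix ltb ok_c fixc Lh').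
by rewrite !of_tabE // inordK.
Qed.

(** Transversals of sizes 12, 11, 10, 9, 8 for the base 0, 1, 2, 3, 4: M_12 is sharply 5-transitive,
    of order 95040 = 64 * 1485. *)
Definition m12_chain : chain := [::
(0, [:: [:: 0; 1; 2; 3; 4; 5; 6; 7; 8; 9; 10; 11];
  [:: 1; 0; 2; 3; 4; 8; 6; 10; 5; 11; 7; 9];
  [:: 2; 0; 1; 3; 4; 9; 6; 5; 10; 7; 11; 8];
  [:: 3; 0; 1; 2; 4; 11; 6; 7; 8; 5; 9; 10];
  [:: 4; 0; 1; 2; 3; 5; 6; 10; 9; 11; 8; 7];
  [:: 5; 0; 1; 2; 3; 6; 10; 4; 8; 7; 11; 9];
  [:: 6; 0; 1; 2; 3; 10; 4; 5; 11; 9; 7; 8];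
  [:: 7; 0; 1; 2; 3; 11; 8; 9; 5; 10; 4; 6];
  [:: 8; 0; 1; 2; 3; 9; 7; 11; 10; 5; 6; 4];
  [:: 9; 0; 1; 2; 3; 7; 11; 8; 6; 4; 5; 10];
  [:: 10; 0; 1; 2; 3; 4; 5; 6; 7; 8; 9; 11];
  [:: 11; 0; 1; 2; 3; 8; 9; 7; 4; 6; 10; 5]]);
(1, [:: [:: 0; 1; 2; 3; 4; 5; 6; 7; 8; 9; 10; 11];
  [:: 0; 2; 1; 3; 4; 10; 6; 11; 9; 8; 5; 7];
  [:: 0; 3; 1; 2; 4; 8; 6; 9; 11; 10; 7; 5];
  [:: 0; 4; 1; 2; 3; 9; 6; 8; 5; 7; 10; 11];
  [:: 0; 5; 1; 2; 3; 8; 10; 11; 6; 9; 4; 7];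
  [:: 0; 6; 1; 2; 3; 11; 4; 7; 10; 8; 5; 9];
  [:: 0; 7; 1; 2; 3; 5; 8; 4; 11; 6; 9; 10];
  [:: 0; 8; 1; 2; 3; 10; 7; 6; 9; 4; 11; 5];
  [:: 0; 9; 1; 2; 3; 6; 11; 5; 7; 10; 8; 4];
  [:: 0; 10; 1; 2; 3; 7; 5; 9; 4; 11; 6; 8];
  [:: 0; 11; 1; 2; 3; 4; 9; 10; 8; 5; 7; 6]]);
(2, [:: [:: 0; 1; 2; 3; 4; 5; 6; 7; 8; 9; 10; 11];
  [:: 0; 1; 3; 2; 4; 7; 6; 5; 10; 11; 8; 9];
  [:: 0; 1; 4; 2; 3; 10; 6; 11; 7; 5; 9; 8];
  [:: 0; 1; 5; 2; 3; 4; 10; 7; 9; 6; 8; 11];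
  [:: 0; 1; 6; 2; 3; 5; 4; 9; 8; 10; 11; 7];
  [:: 0; 1; 7; 2; 3; 9; 8; 10; 6; 11; 5; 4];
  [:: 0; 1; 8; 2; 3; 11; 7; 5; 4; 9; 10; 6];
  [:: 0; 1; 9; 2; 3; 8; 11; 4; 10; 7; 6; 5];
  [:: 0; 1; 10; 2; 3; 6; 5; 8; 11; 4; 7; 9];
  [:: 0; 1; 11; 2; 3; 7; 9; 6; 5; 8; 4; 10]]);
(3, [:: [:: 0; 1; 2; 3; 4; 5; 6; 7; 8; 9; 10; 11];
  [:: 0; 1; 2; 4; 3; 11; 6; 10; 9; 8; 7; 5];
  [:: 0; 1; 2; 5; 3; 7; 10; 4; 8; 11; 9; 6];
  [:: 0; 1; 2; 6; 3; 9; 4; 5; 11; 7; 8; 10];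
  [:: 0; 1; 2; 7; 3; 10; 8; 9; 5; 4; 6; 11];
  [:: 0; 1; 2; 8; 3; 5; 7; 11; 10; 6; 4; 9];
  [:: 0; 1; 2; 9; 3; 4; 11; 8; 6; 5; 10; 7];
  [:: 0; 1; 2; 10; 3; 8; 5; 6; 7; 9; 11; 4];
  [:: 0; 1; 2; 11; 3; 6; 9; 7; 4; 10; 5; 8]]);
(4, [:: [:: 0; 1; 2; 3; 4; 5; 6; 7; 8; 9; 10; 11];
  [:: 0; 1; 2; 3; 5; 6; 10; 9; 11; 8; 4; 7];
  [:: 0; 1; 2; 3; 6; 10; 4; 8; 7; 11; 5; 9];
  [:: 0; 1; 2; 3; 7; 11; 8; 6; 4; 5; 9; 10];
  [:: 0; 1; 2; 3; 8; 9; 7; 4; 6; 10; 11; 5];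
  [:: 0; 1; 2; 3; 9; 7; 11; 10; 5; 6; 8; 4];
  [:: 0; 1; 2; 3; 10; 4; 5; 11; 9; 7; 6; 8];
  [:: 0; 1; 2; 3; 11; 8; 9; 5; 10; 4; 7; 6]])].

Lemma m12_chain_ok : chain_ok m12_chain.
Proof. by vm_compute. Qed.

Definition swap_tab (a b : nat) : seq nat :=
  [seq if i == a then b else if i == b then a else i | i <- tid].
Arguments tmul : simpl never.
Arguments swap_tab : simpl never.
Definition cycle_tab (s : seq nat) : seq nat :=
  if s is a :: s' then foldr (fun b l => tmul (swap_tab a b) l) tid s' else tid.
Definition cycles_tab (c : seq (seq nat)) : seq nat :=
  foldr (fun s l => tmul (cycle_tab s) l) tid c.

Lemma valid_tmul l m : valid l -> valid m -> valid (tmul l m).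
Proof.
move=> val_l val_m.
case/and3P: (val_l) => /eqP sz_l /allP lt_l uniq_l.
case/and3P: (val_m) => /eqP sz_m _ uniq_m.
rewrite /valid size_map sz_l map_inj_in_uniq ?uniq_l ?andbT /=.
  by apply/allP=> _ /mapP[i /lt_l lti ->]; apply: valid_lt.
move=> i j /lt_l lti /lt_l ltj /eqP.
by rewrite nth_uniq ?sz_m // => /eqP.
Qed.

Lemma swap_tabP a b : a < 12 -> b < 12 ->
  valid (swap_tab a b) /\ tperm (inord a) (inord b) = of_tab (swap_tab a b).
Proof.
move=> lta ltb; have val_ab : valid (swap_tab a b).
  apply/and3P; split; first by rewrite size_map.
    apply/allP=> _ /mapP[i + ->]; rewrite mem_iota => /andP[_ lti].
    by case: (i == a); case: (i == b).
  rewrite map_inj_in_uniq ?iota_uniq // => i j _ _.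
  by case: (i =P a); case: (i =P b); case: (j =P a); case: (j =P b); lia.
split=> //; apply: of_tab_eq => //; apply/allP=> i; rewrite mem_iota => /andP[_ lti].
rewrite (nth_map 0) ?size_iota // nth_iota // add0n; apply/eqP.
have eq_inord j : j < 12 -> (inord i == inord j :> 'I_12) = (i == j).
  by move=> ltj; rewrite -val_eqE /= !inordK.
case: tpermP => [/eqP | /eqP | /eqP + /eqP].
- by rewrite eq_inord // => ->; rewrite inordK.
- rewrite eq_inord // => /eqP->; rewrite eqxx inordK //.
  by case: eqP => [->|].
by rewrite !eq_inord // => /negPf-> /negPf->; rewrite inordK.
Qed.

Lemma cycle_tabP s : all (fun i => i < 12) s ->
  valid (cycle_tab s) /\ cycle_perm s = of_tab (cycle_tab s).
Proof.
case: s => [|a s] /=; first by rewrite of_tab1.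
case/andP=> lta; elim: s => [|b s IHs] /=; first by rewrite big_nil of_tab1.
case/andP=> /(swap_tabP lta)[val_ab abE] /IHs[val_s sE].
by rewrite big_cons abE sE of_tabM ?valid_tmul.
Qed.

Lemma cycles_tabP c : all (all (fun i => i < 12)) c ->
  valid (cycles_tab c) /\ cycles_perm c = of_tab (cycles_tab c).
Proof.
elim: c => [|s c IHc] /=; first by rewrite /cycles_perm big_nil of_tab1.
case/andP=> /cycle_tabP[val_s sE] /IHc[val_c cE].
by rewrite /cycles_perm big_cons sE -/(cycles_perm c) cE of_tabM ?valid_tmul.
Qed.

Definition m12_cycles : seq (seq (seq nat)) :=
  [:: [:: iota 0 11]; [:: [:: 2; 6; 10; 7]; [:: 3; 9; 4; 5]];
      [:: [:: 0; 11]; [:: 1; 10]; [:: 2; 5]; [:: 3; 7]; [:: 4; 8]; [:: 6; 9]]].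
Definition m12_gens : seq (seq nat) := map cycles_tab m12_cycles.

Lemma m12_gensP l : l \in m12_gens -> valid l /\ of_tab l \in mathieu12.
Proof.
case/mapP=> c cP ->; have c12 : all (all (fun i => i < 12)) c.
  by apply: allP c cP.
have [val_c cE] := cycles_tabP c12; split=> //; rewrite -cE mem_gen //.
by move: cP; rewrite !inE => /or3P[] /eqP->; rewrite eqxx ?orbT.
Qed.

Definition word_tab (w : seq nat) : seq nat :=
  foldr (fun k l => tmul (nth tid m12_gens k) l) tid w.

Lemma word_tabP w : all (fun k => k < 3) w ->
  valid (word_tab w) /\ of_tab (word_tab w) \in mathieu12.
Proof.
elim: w => [|k w IHw] /=; first by rewrite of_tab1 group1.
case/andP=> lt3k /IHw[val_w Mw].
have [|val_k Mk] := m12_gensP (mem_nth tid (_ : k < size m12_gens)) => //.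
by rewrite valid_tmul // of_tabM // groupM.
Qed.

Lemma m12_chain_group_set : group_set (chain_set m12_chain).
Proof.
apply/group_setP; split; first exact: chain_set1 m12_chain_ok.
move=> x y Lx Ly; apply: (subsetP (chain_set_mul m12_chain_ok)).
exact: mem_mulg.
Qed.

Lemma m12_sub_chain : mathieu12 \subset Group m12_chain_group_set.
Proof.
rewrite gen_subG.
have sift_gens : all (sifts m12_chain) m12_gens by vm_compute.
have inC c : c \in m12_cycles -> cycles_perm c \in chain_set m12_chain.
  move=> cP; have c12 : all (all (fun i => i < 12)) c by apply: allP c cP.
  have [_ ->] := cycles_tabP c12; apply: siftsP m12_chain_ok _.
  by apply: (allP sift_gens); apply: map_f.
by apply/subsetP=> s; rewrite !inE => /orP[/orP[] |] /eqP->; apply: inC;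
  rewrite !inE eqxx ?orbT.
Qed.

Lemma logn_card_mathieu12 : logn 2 #|mathieu12| <= 6.
Proof.
have := dvdn_leq_log 2 (cardG_gt0 _) (cardSg m12_sub_chain).
by rewrite (card_chain_set m12_chain_ok) !big_cons big_nil /= !lognM.
Qed.

(* Words in the letters 0, 1, 2, standing for the generators of M_12.         *)
Definition m12_word (w : seq nat) : 'S_12 := of_tab (word_tab w).
Definition is_word := all (fun k => k < 3).

Lemma is_word_cat u v : is_word (u ++ v) = is_word u && is_word v.
Proof. exact: all_cat. Qed.

Lemma m12_word_cat u v : is_word u -> is_word v ->
  m12_word (u ++ v) = (m12_word u * m12_word v)%g.
Proof.
move=> + wv; rewrite /m12_word; have [val_v _] := word_tabP wv.
elim: u => [|k u IHu] /=; first by rewrite of_tab1 mul1g.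
case/andP=> lt3k; rewrite -/(is_word u) => wu; have [val_u _] := word_tabP wu.
have wuv : is_word (u ++ v) by rewrite is_word_cat wu wv.
have [val_k _] := m12_gensP (mem_nth tid (lt3k : k < size m12_gens)).
have [val_uv _] := word_tabP wuv.
by rewrite !of_tabM // IHu // mulgA.
Qed.

Lemma m12_word_in w : is_word w -> m12_word w \in mathieu12.
Proof. by case/word_tabP. Qed.

Lemma m12_word1 w : word_tab w = tid -> m12_word w = 1%g.
Proof. by rewrite /m12_word => ->; exact: of_tab1. Qed.

(** Words for generators [x], [i], [t] that satisfy the relations of [H2_twisted_square]; as [t] is
    an involution, [m12_y] represents [x ^ t]. *)
Definition m12_x := [:: 1].
Definition m12_i := [:: 2; 0; 2; 1; 1; 0; 2; 0].
Definition m12_t := [:: 1; 0; 1; 1; 1; 0; 2; 0; 0].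
Definition m12_y := m12_t ++ m12_x ++ m12_t.

Definition m12_powers (w : seq nat) n := [seq flatten (nseq k w) | k <- iota 0 n].
(** The normal forms x^a y^b i^c t^d. Their 64 tables are distinct, which gives the lower bound on
    the order of the subgroup. *)
Definition m12_sylow_words := [seq u ++ v
  | u <- [seq u ++ v | u <- m12_powers m12_x 4, v <- m12_powers m12_y 4],
    v <- [seq u ++ v | u <- m12_powers m12_i 2, v <- m12_powers m12_t 2]].

Lemma m12_powersP (A : {group 'S_12}) w n : is_word w -> m12_word w \in A ->
  {in m12_powers w n, forall u, is_word u /\ m12_word u \in A}.
Proof.
move=> ww Aw _ /mapP[k _ ->]; elim: k => [|k [wk Ak]] /=.
  by rewrite m12_word1 ?group1.
by rewrite is_word_cat ww m12_word_cat // groupM.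
Qed.

Lemma m12_allpairsP (A : {group 'S_12}) (S T : seq (seq nat)) :
  {in S, forall u, is_word u /\ m12_word u \in A} ->
  {in T, forall u, is_word u /\ m12_word u \in A} ->
  {in [seq u ++ v | u <- S, v <- T], forall u, is_word u /\ m12_word u \in A}.
Proof.
move=> SA TA _ /allpairsP[[u v] [/= /SA[wu Au] /TA[wv Av] ->]].
by rewrite is_word_cat wu wv m12_word_cat // groupM.
Qed.

Lemma m12_card_words (S : seq (seq nat)) : {in S, forall u, is_word u} ->
  uniq (map word_tab S) -> #|[set s in map m12_word S]| = size S.
Proof.
move=> wS uniqS; rewrite cardsE -(size_map m12_word); apply/card_uniqP.
rewrite (map_comp of_tab word_tab) map_inj_in_uniq // => l m.
case/mapP=> u /wS/word_tabP[val_u _] -> /mapP[v /wS/word_tabP[val_v _] ->].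
exact: of_tab_inj.
Qed.

Lemma H2_mathieu12 : H2_detected mathieu12.
Proof.
set x := m12_word m12_x; set i := m12_word m12_i; set t := m12_word m12_t.
have t2 : (t ^+ 2 = 1)%g.
  by rewrite expg2 -m12_word_cat // m12_word1 //; vm_compute.
have i2 : (i ^+ 2 = 1)%g.
  by rewrite expg2 -m12_word_cat // m12_word1 //; vm_compute.
have x4 : (x ^+ 4 = 1)%g.
  by rewrite !expgS expg0 mulg1 -!m12_word_cat // m12_word1 //; vm_compute.
have xt : (x ^ t)%g = m12_word m12_y.
  rewrite !m12_word_cat // conjgE -/t -/x.
  by have -> : (t^-1 = t)%g by apply: (mulgI t); rewrite mulgV -t2.
have ix2 : ((i * x) ^+ 2 = 1)%g.
  by rewrite expg2 -!m12_word_cat // m12_word1 //; vm_compute.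
have it2 : ((i * t) ^+ 2 = 1)%g.
  by rewrite expg2 -!m12_word_cat // m12_word1 //; vm_compute.
have ixx2 : ((i * (x * x ^ t)) ^+ 2 = 1)%g.
  by rewrite xt expg2 -!m12_word_cat // m12_word1 //; vm_compute.
pose P := (<[x]> <*> <[x ^ t]> <*> <[i]> <*> <[t]>)%G.
have sPM : P \subset mathieu12.
  by rewrite !join_subG !cycle_subG xt !m12_word_in.
have oP : #|P| = 64.
  apply/eqP; rewrite eqn_leq card_twisted_square_leq //=.
  have wordsP : {in m12_sylow_words, forall u, is_word u /\ m12_word u \in P}.
    apply: m12_allpairsP; apply: m12_allpairsP; apply: m12_powersP => //.
    + rewrite -cycle_subG; do 2 apply: subset_trans (joing_subl _ _).
      exact: joing_subl.
    + rewrite -xt -cycle_subG; do 2 apply: subset_trans (joing_subl _ _).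
      exact: joing_subr.
    + rewrite -cycle_subG; apply: subset_trans (joing_subl _ _).
      exact: joing_subr.
    by rewrite -cycle_subG joing_subr.
  have uniqW : uniq (map word_tab m12_sylow_words) by vm_compute.
  have <- : #|[set s in map m12_word m12_sylow_words]| = 64.
    rewrite (m12_card_words _ uniqW) => [|u /wordsP[] //].
    by vm_compute.
  by apply/subset_leq_card/subsetP=> s; rewrite inE => /mapP[w /wordsP[_ Pw] ->].
apply: (H2_odd_index sPM).
  have l6 : logn 2 #|P| = 6 by rewrite oP.
  apply: odd_index_logn => //; apply/eqP.
  by rewrite eqn_leq dvdn_leq_log ?cardSg //= l6 logn_card_mathieu12.
by apply: (@H2_twisted_square _ P x i t) => //; rewrite oP.
Qed.

(** * Two-adic valuations *)

Lemma lognD_lt p a b : prime p -> 0 < b -> logn p b < logn p a ->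
  logn p (a + b) = logn p b.
Proof.
move=> p_pr b_gt0 ltba; have ab_gt0 : 0 < a + b by rewrite addn_gt0 b_gt0 orbT.
have [-> | a_gt0] := posnP a; first by [].
have dvd_a k : k <= logn p a -> p ^ k %| a by rewrite pfactor_dvdn.
apply/eqP; rewrite eqn_leq leqNgt -!pfactor_dvdn // !dvdn_addr ?dvd_a ?(ltnW ltba) //.
by rewrite pfactor_dvdnn pfactor_dvdn // ltnn.
Qed.

Lemma logn_add1_mod4 x : x %% 4 = 1 -> logn 2 (x + 1) = 1.
Proof.
move=> x1; apply/eqP; rewrite eqn_leq leqNgt -!pfactor_dvdn ?addn1 //.
by rewrite !dvdn_eq /=; lia.
Qed.

Section PowerMinusOne.

Variable q : nat.
Hypotheses (q_gt1 : 1 < q) (odd_q : odd q).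
Local Notation d m := (logn 2 (q ^ m - 1)).

Let odd_qX m : odd (q ^ m).
Proof. by rewrite oddX odd_q orbT. Qed.

Let qX_gt1 m : 0 < m -> 1 < q ^ m.
Proof. by move=> m_gt0; rewrite -(exp1n m) ltn_exp2r. Qed.

(** The quotient of the two numbers is a sum of [o] odd powers, hence odd. *)
Lemma logn_pow_sub1_mul_odd m o : 0 < m -> odd o -> d (m * o) = d m.
Proof.
move=> m_gt0 odd_o; rewrite expnM !subn1 predn_exp.
have odd_sum e : odd (\sum_(i < e) (q ^ m) ^ i) = odd e.
  elim: e => [|e IHe]; first by rewrite big_ord0.
  by rewrite big_ord_recr /= oddD IHe oddX odd_qX orbT addbT.
by rewrite mulnC logn_Gauss // coprime2n odd_sum.
Qed.

Lemma logn_pow_sub1_double m : 0 < m -> d (m * 2) = d m + logn 2 (q ^ m + 1).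
Proof.
move=> m_gt0; rewrite expnM -[X in _ - X](exp1n 2) subn_sqr.
by rewrite lognM // ?addn1 // subn_gt0 qX_gt1.
Qed.

Lemma logn_pow_add1_gt0 m : 0 < logn 2 (q ^ m + 1).
Proof. by rewrite logn_gt0 mem_primes /= addn1 /= dvdn2 /= odd_qX. Qed.

Lemma logn_pow2_sub1_lt s k : s < k -> d (2 ^ s) < d (2 ^ k).
Proof.
elim: k => // k IHk; rewrite ltnS leq_eqVlt => lesk.
rewrite expnSr logn_pow_sub1_double ?expn_gt0 //.
have := logn_pow_add1_gt0 (2 ^ k).
by case/orP: lesk => [/eqP-> | /IHk]; lia.
Qed.

(** The difference of the two numbers is q^j (q^(2^k) - 1). Its valuation exceeds that of q^j - 1,
    because the 2-part of [j] is smaller than 2^k. *)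
Lemma logn_pow_sub1_add k j : 0 < j < 2 ^ k -> d (2 ^ k + j) = d j.
Proof.
case/andP=> j_gt0 ltj.
have -> : q ^ (2 ^ k + j) - 1 = q ^ j * (q ^ 2 ^ k - 1) + (q ^ j - 1).
  have := qX_gt1 j_gt0; have := qX_gt1 (expn_gt0 2 k); rewrite expnD mulnBr muln1.
  move: (q ^ j) (q ^ 2 ^ k) => x y; rewrite mulnC; move=> y1 x1.
  have : x <= x * y by rewrite leq_pmulr // ltnW.
  by lia.
have qj1 : 0 < q ^ j - 1 by rewrite subn_gt0 qX_gt1.
apply: lognD_lt => //; rewrite logn_Gauss ?coprime2n ?odd_qX //.
have [o odd_o jE] := pfactor_coprime (isT : prime 2) j_gt0.
rewrite coprime2n in odd_o; rewrite {1}jE mulnC logn_pow_sub1_mul_odd ?expn_gt0 //.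
apply: logn_pow2_sub1_lt; rewrite -(ltn_exp2l _ _ (isT : 1 < 2)).
by apply: leq_ltn_trans ltj; rewrite {2}jE leq_pmull // odd_gt0.
Qed.

End PowerMinusOne.

Local Open Scope group_scope.

(** * General linear groups *)

(** Singular matrices are sent to 1. *)
Definition mkGL (F : finFieldType) n (A : 'M[F]_n.-1.+1) : {'GL_n[F]} :=
  insubd (1 : {'GL_n[F]}) A.

Lemma mkGLE (F : finFieldType) n (A : 'M[F]_n.-1.+1) :
  A \in unitmx -> GLval (mkGL A) = A.
Proof. by move=> uA; rewrite /mkGL -[LHS]/(val _) val_insubd ifT. Qed.

Lemma GL_inj (F : finFieldType) n : injective (@GLval n F).
Proof. exact: val_inj. Qed.

Lemma sq_injm_sub (gT aT : finGroupType) (D G : {group gT})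
    (h : {morphism D >-> aT}) : 'injm h -> G \subset D ->
  sq_detected G -> sq_detected (h @* G).
Proof.
move=> injh sGD dG.
have -> : (h @* G)%G = (restrm sGD h @* G)%G by apply/val_inj; rewrite /= im_restrm.
exact: sq_injm (injm_restrm sGD injh) dG.
Qed.

Section DirectSum.

Variables (F : finFieldType) (a b : nat).
Local Notation GLa := {'GL_a.+1[F]}.
Local Notation GLb := {'GL_b.+1[F]}.
Local Notation GLab := {'GL_(a.+1 + b.+1)[F]}.

(** Ranks are written as successors so that the matrix size is convertible to [a.+1 + b.+1]. *)
Definition dsum_mx (g : GLa) (h : GLb) : 'M[F]_((a.+1 + b.+1).-1.+1) :=
  (block_mx (GLval g) 0 0 (GLval h))%R.
Definition dsum (g : GLa) (h : GLb) : GLab := mkGL (dsum_mx g h).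

Lemma dsumE g h : GLval (dsum g h) = dsum_mx g h.
Proof.
apply: mkGLE; rewrite unitmxE.
have -> : (\det (dsum_mx g h) = \det (GLval g) * \det (GLval h))%R.
  exact: (@det_ublock F a.+1 b.+1 (GLval g) 0%R (GLval h)).
by rewrite unitrM -!unitmxE !GL_unitmx.
Qed.

Lemma dsumM g h g' h' : dsum (g * g') (h * h') = dsum g h * dsum g' h'.
Proof.
apply: GL_inj; rewrite GL_MxE !dsumE /dsum_mx !GL_MxE.
rewrite [RHS](@mulmx_block F a.+1 b.+1 a.+1 b.+1 a.+1 b.+1).
by rewrite !mulmx0 !mul0mx !addr0 !add0r.
Qed.

Lemma dsum_inj g h g' h' : dsum g h = dsum g' h' -> g = g' /\ h = h'.
Proof.
move=> /(congr1 (@GLval _ _)); rewrite !dsumE => eq_gh.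
have [e1 _ _ e2] := @eq_block_mx F a.+1 b.+1 a.+1 b.+1 _ _ _ _ _ _ _ _ eq_gh.
by split; apply: GL_inj.
Qed.

Definition dsuml (g : GLa) : GLab := dsum g 1.
Definition dsumr (h : GLb) : GLab := dsum 1 h.

Lemma dsuml_morph : {in [set: GLa] &, {morph dsuml : x y / x * y}}.
Proof. by move=> x y _ _; rewrite /dsuml -dsumM mulg1. Qed.
Lemma dsumr_morph : {in [set: GLb] &, {morph dsumr : x y / x * y}}.
Proof. by move=> x y _ _; rewrite /dsumr -dsumM mulg1. Qed.
Canonical dsuml_morphism := Morphism dsuml_morph.
Canonical dsumr_morphism := Morphism dsumr_morph.

Lemma injm_dsuml : 'injm dsuml.
Proof. by apply/injmP=> x y _ _ /dsum_inj[]. Qed.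
Lemma injm_dsumr : 'injm dsumr.
Proof. by apply/injmP=> x y _ _ /dsum_inj[]. Qed.

Variables (Ga : {group GLa}) (Gb : {group GLb}).

Definition dsum_group : {group GLab} := (dsuml @* Ga <*> dsumr @* Gb)%G.

Lemma dprod_dsum : dsuml @* Ga \x dsumr @* Gb = dsum_group.
Proof.
apply: dprodEY.
  apply/centsP=> _ /morphimP[g _ _ ->] _ /morphimP[h _ _ ->].
  by rewrite /commute /dsuml /dsumr -!dsumM !mulg1 !mul1g.
apply/trivgP/subsetP=> _ /setIP[/morphimP[g _ _ ->] /morphimP[h _ _ /dsum_inj[-> _]]].
by rewrite inE; apply/eqP/(morph1 dsuml_morphism).
Qed.

Lemma card_dsum_group : #|dsum_group| = (#|Ga| * #|Gb|)%N.
Proof.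
by rewrite -(dprod_card dprod_dsum) !card_injm ?injm_dsuml ?injm_dsumr ?subsetT.
Qed.

Lemma dsum_groupP x : x \in dsum_group ->
  exists g h, [/\ g \in Ga, h \in Gb & x = dsum g h].
Proof.
rewrite -(dprodW dprod_dsum) => /mulsgP[_ _ /morphimP[g _ Gg ->] /morphimP[h _ Gh ->] ->].
by exists g, h; rewrite /= /dsuml /dsumr -dsumM mulg1 mul1g.
Qed.

Lemma dsum_group_sub (G : {group GLab}) :
  {in Ga & Gb, forall g h, dsum g h \in G} -> dsum_group \subset G.
Proof. by move=> sG; apply/subsetP=> x /dsum_groupP[g [h [Gg Gh ->]]]; apply: sG. Qed.

Lemma sq_dsum_group : sq_detected Ga -> sq_detected Gb -> sq_detected dsum_group.
Proof.
move=> da db; apply: sq_dprod dprod_dsum _ _.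
  exact: sq_injm_sub injm_dsuml (subsetT _) da.
exact: sq_injm_sub injm_dsumr (subsetT _) db.
Qed.

End DirectSum.

Lemma sq_dsum (F : finFieldType) a b (Ga : {group {'GL_a.+1[F]}})
    (Gb : {group {'GL_b.+1[F]}}) (G : {group {'GL_(a.+1 + b.+1)[F]}}) :
    {in Ga & Gb, forall g h, dsum g h \in G} ->
    logn 2 #|G| = (logn 2 #|Ga| + logn 2 #|Gb|)%N ->
  sq_detected Ga -> sq_detected Gb -> sq_detected G.
Proof.
move=> /dsum_group_sub sG lG da db.
apply: (sq_odd_index sG); last exact: sq_dsum_group.
by apply: odd_index_logn => //; rewrite card_dsum_group lognM ?cardG_gt0.
Qed.

Section Swap.

Variables (F : finFieldType) (a : nat).

Definition swap_mx : 'M[F]_((a.+1 + a.+1).-1.+1) :=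
  (block_mx (0 : 'M_a.+1) 1%:M 1%:M (0 : 'M_a.+1))%R.
Definition swapGL : {'GL_(a.+1 + a.+1)[F]} := mkGL swap_mx.

Lemma swap_mx_sqr : (swap_mx *m swap_mx)%R = 1%:M%R.
Proof.
rewrite [LHS](@mulmx_block F a.+1 a.+1 a.+1 a.+1 a.+1 a.+1).
rewrite !mulmx0 !mul0mx !mul1mx !addr0 !add0r.
exact/esym/(@scalar_mx_block F a.+1 a.+1 1%R).
Qed.

Lemma swapGLE : GLval swapGL = swap_mx.
Proof. by apply: mkGLE; have [] := mulmx1_unit swap_mx_sqr. Qed.

Lemma swapGL_sqr : swapGL ^+ 2 = 1.
Proof. by apply: GL_inj; rewrite expg2 GL_MxE swapGLE swap_mx_sqr. Qed.

Lemma dsumJ_swap (g h : {'GL_a.+1[F]}) : dsum g h ^ swapGL = dsum h g.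
Proof.
have swapV : swapGL^-1 = swapGL by apply: (mulgI swapGL); rewrite mulgV -swapGL_sqr.
rewrite conjgE swapV; apply: GL_inj; rewrite !GL_MxE !dsumE swapGLE.
have -> : (dsum_mx g h *m swap_mx)%R
    = (swap_mx *m dsum_mx h g)%R.
  rewrite [LHS](@mulmx_block F a.+1 a.+1 a.+1 a.+1 a.+1 a.+1).
  rewrite [RHS](@mulmx_block F a.+1 a.+1 a.+1 a.+1 a.+1 a.+1).
  by rewrite !mulmx0 !mul0mx !mul1mx !mulmx1 !addr0 !add0r.
by rewrite mulmxA swap_mx_sqr mul1mx.
Qed.

(** The swap doubles the order of the group of block sums, whence the successor in the valuation. *)
Lemma sq_dsum_swap (Ga : {group {'GL_a.+1[F]}}) (G : {group {'GL_(a.+1 + a.+1)[F]}}) :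
    {in Ga &, forall g h, dsum g h \in G} -> swapGL \in G ->
    logn 2 #|G| = (logn 2 #|Ga| + logn 2 #|Ga|).+1 ->
  sq_detected Ga -> sq_detected G.
Proof.
move=> sG Gs lG da; pose N := dsum_group Ga Ga.
have sNG : N \subset G by apply: dsum_group_sub.
have nNs : swapGL \notin N.
  apply/negP=> /dsum_groupP[g [h [_ _ /(congr1 (@GLval _ _))]]].
  rewrite dsumE swapGLE => eq_bl.
  have [_ e1 _ _] := @eq_block_mx F a.+1 a.+1 a.+1 a.+1 _ _ _ _ _ _ _ _ eq_bl.
  by move/eqP: e1; rewrite -[1%:M%R]/(1%R : 'M_a.+1) oner_eq0.
pose H := (N <*> <[swapGL]>)%G.
have sHG : H \subset G by rewrite join_subG sNG cycle_subG.
have defHt : (@dsuml F a a @* Ga) :^ swapGL = @dsumr F a a @* Ga.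
  apply/eqP; rewrite eqEcard cardJg !card_injm ?injm_dsuml ?injm_dsumr ?subsetT //.
  rewrite leqnn andbT; apply/subsetP=> _ /imsetP[_ /morphimP[g _ Gg ->] ->].
  rewrite dsumJ_swap; exact: (mem_morphim (dsumr_morphism F a a) (in_setT g) Gg).
have nNsw : swapGL \in 'N(N).
  rewrite inE; apply/subsetP=> _ /imsetP[_ /dsum_groupP[g [h [Gg Gh ->]]] ->].
  rewrite dsumJ_swap -(mulg1 h) -(mul1g g) dsumM; apply: groupM.
    apply: mem_gen; rewrite inE.
    by rewrite (mem_morphim (dsuml_morphism F a a) (in_setT h) Gh).
  apply: mem_gen; rewrite inE orbC.
  by rewrite (mem_morphim (dsumr_morphism F a a) (in_setT g) Gg).
have oH : #|H| = (#|N| * 2)%N.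
  apply/eqP; rewrite eqn_leq card_joing_cycle_leq ?swapGL_sqr //=.
  rewrite -(Lagrange (joing_subl N <[swapGL]>)) leq_pmul2l ?cardG_gt0 //.
  rewrite indexg_gt1; apply: contra nNs => sHN.
  by apply: (subsetP sHN); rewrite mem_gen // inE cycle_id orbT.
apply: (sq_odd_index sHG).
  apply: odd_index_logn => //; rewrite oH card_dsum_group !lognM ?muln_gt0 ?cardG_gt0 //.
  by rewrite lG (_ : logn 2 2 = 1%N) ?addn1.
apply: (@sq_wreath _ (@dsuml F a a @* Ga)%G N H swapGL) => //.
- by rewrite -(dprod_dsum Ga Ga) -defHt.
- exact: swapGL_sqr.
exact: sq_injm_sub (injm_dsuml _ _ _) (subsetT _) da.
Qed.

End Swap.

Local Close Scope group_scope.
Local Open Scope ring_scope.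

(** * Fields of odd order, and GL_2 over a field with 3 mod 4 elements *)

Section OddField.

Variable F : finFieldType.
Hypothesis oddF : odd #|F|.

Lemma expf_card_pred (x : F) : x != 0 -> x ^+ #|F|.-1 = 1.
Proof.
move=> x0; apply: (mulfI x0).
by rewrite -exprS prednK ?odd_gt0 // expf_card mulr1.
Qed.

Lemma two_neq0 : 2%:R != 0 :> F.
Proof.
apply/eqP=> F2; have := expg_cardG (in_setT (1 : F)).
rewrite FinRing.zmodXgE cardsT -(odd_double_half #|F|) oddF -muln2 mulrS mulrnA.
by rewrite mulrnAC -[1 *+ 2]/(2%:R) F2 mul0rn addr0 => /eqP; rewrite oner_eq0.
Qed.

End OddField.

Section ThreeMod4.

Variable F : finFieldType.
Hypothesis F3 : #|F| = 3 %[mod 4].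
Let o := (#|F|.-1)./2.

Lemma odd_card3 : odd #|F|.
Proof. by move: F3; lia. Qed.

Let F_gt0 : (0 < #|F|)%N := odd_gt0 odd_card3.

Lemma card_pred3 : #|F|.-1 = (o * 2)%N /\ odd o.
Proof. by rewrite /o; move: F3 F_gt0; lia. Qed.

Lemma half_pow_sign (x : F) : x != 0 -> x ^+ o = 1 \/ x ^+ o = -1.
Proof.
move=> x0; have := expf_card_pred odd_card3 x0.
rewrite (proj1 card_pred3) exprM => /eqP; rewrite sqrf_eq1.
by case/orP=> /eqP; auto.
Qed.

Lemma neq_opp1 : (1 : F) != -1.
Proof. by rewrite -subr_eq0 opprK (two_neq0 odd_card3). Qed.

(** If x^2 = -1, then x^(q-1) = (-1)^o = -1, since [o] is odd. *)
Lemma sqrf_neq_opp1 (x : F) : x ^+ 2 != -1.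
Proof.
have [oE odd_o] := card_pred3.
have [->|x0] := eqVneq x 0; first by rewrite expr0n /= eq_sym oppr_eq0 oner_eq0.
apply: contra neq_opp1 => /eqP x2; have := expf_card_pred odd_card3 x0.
by rewrite oE mulnC exprM x2 -signr_odd odd_o expr1 => ->.
Qed.

Lemma sum_sqr_eq0 (a b : F) : (a ^+ 2 + b ^+ 2 == 0) = (a == 0) && (b == 0).
Proof.
apply/idP/andP=> [|[/eqP-> /eqP->]]; last by rewrite !expr0n addr0.
have [-> | b0] := eqVneq b 0; first by rewrite expr0n addr0 expf_eq0.
rewrite addr_eq0 => /eqP ab; have := sqrf_neq_opp1 (a / b).
by rewrite expr_div_n ab mulNr divff ?expf_neq0 // eqxx.
Qed.

(** The exponent o + 1 is even and c^(o+1) is c or -c. *)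
Lemma sign_sqr (c : F) : c != 0 -> exists d, d != 0 /\ (c = d ^+ 2 \/ c = - d ^+ 2).
Proof.
move=> c0; have [oE odd_o] := card_pred3.
exists (c ^+ (o.+1)./2); split; first by rewrite expf_neq0.
have -> : (c ^+ (o.+1)./2) ^+ 2 = c ^+ o * c.
  by rewrite -exprM -exprSr; congr (_ ^+ _); lia.
by case: (half_pow_sign c0) => ->; rewrite ?mul1r ?mulN1r ?opprK; auto.
Qed.

End ThreeMod4.

Section Matrix2.

Variable F : fieldType.

Definition mx2 (a b c d : F) : 'M[F]_2 :=
  \matrix_(i, j) nth 0 (nth [::] [:: [:: a; b]; [:: c; d]] i) j.

Lemma mx2M a b c d a' b' c' d' : mx2 a b c d *m mx2 a' b' c' d' =
  mx2 (a * a' + b * c') (a * b' + b * d') (c * a' + d * c') (c * b' + d * d').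
Proof.
apply/matrixP=> i j; rewrite !mxE !big_ord_recl big_ord0 !mxE addr0 /=.
by case: i => [[|[|//]] ?]; case: j => [[|[|//]] ?].
Qed.

Lemma mx2_scalar c : mx2 c 0 0 c = c%:M.
Proof.
apply/matrixP=> i j; rewrite !mxE -val_eqE.
by case: i => [[|[|//]] ?]; case: j => [[|[|//]] ?].
Qed.

Lemma mx2_eta (A : 'M[F]_2) : A = mx2 (A ord0 ord0) (A ord0 ord_max) (A ord_max ord0) (A ord_max ord_max).
Proof.
apply/matrixP=> i j; rewrite !mxE.
by case: i => [[|[|//]] ?]; case: j => [[|[|//]] ?]; congr (A _ _); apply/val_inj.
Qed.

Lemma mx2_inj a b c d a' b' c' d' :
  mx2 a b c d = mx2 a' b' c' d' -> [/\ a = a', b = b', c = c' & d = d'].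
Proof.
move/matrixP=> eqA; split.
- by have := eqA ord0 ord0; rewrite !mxE.
- by have := eqA ord0 ord_max; rewrite !mxE.
- by have := eqA ord_max ord0; rewrite !mxE.
by have := eqA ord_max ord_max; rewrite !mxE.
Qed.

Lemma mx2_unit a b c d : (mx2 a b c d \in unitmx) = (a * d - b * c != 0).
Proof.
rewrite unitmxE unitfE (expand_det_row _ ord0) !big_ord_recl big_ord0.
rewrite /cofactor !det_mx11 !mxE /= addr0 expr0 expr1 mul1r.
by rewrite mulN1r mulrN.
Qed.

End Matrix2.

Section GL2.

Variable F : finFieldType.
Hypothesis F3 : #|F| = 3 %[mod 4].
Local Notation q := #|F|.
Let o := (q.-1)./2.
Local Notation GL2 := {'GL_2[F]}.
Local Notation G := 'GL_2[F]%G.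

Definition gl2 (a b c d : F) : GL2 := @mkGL F 2 (mx2 a b c d).

Arguments gl2 (a b c d)%_R.
Lemma gl2E a b c d : a * d - b * c != 0 -> GLval (gl2 a b c d) = mx2 a b c d.
Proof. by move=> D0; apply: mkGLE; rewrite mx2_unit. Qed.

Lemma gl2P (g : GL2) : exists a b c d, a * d - b * c != 0 /\ g = gl2 a b c d.
Proof.
have gE : GLval g = mx2 (GLval g ord0 ord0) (GLval g ord0 ord_max)
  (GLval g ord_max ord0) (GLval g ord_max ord_max) := mx2_eta (GLval g).
move: gE; set a := GLval g _ _; set b := GLval g _ _; set c := GLval g _ _.
set d := GLval g _ _ => gE; have D0 : a * d - b * c != 0.
  by rewrite -mx2_unit -gE; exact: (GL_unitmx g).
by exists a, b, c, d; split=> //; apply: GL_inj; rewrite gl2E.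
Qed.

Lemma gl2M a b c d a' b' c' d' : a * d - b * c != 0 -> a' * d' - b' * c' != 0 ->
  (gl2 a b c d * gl2 a' b' c' d')%g =
  gl2 (a * a' + b * c') (a * b' + b * d') (c * a' + d * c') (c * b' + d * d').
Proof.
move=> D0 D0'; apply: GL_inj; rewrite GL_MxE !gl2E ?mx2M //.
rewrite [X in X != 0](_ : _ = (a * d - b * c) * (a' * d' - b' * c')); last by ring.
by rewrite mulf_neq0.
Qed.

Definition scal2 (c : F) : GL2 := gl2 c 0 0 c.

Let scal2_det (c : F) : c != 0 -> c * c - 0 * 0 != 0.
Proof. by move=> c0; rewrite mul0r subr0 mulf_neq0. Qed.

Lemma scal2E c : c != 0 -> GLval (scal2 c) = c%:M.
Proof. by move=> c0; rewrite gl2E ?scal2_det // mx2_scalar. Qed.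

Lemma scal2M c d : c != 0 -> d != 0 -> scal2 (c * d) = (scal2 c * scal2 d)%g.
Proof.
move=> c0 d0; apply: GL_inj; rewrite GL_MxE !scal2E ?mulf_neq0 //.
exact: scalar_mxM.
Qed.

Lemma scal2_1 : scal2 1 = 1%g.
Proof. by apply: GL_inj; rewrite scal2E ?oner_eq0. Qed.

Lemma scal2_inj c d : c != 0 -> d != 0 -> scal2 c = scal2 d -> c = d.
Proof.
move=> c0 d0 /(congr1 (@GLval _ _)); rewrite !gl2E ?scal2_det //.
by case/mx2_inj.
Qed.

Lemma scal2X c n : c != 0 -> scal2 (c ^+ n) = (scal2 c ^+ n)%g.
Proof.
move=> c0; elim: n => [|n IHn]; first by rewrite expr0 scal2_1.
by rewrite exprS expgS scal2M ?expf_neq0 // IHn.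
Qed.

Lemma scal2C c (g : GL2) : c != 0 -> commute (scal2 c) g.
Proof.
move=> c0; apply: GL_inj; rewrite !GL_MxE scal2E //.
by rewrite mul_scalar_mx mul_mx_scalar.
Qed.

Definition scalars2 : {set GL2} := [set scal2 c | c in [set c : F | c != 0]].

Lemma scalars2P g : reflect (exists2 c, c != 0 & g = scal2 c) (g \in scalars2).
Proof.
apply: (iffP imsetP) => [[c + ->] | [c c0 ->]]; last by exists c; rewrite ?inE.
by rewrite inE => c0; exists c.
Qed.

Lemma scalars2_group_set : group_set scalars2.
Proof.
apply/group_setP; split; first by apply/scalars2P; exists 1; rewrite ?oner_eq0 ?scal2_1.
move=> _ _ /scalars2P[c c0 ->] /scalars2P[d d0 ->].
by apply/scalars2P; exists (c * d); rewrite ?mulf_neq0 ?scal2M.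
Qed.
Definition scalars2_group := Group scalars2_group_set.
Local Notation C := scalars2_group.

Lemma card_scalars2 : #|C| = q.-1.
Proof.
rewrite card_in_imset => [|c d]; last by rewrite !inE; apply: scal2_inj.
rewrite (_ : [set c : F | c != 0] = [set~ 0]) ?cardsC1 //.
by apply/setP=> c; rewrite !inE.
Qed.

Lemma scalars2_cent : (C \subset 'C(G))%g.
Proof.
by apply/centsP=> _ /scalars2P[c c0 ->] g _; apply: scal2C.
Qed.

(** [L] contains all squares and all involutions, hence every [x] with x^(2o) = 1, because x^o is
    [x] times a square. Transvections are squares, as 2 is invertible, and diagonal matrices have
    order dividing q - 1 = 2o; together they generate. *)
Lemma H1_GL2 : H1_detected G.
Proof.
move=> L sLG Linv L2; have [qE odd_o] := card_pred3 F3.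
have L_sqr (x : GL2) : (x ^+ 2)%g \in L.
  have [Lx | nLx] := boolP (x \in L); first exact: groupX.
  by apply: L2; rewrite !inE nLx.
have L_odd (x : GL2) : (x ^+ (o * 2) = 1)%g -> x \in L.
  move=> x1; have Lxo : (x ^+ o)%g \in L by apply: Linv; rewrite ?inE // -expgM.
  rewrite -(mulgK ((x ^+ o./2) ^+ 2)%g x) groupM ?groupV ?L_sqr //.
  rewrite -expgM -expgS; suff -> : (o./2 * 2).+1 = o by [].
  by rewrite muln2 -[RHS]odd_double_half odd_o.
have det1 (a d b c : F) : a != 0 -> d != 0 -> b * c = 0 -> a * d - b * c != 0.
  by move=> a0 d0 ->; rewrite subr0 mulf_neq0.
have L_U b : gl2 1 b 0 1 \in L.
  have -> : gl2 1 b 0 1 = (gl2 1 (b / 2%:R)%R 0 1 ^+ 2)%g.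
    rewrite expg2 gl2M ?det1 ?oner_eq0 ?mulr0 //; congr gl2; try by ring.
    by have := two_neq0 (odd_card3 F3) => two0; field.
  exact: L_sqr.
have L_V c : gl2 1 0 c 1 \in L.
  have -> : gl2 1 0 c 1 = (gl2 1 0 (c / 2%:R)%R 1 ^+ 2)%g.
    rewrite expg2 gl2M ?det1 ?oner_eq0 ?mul0r //; congr gl2; try by ring.
    by have := two_neq0 (odd_card3 F3) => two0; field.
  exact: L_sqr.
have L_D a d : a != 0 -> d != 0 -> gl2 a 0 0 d \in L.
  move=> a0 d0; apply: L_odd.
  have DX n : (gl2 a 0%R 0%R d ^+ n)%g = gl2 (a ^+ n) 0 0 (d ^+ n).
    elim: n => [|n IHn]; first by rewrite !expr0 -/(scal2 1) scal2_1.
    rewrite expgS IHn gl2M ?det1 ?expf_neq0 ?mul0r // !exprS.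
    by congr gl2; ring.
  by rewrite DX -qE !(expf_card_pred (odd_card3 F3)) // -/(scal2 1) scal2_1.
have L_a a b c d : a != 0 -> a * d - b * c != 0 -> gl2 a b c d \in L.
  move=> a0 D0; pose e := d - b * c / a.
  have e0 : e != 0.
    have -> : e = (a * d - b * c) / a by rewrite /e; field.
    by rewrite mulf_neq0 ?invr_neq0.
  have -> : gl2 a b c d = (gl2 1 0 (c / a)%R 1 * (gl2 a 0 0 e * gl2 1 (b / a)%R 0 1))%g.
    rewrite (@gl2M a) ?det1 ?oner_eq0 ?mul0r ?mulr0 //.
    rewrite !(mulr0, mul0r, mulr1, addr0, add0r) gl2M ?det1 ?oner_eq0 ?mul0r //.
      by congr gl2; rewrite /e; field.
    by rewrite mulr0.
  by rewrite !groupM ?L_U ?L_V ?L_D.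
apply/eqP; rewrite eqEsubset sLG; apply/subsetP=> g _.
have [a [b [c [d [D0 ->]]]]] := gl2P g.
have [a0 | a0] := eqVneq a 0; last exact: L_a.
(* Adding the second row to the first makes the upper left entry nonzero. *)
rewrite -(mulKg (gl2 1 1 0 1) (gl2 a b c d)) groupM ?groupV ?L_U //.
have D1 : 1 * 1 - 1 * 0 != 0 :> F by rewrite mulr0 subr0 mulr1 oner_eq0.
rewrite (gl2M D1 D0); apply: L_a.
  rewrite a0 mulr0 add0r mul1r; apply: contra D0 => /eqP->.
  by rewrite a0 mul0r mulr0 subr0.
by rewrite [X in X != 0](_ : _ = a * d - b * c) //; ring.
Qed.

Definition J2 : GL2 := gl2 0 1 (-1) 0.

Let J2_det : 0 * 0 - 1 * -1 != 0 :> F.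
Proof. by rewrite mul0r mul1r opprK add0r oner_eq0. Qed.

Let opp1_neq0 : -1 != 0 :> F.
Proof. by rewrite oppr_eq0 oner_eq0. Qed.

Lemma J2_sqr : (J2 ^+ 2)%g = scal2 (-1).
Proof. by rewrite expg2 gl2M //; congr gl2; ring. Qed.

(** The rows of the conjugating matrix are the first basis vector and its image under [x]. They are
    independent: if b = 0, then a^2 = -1. *)
Lemma sqr_opp1_conj (x : GL2) : (x ^+ 2)%g = scal2 (-1) -> exists g, x = (J2 ^ g)%g.
Proof.
have [a [b [c [d [D0 ->]]]]] := gl2P x.
rewrite expg2 gl2M // => /(congr1 (@GLval _ _)); rewrite !gl2E ?scal2_det //; last first.
  rewrite [X in X != 0](_ : _ = (a * d - b * c) ^+ 2) ?expf_neq0 //; ring.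
case/mx2_inj=> e1 e2 _ _.
have b0 : b != 0.
  apply: contraNneq (sqrf_neq_opp1 F3 a) => b0.
  by rewrite -e1 b0 mul0r addr0.
have P0 : 1 * b - 0 * a != 0 by rewrite mul1r mul0r subr0.
exists (gl2 1 0 a b); apply: (mulgI (gl2 1 0 a b)).
rewrite -conjgC !gl2M //; congr gl2; last by rewrite e2; ring.
- by ring.
- by ring.
by rewrite e1; ring.
Qed.

(* As -1 is not a square, this is the multiplicative group of F(sqrt(-1)).    *)
Definition torus2 := 'C[J2]%G.
Local Notation T := torus2.

Lemma torus2P g : reflect (exists a b, a ^+ 2 + b ^+ 2 != 0 /\ g = gl2 a b (- b) a) (g \in T).
Proof.
apply: (iffP cent1P) => [|[a [b [ab0 ->]]]]; last first.
  have D0 : a * a - b * - b != 0 by rewrite mulrN opprK -!expr2.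
  by rewrite /commute !gl2M //; congr gl2; ring.
have [a [b [c [d [D0 ->]]]]] := gl2P g; rewrite /commute !gl2M //.
move/(congr1 (@GLval _ _)); rewrite !gl2E; last 2 first.
- by rewrite [X in X != 0](_ : _ = a * d - b * c) //; ring.
- by rewrite [X in X != 0](_ : _ = a * d - b * c) //; ring.
case/mx2_inj; rewrite !(mulr0, mul0r, mulr1, mul1r, add0r, addr0, mulrN1, mulN1r).
move=> bc ad _ _; exists a, b.
have cE : c = - b by rewrite -bc.
by move: D0; rewrite -ad cE mulrN opprK -!expr2.
Qed.

(** For [x != 1] in the torus, the determinant of [GLval x - 1] is a sum of two squares that are not
    both 0, so this matrix is invertible. *)
Lemma torus2_cyclic : cyclic T.
Proof.
apply: (@div_ring_mul_group_cyclic {'GL_2[F]} T 'M[F]_2 (fun g => GLval g)) => //.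
  move=> x /setD1P[x1 /torus2P[a [b [ab0 xE]]]].
  have D0 : a * a - b * - b != 0 by rewrite mulrN opprK -!expr2.
  have -> : GLval x - 1 = mx2 (a - 1) b (- b) (a - 1).
    rewrite xE gl2E // -[1]/(1%:M) -mx2_scalar; apply/matrixP=> i j; rewrite !mxE.
    by case: i => [[|[|//]] ?]; case: j => [[|[|//]] ?] /=; rewrite ?subr0.
  rewrite -[_ \is a _]/(_ \in unitmx) mx2_unit mulrN opprK -!expr2.
  rewrite (sum_sqr_eq0 F3); apply: contra x1 => /andP[/eqP a1 /eqP b0].
  move: a1 => /eqP; rewrite subr_eq0 => /eqP a1.
  by rewrite xE a1 b0 oppr0 -/(scal2 1) scal2_1.
apply/centsP=> _ /torus2P[a [b [ab0 ->]]] _ /torus2P[c [d [cd0 ->]]].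
have D0 (u v : F) : u ^+ 2 + v ^+ 2 != 0 -> u * u - v * - v != 0.
  by rewrite mulrN opprK -!expr2.
by rewrite /commute !gl2M ?D0 //; congr gl2; ring.
Qed.

Lemma card_torus2 : #|T| = (q.-1 * q.+1)%N.
Proof.
have -> : (q.-1 * q.+1)%N = #|[set~ ((0, 0) : F * F)]|.
  by rewrite cardsC1 card_prod; case: #|F| (odd_gt0 (odd_card3 F3)) => // n _; nia.
have -> : (T : {set _}) = [set gl2 x.1 x.2 (- x.2) x.1 | x in [set~ ((0, 0) : F * F)]].
  apply/setP=> g; apply/torus2P/imsetP => [[a [b [ab0 ->]]] | [[a b] + ->]].
    exists (a, b) => //; rewrite !inE; apply: contra ab0 => /eqP[-> ->].
    by rewrite !expr0n addr0.
  rewrite !inE xpair_eqE => ab; exists a, b; split=> //.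
  by rewrite (sum_sqr_eq0 F3).
rewrite card_in_imset // => [[a b] [c d]]; rewrite !inE !xpair_eqE -!(sum_sqr_eq0 F3) /=.
move=> ab cd /(congr1 (@GLval _ _)); rewrite !gl2E; last 2 first.
- by rewrite mulrN opprK -!expr2.
- by rewrite mulrN opprK -!expr2.
by case/mx2_inj=> -> ->.
Qed.

Lemma scalars2_sub_torus2 : C \subset T.
Proof.
apply/subsetP=> _ /scalars2P[c c0 ->]; apply/torus2P; exists c, 0.
by rewrite expr0n addr0 expf_neq0 // oppr0.
Qed.

Definition refl2 : GL2 := gl2 1 0 0 (-1).

Let refl2_det : 1 * -1 - 0 * 0 != 0 :> F.
Proof. by rewrite mul0r subr0 mul1r. Qed.

Lemma refl2_sqr : (refl2 ^+ 2 = 1)%g.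
Proof. by rewrite expg2 gl2M // -scal2_1; congr gl2; ring. Qed.

Lemma refl2_notin_torus2 : refl2 \notin T.
Proof.
apply/negP=> /torus2P[a [b [ab0 /(congr1 (@GLval _ _))]]].
have D0 : a * a - b * - b != 0 by rewrite mulrN opprK -!expr2.
rewrite (gl2E refl2_det) (gl2E D0) => /mx2_inj[a1 _ _ a2].
by have := neq_opp1 F3; rewrite {1}a1 a2 eqxx.
Qed.

(** [refl2] induces the conjugation of F(sqrt(-1)), so this square is the norm of [t]. *)
Lemma refl2_torus2 t : t \in T -> ((refl2 * t) ^+ 2)%g \in C.
Proof.
case/torus2P=> a [b [ab0 ->]]; apply/scalars2P; exists (a ^+ 2 + b ^+ 2) => //.
have D0 : a * a - b * - b != 0 by rewrite mulrN opprK -!expr2.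
rewrite gl2M // expg2 gl2M; first by congr gl2; ring.
all: by rewrite [X in X != 0](_ : _ = - (a ^+ 2 + b ^+ 2)) ?oppr_eq0 //; ring.
Qed.

Lemma refl2_norm_torus2 : refl2 \in 'N(T)%g.
Proof.
rewrite inE; apply/subsetP=> _ /imsetP[t Tt ->].
have reflV : (refl2^-1 = refl2)%g by apply: (mulgI refl2); rewrite mulgV -refl2_sqr.
rewrite conjgE reflV -(mulgK t (refl2 * (t * refl2))%g) groupM ?groupV //.
rewrite mulgA -!mulgA (mulgA refl2 t) -expg2.
exact: (subsetP scalars2_sub_torus2 _ (refl2_torus2 Tt)).
Qed.

End GL2.

Local Close Scope ring_scope.
Local Open Scope group_scope.

Lemma GL2_index_identity p x y w :
  (p * (x * (w * 2)) * y = x * y * 2 * (p * w))%N.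
Proof. by lia. Qed.

Section GL2.

Variable F : finFieldType.
Hypothesis F3 : #|F| = 3 %[mod 4].
Local Notation q := #|F|.
Local Notation G := 'GL_2[F]%G.
Local Notation C := (scalars2_group F).
Local Notation T := (torus2 F).
Local Notation sc := (@scal2 F).
Let o := (q.-1)./2.

Let opp1_neq0 : (-1 != 0 :> F)%R.
Proof. by rewrite oppr_eq0 oner_eq0. Qed.

Lemma H1_scalars2 : H1_detected C.
Proof.
have [qE odd_o] := card_pred3 F3.
by apply: (proj1 (@sq_order2odd _ _ o _ odd_o)); rewrite card_scalars2 qE mulnC.
Qed.

Let q_even : (q.+1 = (q.+1)./2 * 2)%N.
Proof. by rewrite muln2 even_halfK //= odd_card3. Qed.

(** All lifts of scalars are central in [E], since H^1 is detected for the scalars and for GL_2. A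
    lift [M] of the scalars is built first; over it, lifts of a generator of the torus and of the
    reflection satisfy dihedral relations, so [ext_dihedral] splits [E] over a subgroup of odd
    index. *)
Lemma H2_GL2 : H2_detected G.
Proof.
move=> rT E f z extE; have [qE odd_o] := card_pred3 F3.
have Ez := ext_zE extE.
have sCG : C \subset G := subsetT _.
have cC x y : x \in E -> f x \in C -> y \in E -> commute x y.
  move=> Ex Cx Ey; apply: (ext_cents extE sCG (subxx G) H1_scalars2 (H1_GL2 F3)) => //.
    exact: scalars2_cent.
  by rewrite inE.
have [j Ej fj] := ext_lift extE (in_setT (J2 F)).
pose m := j ^+ 2; have Em : m \in E by rewrite groupX.
have fm : f m = sc (-1)%R by rewrite (ext_fX extE) // fj J2_sqr.
have sc_sqr : sc (-1)%R ^+ 2 = 1 by rewrite -scal2X // sqrrN expr1n scal2_1.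
have Cfm : f m \in C by apply/scalars2P; exists (-1)%R.
have m2 : m ^+ 2 = 1 by apply: (ext_inv extE); rewrite // fm.
have neq_fm : f m != 1.
  rewrite fm -scal2_1; apply/eqP => /scal2_inj e; have := neq_opp1 F3.
  by rewrite e ?oner_eq0 ?eqxx.
(* The conjugation of [sqr_opp1_conj] lifts to [E], where [m] is central, and multiplying a lift by
   [z] does not change its square. *)
have sqr_opp1 y : y \in E -> f y ^+ 2 = sc (-1)%R -> y ^+ 2 = m.
  move=> Ey /sqr_opp1_conj[//|g fy].
  have [u Eu fu] := ext_lift extE (in_setT g).
  have fju : f (j ^ u) = f y by rewrite (ext_fJ extE) // fj fu fy.
  have ju2 : (j ^ u) ^+ 2 = m.
    by rewrite -conjXg; apply/conjg_fixP/commgP/cC.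
  have Eju : j ^ u \in E by rewrite groupJ.
  case: (ext_eq extE Eju Ey fju) => -> //.
  rewrite expgMn; last by apply/esym/(ext_zC extE).
  by rewrite ju2 expg2 (ext_zz extE) mulg1.
(* Every scalar is up to sign a square, so [M] contains the square of every   *)
(* [y] such that [f y ^+ 2] is scalar; modulo [M], the normalizer of the torus*)
(* can be treated like a dihedral group.                                      *)
pose M := [set x in ext_preim E f C | x ^+ o \in <[m]>].
have MP x : (x \in M) = [&& x \in E, f x \in C & x ^+ o \in <[m]>].
  by rewrite !inE andbA.
have gM : group_set M.
  apply/group_setP; split; first by rewrite MP group1 (ext_f1 extE) group1 expg1n group1.
  move=> x y; rewrite !MP => /and3P[Ex Cx mx] /and3P[Ey Cy my].
  rewrite groupM // (extM extE) // groupM //= expgMn; first exact: groupM.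
  exact: cC.
pose Mg := Group gM.
have sME : M \subset E by apply/subsetP=> x; rewrite MP => /and3P[].
have nME : E \subset 'N(Mg).
  apply: cents_norm; apply/centsP=> x Ex y; rewrite /= MP => /and3P[Ey Cy _].
  exact/commute_sym/cC.
have m_cycle : <[m]> = [set 1; m].
  apply: cycle2g; apply: nt_prime_order => //.
  by apply: contra neq_fm => /eqP->; rewrite (ext_f1 extE).
have zo : z ^+ o = z.
  rewrite -[o]odd_double_half odd_o -mul2n expgS expgM expg2 (ext_zz extE).
  by rewrite expg1n mulg1.
have zM : z \notin M.
  rewrite MP zo m_cycle !inE (negPf (ext_z1 extE)) /= !negb_and !orbA; apply/orP; right.
  by apply: contra neq_fm => /eqP <-; rewrite (ext_fz extE).
have Mm : m \in M by rewrite MP Em Cfm groupX ?cycle_id.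
(* The power [x ^+ o] lies over 1 or -1, and [(x * z) ^+ o = x ^+ o * z] as [o] is odd; so one of
   the two lifts has this power in [<[m]>]. *)
have lift_M c : (c != 0)%R -> exists2 x, x \in M & f x = sc c.
  move=> c0; have [x Ex fx] := ext_lift extE (in_setT (sc c)).
  have Cx : f x \in C by rewrite fx; apply/scalars2P; exists c.
  have [Mx | nMx] := boolP (x \in M); first by exists x.
  exists (x * z); last by rewrite (extM extE) // (ext_fz extE) mulg1.
  rewrite MP groupM // (extM extE) // (ext_fz extE) mulg1 Cx /=.
  rewrite expgMn; last by apply/esym/(ext_zC extE).
  rewrite zo; move: nMx; rewrite MP Ex Cx /= => nmx.
  have Exo : x ^+ o \in E by rewrite groupX.
  have fxo : f (x ^+ o) = sc (c ^+ o)%R by rewrite (ext_fX extE) // fx scal2X.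
  have [co | co] := half_pow_sign F3 c0.
    rewrite co scal2_1 in fxo; case: (ext_ker extE Exo fxo) => xo.
      by rewrite xo group1 in nmx.
    by rewrite xo (ext_zz extE) group1.
  rewrite co -fm in fxo; case: (ext_eq extE Em Exo (esym fxo)) => xo.
    by rewrite xo cycle_id in nmx.
  by rewrite xo -mulgA (ext_zz extE) mulg1 cycle_id.
have fM : f @: Mg = C.
  apply/setP=> g; apply/imsetP/scalars2P => [[x Mx ->] | [c c0 ->]].
    by apply/scalars2P; move: Mx; rewrite /= MP => /and3P[].
  by have [x Mx fx] := lift_M c c0; exists x.
have oM : #|Mg| = q.-1.
  by rewrite -card_scalars2 -fM (card_in_imset (ext_inj (K := Mg) extE sME zM)).
(* Dividing [y] by a lift of the scalar [d] reduces to the case where the image has square 1 or -1;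
   then the square of the lift is 1 or [m]. *)
have sqM y : y \in E -> f y ^+ 2 \in C -> y ^+ 2 \in M.
  move=> Ey /scalars2P[c c0 fy2].
  have [d [d0 cE]] := sign_sqr F3 c0.
  have [x Mx fx] := lift_M d d0.
  have [Ex Cx] : x \in E /\ f x \in C by move: Mx; rewrite MP => /and3P[].
  pose y' := y * x^-1; have Ey' : y' \in E by rewrite groupM ?groupV.
  have cyx : commute y' x by apply/commute_sym/cC.
  have yE : y ^+ 2 = y' ^+ 2 * x ^+ 2 by rewrite -expgMn // mulgKV.
  have fy'2 : f y' ^+ 2 * sc (d ^+ 2)%R = sc c.
    by rewrite scal2X // -fx -fy2 -!(ext_fX extE) // -(extM extE) ?groupX // -yE.
  have Mx2 : x ^+ 2 \in Mg by apply: groupX.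
  rewrite yE (@groupMr _ Mg _ _ Mx2).
  case: cE => cE.
    rewrite (ext_inv extE Ey') ?(group1 Mg) //.
    by apply: (mulIg (sc (d ^+ 2)%R)); rewrite mul1g fy'2 cE.
  rewrite (sqr_opp1 y' Ey') //.
  apply: (mulIg (sc (d ^+ 2)%R)).
  by rewrite fy'2 cE -scal2M ?expf_neq0 // mulN1r.
have /cyclicP[t defT] := torus2_cyclic F3.
have oT : #[t] = (q.-1 * q.+1)%N by rewrite orderE -defT card_torus2.
have Tt : t \in T by rewrite defT cycle_id.
have tC : t ^+ q.+1 \in C.
  have sCt : <[t ^+ q.+1]> \subset T by rewrite defT cycleX.
  have : (<[t ^+ q.+1]>%G == C :> {set _}).
    rewrite (eq_subG_cyclic (torus2_cyclic F3) sCt (scalars2_sub_torus2 F)).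
    by rewrite card_scalars2 -orderE orderXdiv oT ?dvdn_mull // mulnK.
  by move/eqP <-; rewrite cycle_id.
have [u Eu fu] := ext_lift extE (in_setT t).
have [s Es fs] := ext_lift extE (in_setT (refl2 F)).
pose K := (Mg <*> <[u]> <*> <[s]>)%G.
have sKE : K \subset E by rewrite !join_subG sME !cycle_subG Eu.
have fK : f @: K = T <*> <[refl2 F]>.
  rewrite !(ext_imY extE) ?join_subG ?sME ?cycle_subG ?Eu // fM.
  rewrite !(ext_im_cycle extE) // fu fs -defT.
  by congr (_ <*> _); apply/joing_idPr; exact: scalars2_sub_torus2.
have [N defN] := ext_im_group extE sKE.
have oN : #|N| = (#|T| * 2)%N.
  rewrite -defN fK; apply/eqP; rewrite eqn_leq card_joing_cycle_leq ?refl2_sqr //=; last first.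
    exact: refl2_norm_torus2.
  rewrite -(Lagrange (joing_subl T <[refl2 F]>)) leq_pmul2l ?cardG_gt0 //.
  rewrite indexg_gt1; apply: contra (refl2_notin_torus2 F3) => sTs.
  by apply: (subsetP sTs); rewrite mem_gen // inE cycle_id orbT.
have zK : z \notin K.
  apply: (ext_dihedral extE (n := q.+1)) => //.
  - rewrite (ext_inv extE) ?(group1 Mg) // fs; exact: refl2_sqr.
  - apply: sqM; first by rewrite groupM.
    by rewrite (extM extE) // fs fu; exact: (refl2_torus2 Tt).
  - rewrite q_even expgM; apply: sqM; first by rewrite groupX.
    by rewrite (ext_fX extE) // fu -expgM -q_even.
  by rewrite -/K defN oN card_torus2 // -oM.
apply: (ext_odd_index extE (subsetT N) _ sKE defN zK).
(* The order of GL_2 is q (q-1)^2 (q+1) and that of [N] is 2 (q-1)(q+1); the index q (q-1)/2 is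
   odd. *)
have oG : (#|N| * #|G : N| = #|N| * (q * o))%N.
  rewrite Lagrange ?subsetT // oN card_torus2 // card_GL_2 expnS expn1.
  by rewrite -GL2_index_identity /o -qE.
move/eqP: oG; rewrite eqn_pmul2l ?cardG_gt0 // => /eqP->.
by rewrite oddM odd_card3 // odd_o.
Qed.

End GL2.

Lemma logn_prod (p : nat) (f : nat -> nat) n : (forall i, 0 < f i)%N ->
  logn p (\prod_(0 <= i < n) f i) = (\sum_(0 <= i < n) logn p (f i))%N.
Proof.
move=> f_gt0; elim: n => [|n IHn]; first by rewrite !big_geq // logn1.
by rewrite !big_nat_recr //= lognM ?prodn_gt0 // IHn.
Qed.

(** The increments of [tower_induction] are the valuations of q^i - 1. For k > 0, q^(2^k) is 1 mod
    4, so doubling 2^k adds exactly 1. From rank 1 to rank 2 it adds more, since 4 divides q + 1. *)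
Lemma sq_GL (F : finFieldType) n : #|F| = 3 %[mod 4] -> (0 < n)%N ->
  sq_detected 'GL_n[F]%G.
Proof.
move=> F3; set q := #|F|; have oddq : odd q := odd_card3 F3.
have [qE odd_o] := card_pred3 F3; rewrite -/q in qE odd_o.
have q_gt1 : (1 < q)%N by rewrite /q; move: F3; case: #|F| => [|[]].
pose c i := logn 2 (q ^ i - 1); pose v n := (\sum_(0 <= i < n) c i.+1)%N.
have qX_gt0 i : (0 < q ^ i.+1 - 1)%N by rewrite subn_gt0 -{1}(exp1n i.+1) ltn_exp2r.
have vE m : (0 < m)%N -> logn 2 #|'GL_m[F]| = v m.
  move=> m_gt0; have prod_gt0 : (0 < \prod_(1 <= i < m.+1) (q ^ i - 1))%N.
    by rewrite big_add1; apply: prodn_gt0 => i.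
  rewrite card_GL // -/q.
  have co2q : coprime 2 q by rewrite coprime2n.
  by rewrite logn_Gauss ?coprimeXr // big_add1 /= logn_prod.
move: n; apply: (@tower_induction (fun n => sq_detected 'GL_n[F]%G) v c).
- by move=> m; rewrite /v big_nat_recr.
- by rewrite /v big_geq.
- by move=> k j; apply: logn_pow_sub1_add.
- move=> k k_gt0; rewrite /c expnSr logn_pow_sub1_double ?expn_gt0 //.
  rewrite logn_add1_mod4 ?addn1 //.
  rewrite -(prednK k_gt0) expnS expnM -modnXm.
  have -> : (q ^ 2 = 1 %[mod 4])%N by rewrite -modnXm F3.
  by rewrite modnXm exp1n.
- by apply: (sq_order2odd _ odd_o); rewrite card_GL_1 -/q [LHS]qE mulnC.
- by split; [apply: H1_GL2 | apply: H2_GL2].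
- case=> [|a] [|b] // _ _; rewrite -!vE // => lG; apply: sq_dsum lG => g h _ _.
  by rewrite inE.
case=> [|a] // _; rewrite -!vE // => lG; apply: sq_dsum_swap lG => [g h _ _|].
  by rewrite inE.
by rewrite inE.
Qed.

Local Close Scope group_scope.
Local Open Scope ring_scope.

(** * Orthogonal groups *)

Section UnitForm.

Variable F : finFieldType.
Local Notation q := #|F|.

Definition ufcount n (c : F) := #|[set x : 'rV[F]_n | unit_form x == c]|.

Arguments ufcount n%_N c%_R.

Lemma unit_form_row_mx m n (x : 'rV[F]_m) (y : 'rV[F]_n) :
  unit_form (row_mx x y) = unit_form x + unit_form y.
Proof.
rewrite /unit_form big_split_ord /=.
by congr (_ + _); apply: eq_bigr => i _; rewrite ?row_mxEl ?row_mxEr.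
Qed.

Lemma unit_form_mul n (x : 'rV[F]_n) : unit_form x = (x *m x^T) 0 0.
Proof. by rewrite mxE; apply: eq_bigr => i _; rewrite mxE expr2. Qed.

Lemma ufcountE n c : ufcount n c = (\sum_(x : 'rV[F]_n | unit_form x == c) 1)%N.
Proof. by rewrite sum1dep_card. Qed.

Lemma ufcount0 : ufcount 0 1 = 0%N.
Proof.
apply/eqP; rewrite cards_eq0; apply/eqP/setP=> x; rewrite !inE.
by rewrite /unit_form big_ord0 eq_sym oner_eq0.
Qed.

Lemma ufcount_sum n : (\sum_c ufcount n c = q ^ n)%N.
Proof.
have <- : #|{: 'rV[F]_n}| = (q ^ n)%N by rewrite card_mx mul1n.
rewrite -sum1_card (partition_big (@unit_form n F) xpredT) //=.
by apply: eq_bigr => c _; rewrite ufcountE.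
Qed.

Lemma ufcount_add m n c :
  ufcount (m + n) c = (\sum_(y : 'rV[F]_m) ufcount n (c - unit_form y))%N.
Proof.
rewrite ufcountE.
pose h (p : 'rV[F]_m * 'rV[F]_n) : 'rV[F]_(m + n) := row_mx p.1 p.2.
have bij_h : bijective h.
  exists (fun z => (lsubmx z, rsubmx z)) => [[x y] | z]; rewrite /h /=.
    by rewrite row_mxKl row_mxKr.
  exact: hsubmxK.
rewrite (reindex h) /=; last exact: onW_bij.
rewrite -(pair_big_dep xpredT (fun x y => unit_form (row_mx x y) == c) (fun _ _ => 1%N)) /=.
apply: eq_bigr => x _; rewrite ufcountE; apply: eq_bigl => y.
by rewrite unit_form_row_mx [RHS]eq_sym subr_eq addrC eq_sym.
Qed.

Hypothesis F1 : q = 1 %[mod 4].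

Lemma odd_card1 : odd q.
Proof. by move: F1; move: q => n; lia. Qed.

Lemma exists_sqrt_opp1 : exists i : F, i ^+ 2 = -1.
Proof.
have q_gt1 : (1 < q)%N := finNzRing_gt1 F.
have [k qE] : exists k, q.-1 = (4 * k)%N.
  exists (q.-1 %/ 4)%N; move: F1 q_gt1; move: q => n; lia.
have /cyclicP[u defU] := field_unit_group_cyclic [set: {unit F}]%G.
have ou : #[u]%g = (4 * k)%N by rewrite orderE -defU card_finField_unit.
have k_gt0 : (0 < k)%N by move: qE q_gt1; move: q => n; lia.
(* The unit group is cyclic of order 4k, so u^k has order 4. *)
exists (val u ^+ k); apply/eqP.
have uX n : val u ^+ n = val (u ^+ n)%g by rewrite FinRing.val_unitX.
have : (val u ^+ k) ^+ 2 == 1 \/ (val u ^+ k) ^+ 2 == -1.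
  apply/orP; rewrite -sqrf_eq1 -!exprM uX; apply/eqP.
  have -> : (k * 2 * 2)%N = #[u]%g by rewrite ou; lia.
  by rewrite expg_order.
case=> //; rewrite -exprM uX => /eqP u1.
have /eqP : (u ^+ (k * 2) = 1)%g by apply: val_inj.
rewrite -order_dvdn ou => /dvdn_leq; lia.
Qed.

(* With i^2 = -1, the plane x^2 + y^2 = (x + i y) (x - i y) is hyperbolic.    *)
Lemma sum_uf2 (g : F -> nat) :
  (\sum_(y : 'rV[F]_2) g (unit_form y) = q * g 0%R + q.-1 * \sum_w g w)%N.
Proof.
have [i i2] := exists_sqrt_opp1.
have two0 := two_neq0 odd_card1.
have i0 : i != 0 by apply: contra_eq_neq i2 => ->; rewrite expr0n eq_sym oppr_eq0 oner_eq0.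
pose h (p : F * F) : 'rV[F]_2 :=
  \row_j nth 0 [:: (p.1 + p.2) / 2%:R; (p.1 - p.2) / (2%:R * i)] j.
have bij_h : bijective h.
  exists (fun y : 'rV[F]_2 => (y 0 ord0 + i * y 0 ord_max, y 0 ord0 - i * y 0 ord_max)).
    case=> u v; rewrite /h !mxE /=; congr (_, _); field; exact/andP.
  move=> y; apply/rowP=> j; rewrite /h !mxE /=.
  case: j => [[|[|//]] ltj] /=.
    by rewrite [RHS](_ : _ = y 0 ord0); [field | congr (y _ _); apply/val_inj].
  rewrite [RHS](_ : _ = y 0 ord_max); last by congr (y _ _); apply/val_inj.
  by field; exact/andP.
have uf_h u v : unit_form (h (u, v)) = u * v.
  rewrite /unit_form !big_ord_recl big_ord0 !mxE /= addr0.
  have -> : ((u - v) / (2%:R * i)) ^+ 2 = - ((u - v) / 2%:R) ^+ 2.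
    by rewrite invfM mulrA exprMn exprVn i2 invrN invr1 mulrN1.
  by field.
rewrite (reindex h) /=; last exact: onW_bij.
rewrite (eq_bigr (fun p => g (p.1 * p.2))) => [|[u v] _]; last by rewrite uf_h.
rewrite -(pair_bigA _ (fun u v => g (u * v))) /= (bigD1 0) //=; congr (_ + _)%N.
  under eq_bigr do rewrite mul0r.
  by rewrite sum_nat_const mulnC.
rewrite (eq_bigr (fun=> \sum_w g w))%N => [|u u0]; last first.
  rewrite [RHS](reindex (fun w => u * w)) //=.
  by exists (fun w => u^-1 * w) => w _; rewrite ?mulKf ?mulVKf.
rewrite sum_nat_const; congr (_ * _)%N.
by rewrite -(cardC1 (0 : F)).
Qed.

(** Splitting off a hyperbolic plane: in [sum_uf2] the sum over all values of the remaining form is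
    q^n. *)
Lemma ufcountSS n c : ufcount n.+2 c = (q.-1 * q ^ n + q * ufcount n c)%N.
Proof.
rewrite -[n.+2]/(2 + n)%N ufcount_add (sum_uf2 (fun e => ufcount n (c - e))).
rewrite subr0 addnC; congr (_ * _ + _)%N.
rewrite -ufcount_sum [RHS](reindex (fun e => c - e)) //=.
by exists (fun e => c - e) => e _; rewrite opprB addrC subrK.
Qed.

Lemma ufcount1 : ufcount 1 1 = 2.
Proof.
rewrite /ufcount (_ : [set x | _] = [set 1%:M; (-1)%:M]).
  rewrite cards2; case: eqP => // /matrixP/(_ 0 0); rewrite !mxE /= => /eqP.
  by rewrite -subr_eq0 opprK (negPf (two_neq0 odd_card1)).
apply/setP=> x; rewrite !inE /unit_form big_ord1 sqrf_eq1.
have xE := mx11_scalar x; have eqs c : (x == c%:M) = (x 0 0 == c).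
  by apply/eqP/eqP=> [->|xc]; [rewrite mxE | rewrite xE xc].
by rewrite !eqs.
Qed.

Let q_gt0 : (0 < q)%N := odd_gt0 odd_card1.

(** The count is q^(m-1) (q^m - 1); the factor [q] avoids a truncated exponent. *)
Lemma ufcount_even m : (ufcount m.*2 1 * q = q ^ m * (q ^ m - 1))%N.
Proof.
elim: m => [|m IHm]; first by rewrite ufcount0.
rewrite doubleS ufcountSS mulnDl -(mulnA q) IHm -addnn expnD expnS.
have : (0 < q ^ m)%N by rewrite expn_gt0 q_gt0.
move: (q ^ m)%N => r r_gt0; rewrite -(prednK r_gt0) -(prednK q_gt0) subn1 /=.
move: r.-1 (#|F|.-1) => k p.
have -> : (p.+1 * k.+1 - 1 = p * k.+1 + k)%N by rewrite mulSn addnC subn1 addnS.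
clear; lia.
Qed.

Lemma ufcount_odd m : ufcount m.*2.+1 1 = (q ^ m * (q ^ m + 1))%N.
Proof.
elim: m => [|m IHm]; first by rewrite ufcount1.
rewrite doubleS ufcountSS IHm -addnn -addnS expnD !expnS.
by move: (q ^ m)%N => r; rewrite -(prednK q_gt0) /=; move: (#|F|.-1) => p; lia.
Qed.

Lemma logn_ufcount_even m : (0 < m)%N -> logn 2 (ufcount m.*2 1) = logn 2 (q ^ m - 1).
Proof.
move=> m_gt0; have co2 k : coprime 2 (q ^ k) by rewrite coprimeXr // coprime2n odd_card1.
rewrite -[RHS](logn_Gauss _ (co2 m)) -ufcount_even mulnC.
by rewrite logn_Gauss // coprime2n odd_card1.
Qed.

Lemma logn_ufcount_odd m : logn 2 (ufcount m.*2.+1 1) = 1%N.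
Proof.
have co2 k : coprime 2 (q ^ k) by rewrite coprimeXr // coprime2n odd_card1.
rewrite ufcount_odd (logn_Gauss _ (co2 m)) logn_add1_mod4 //.
by rewrite -modnXm F1 modnXm exp1n.
Qed.

End UnitForm.

(** * Orthogonal matrices and their number *)

Section OrthogonalMatrices.

Variable F : finFieldType.
Hypothesis two0 : 2%:R != 0 :> F.

Definition orthomx n : {set 'M[F]_n} := [set A | A *m A^T == 1%:M].

Lemma orthomxP n (A : 'M[F]_n) : reflect (A *m A^T = 1%:M) (A \in orthomx n).
Proof. by rewrite inE; apply: eqP. Qed.

Lemma orthomx_tr n (A : 'M[F]_n) : A \in orthomx n -> A^T *m A = 1%:M.
Proof. by move/orthomxP/mulmx1C. Qed.

Lemma orthomxM n (A B : 'M[F]_n) :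
  A \in orthomx n -> B \in orthomx n -> A *m B \in orthomx n.
Proof.
move=> /orthomxP AA /orthomxP BB; apply/orthomxP.
by rewrite trmx_mul mulmxA -(mulmxA A) BB mulmx1.
Qed.

Lemma orthomx_trmx n (A : 'M[F]_n) : A \in orthomx n -> A^T \in orthomx n.
Proof. by move=> /orthomx_tr AA; apply/orthomxP; rewrite trmxK. Qed.

(** The reflection in the hyperplane orthogonal to [w], meaningful if [w] is not isotropic. *)
Definition reflmx n (w : 'rV[F]_n) : 'M[F]_n :=
  1%:M - (2%:R / unit_form w) *: (w^T *m w).

Lemma row_mul_tr n (w x : 'rV[F]_n) : x *m w^T = ((x *m w^T) 0 0)%:M.
Proof. exact: mx11_scalar. Qed.

Lemma reflmx_ortho n (w : 'rV[F]_n) : unit_form w != 0 -> reflmx w \in orthomx n.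
Proof.
move=> w0; apply/orthomxP; rewrite /reflmx.
have -> : (1%:M - (2%:R / unit_form w) *: (w^T *m w))^T
    = 1%:M - (2%:R / unit_form w) *: (w^T *m w).
  by rewrite linearB linearZ /= trmx1 trmx_mul trmxK.
set a := 2%:R / unit_form w; set S := w^T *m w.
have SS : S *m S = unit_form w *: S.
  rewrite /S mulmxA -(mulmxA w^T) (row_mul_tr w w) -unit_form_mul.
  by rewrite mul_mx_scalar -scalemxAl.
rewrite mulmxBl mul1mx mulmxBr mulmx1 -scalemxAl -scalemxAr SS !scalerA.
have -> : a * a * unit_form w = a + a.
  by rewrite -mulrA {2}/a divfK // mulr_natr mulr2n.
have aS : a *: S - (a + a) *: S = - (a *: S).
  by rewrite scalerDl opprD addrA subrr sub0r.
by rewrite aS opprK subrK.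
Qed.

Lemma unit_formD n (u v : 'rV[F]_n) :
  unit_form (u + v) = unit_form u + unit_form v + 2%:R * (u *m v^T) 0 0.
Proof.
rewrite !mxE /unit_form mulr_sumr -!big_split; apply: eq_bigr => i _ /=.
by rewrite !mxE; ring.
Qed.

Lemma unit_formN n (u : 'rV[F]_n) : unit_form (- u) = unit_form u.
Proof. by apply: eq_bigr => i _; rewrite mxE sqrrN. Qed.

Lemma mul_reflmx n (u v : 'rV[F]_n) : unit_form u = 1 -> unit_form v = 1 ->
  unit_form (u + v) != 0 -> u *m reflmx (u + v) = - v.
Proof.
move=> u1 v1 w0; rewrite /reflmx mulmxBr mulmx1 -scalemxAr mulmxA row_mul_tr.
rewrite mul_scalar_mx scalerA.
have -> : 2%:R / unit_form (u + v) * (u *m (u + v)^T) 0 0 = 1.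
  have : unit_form (u + v) = 2%:R * (u *m (u + v)^T) 0 0.
    rewrite unit_formD u1 v1 linearD mulmxDr [in RHS]mxE -unit_form_mul u1; ring.
  by move=> e; rewrite mulrAC -e divff.
by rewrite scale1r opprD addrA subrr add0r.
Qed.

(** The reflection in u + v sends u to -v, and the one in u - v sends u to v. One of the two vectors
    is not isotropic, because the values of the form at them add up to 4. *)
Lemma orthomx_transitive n (u v : 'rV[F]_n) : unit_form u = 1 -> unit_form v = 1 ->
  exists2 B, B \in orthomx n & u *m B = v.
Proof.
move=> u1 v1; have [w0 | w0] := eqVneq (unit_form (u + v)) 0; last first.
  exists (- reflmx (u + v)); last by rewrite mulmxN mul_reflmx ?opprK.
  have /orthomxP r := reflmx_ortho w0.
  by apply/orthomxP; rewrite linearN mulmxN mulNmx opprK.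
have w1 : unit_form (u - v) != 0.
  apply/eqP=> w1; have /eqP : (2%:R * 2%:R : F) = 0.
    pose b := (u *m v^T) 0 0.
    have w0E : 1 + 1 + 2%:R * b = 0 by rewrite -w0 unit_formD u1 v1.
    have w1E : 1 + 1 + 2%:R * - b = 0.
      rewrite -w1 unit_formD unit_formN u1 v1 linearN mulmxN.
      by congr (_ + _ * _); rewrite mxE.
    by rewrite -[RHS](addr0 0) -{1}w0E -w1E; ring.
  by rewrite mulf_eq0 (negPf two0).
exists (reflmx (u - v)); first exact: reflmx_ortho.
by rewrite mul_reflmx ?unit_formN ?opprK.
Qed.

Lemma block1_ortho n (A : 'M[F]_n) :
  (block_mx 1%:M 0 0 A \in orthomx (1 + n)) = (A \in orthomx n).
Proof.
rewrite !inE tr_block_mx !trmx0 trmx1 mulmx_block !mulmx0 !mul0mx mul1mx !addr0 add0r.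
rewrite -[1%:M in RHS]/(1%:M) (@scalar_mx_block _ 1 n 1).
by apply/eqP/eqP => [/eq_block_mx[] | ->].
Qed.

(** The first row of an orthogonal matrix is a unit vector. By transitivity the matrices with given
    first row are a translate of those with first row [e0], which are block matrices. *)
Lemma card_orthomxS n : #|orthomx n.+1| = (ufcount n.+1 (1%R : F) * #|orthomx n|)%N.
Proof.
rewrite -[n.+1]/(1 + n)%N -sum1_card.
rewrite (partition_big (fun A : 'M[F]_(1 + n) => usubmx A)
  (fun v : 'rV[F]_(1 + n) => unit_form v == 1)) /=; last first.
  move=> A /orthomxP AA.
  rewrite -[A in A *m _]vsubmxK -[A in A^T]vsubmxK tr_col_mx mul_col_row in AA.
  move: AA; rewrite (@scalar_mx_block _ 1 n 1) => /eq_block_mx[AA _ _ _].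
  by rewrite unit_form_mul AA mxE.
rewrite /ufcount -sum1_card big_distrl /=; apply: eq_big => [v | v]; first by rewrite inE.
move/eqP=> v1; rewrite mul1n sum1_card.
pose e0 : 'rV[F]_(1 + n) := row_mx 1%:M 0.
have e01 : unit_form e0 = 1.
  rewrite unit_form_row_mx /unit_form big_ord1 mxE expr1n big1 ?addr0 // => i _.
  by rewrite mxE expr0n.
have [B oB e0B] := orthomx_transitive e01 v1.
have inj_blk : injective (fun A : 'M[F]_n => block_mx 1%:M 0 0 A *m B).
  move=> A A' /(congr1 (fun X => X *m B^T)); rewrite -!mulmxA (orthomxP _ oB) !mulmx1.
  by case/eq_block_mx.
rewrite -(card_imset _ inj_blk); apply: eq_card => X.
rewrite [LHS]inE; apply/andP/imsetP => [[oX /eqP uX] | [A oA ->]].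
  pose C := X *m B^T; have oC : C \in orthomx (1 + n) by rewrite orthomxM ?orthomx_trmx.
  have uC : usubmx C = e0.
    rewrite -mul_usub_mx uX -e0B -mulmxA (orthomxP _ oB) mulmx1 //.
  have CE : C = block_mx 1%:M 0 (dlsubmx C) (drsubmx C).
    by rewrite -[LHS]submxK /ulsubmx /ursubmx uC row_mxKl row_mxKr.
  have dl0 : dlsubmx C = 0.
    have CC := orthomxP _ oC.
    rewrite CE tr_block_mx mulmx_block (@scalar_mx_block _ 1 n 1) in CC.
    by case/eq_block_mx: CC => _ _ + _; rewrite trmx1 trmx0 mulmx1 mulmx0 addr0.
  exists (drsubmx C); first by rewrite -block1_ortho -{1}dl0 -CE.
  by rewrite -{1}dl0 -CE -mulmxA (orthomx_tr oB) mulmx1.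
split; first by rewrite orthomxM ?block1_ortho.
apply/eqP; rewrite -mul_usub_mx.
have -> : usubmx (block_mx 1%:M 0 0 A) = e0 by rewrite block_mxEv col_mxKu.
exact: e0B.
Qed.

Lemma card_orthomx0 : #|orthomx 0| = 1%N.
Proof.
have eq0 (A B : 'M[F]_0) : A = B by rewrite [A]flatmx0 [B]flatmx0.
apply/eqP/cards1P; exists 1%:M; apply/setP=> A; rewrite !inE.
by rewrite (eq0 A 1%:M) (eq0 (_ *m _) 1%:M) !eqxx.
Qed.

(** The symmetric matrix [S] defines the zero quadratic form; polarization gives 2 S i j = 0. *)
Lemma orthogonal_setP n (g : {'GL_n.+1[F]}) :
  reflect (GLval g *m (GLval g)^T = 1%:M) (g \in orthogonal_group n.+1 F).
Proof.
rewrite inE; apply: (iffP forallP) => [og | gg x]; last first.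
  by apply/eqP; rewrite !unit_form_mul trmx_mul mulmxA -(mulmxA x) gg mulmx1.
pose S := GLval g *m (GLval g)^T - 1%:M.
have S0 (x : 'rV[F]_n.+1) : (x *m S *m x^T) 0 0 = 0.
  rewrite /S mulmxBr mulmx1 mulmxBl mulmxA -(mulmxA (x *m _)) -trmx_mul.
  have := eqP (og x); rewrite !unit_form_mul => e.
  by rewrite [LHS]mxE [X in _ + X]mxE e subrr.
have symS i j : S i j = S j i.
  have ST : S^T = S by rewrite /S linearB /= trmx1 trmx_mul trmxK.
  by rewrite -[in LHS]ST mxE.
have Sij i j : (delta_mx 0 i *m S *m (delta_mx 0 j)^T) (0 : 'I_1) (0 : 'I_1) = S i j.
  by rewrite -rowE trmx_delta -colE !mxE.
have Sii i : S i i = 0 by rewrite -Sij S0.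
apply/eqP; rewrite -subr_eq0; apply/eqP/matrixP=> i j.
rewrite -/S [RHS]mxE; have := S0 (delta_mx 0 i + delta_mx 0 j).
have -> : (delta_mx 0 i + delta_mx 0 j) *m S *m (delta_mx 0 i + delta_mx 0 j)^T
    = delta_mx 0 i *m S *m (delta_mx 0 i)^T + delta_mx 0 j *m S *m (delta_mx 0 i)^T
      + (delta_mx 0 i *m S *m (delta_mx 0 j)^T + delta_mx 0 j *m S *m (delta_mx 0 j)^T)
    :> 'M_1.
  by rewrite [(_ + _)^T]linearD /= mulmxDr !mulmxDl.
rewrite [LHS]mxE [X in X + _]mxE [X in _ + X]mxE !Sij !Sii add0r addr0 (symS j i).
rewrite -mulr2n -mulr_natl => /eqP; rewrite mulf_eq0 (negPf two0) /= => /eqP.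
by [].
Qed.

Lemma card_orthogonal_group n : #|orthogonal_group n.+1 F| = #|orthomx n.+1|.
Proof.
rewrite -(card_imset _ (@GL_inj F n.+1)); apply: eq_card => A.
apply/imsetP/orthomxP => [[g /orthogonal_setP gg ->] // | AA].
have uA : A \in unitmx by have [] := mulmx1_unit AA.
by exists (@mkGL F n.+1 A); rewrite ?mkGLE //; apply/orthogonal_setP; rewrite mkGLE.
Qed.

Lemma dsum_orthogonal a b (g : {'GL_a.+1[F]}) (h : {'GL_b.+1[F]}) :
  g \in orthogonal_group a.+1 F -> h \in orthogonal_group b.+1 F ->
  dsum g h \in orthogonal_group (a.+1 + b.+1) F.
Proof.
move=> /orthogonal_setP gg /orthogonal_setP hh; apply/orthogonal_setP.
rewrite dsumE /dsum_mx.
have -> : (block_mx (GLval g) 0 0 (GLval h))^T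
    = block_mx (GLval g)^T 0 0 (GLval h)^T :> 'M_(a.+1 + b.+1).
  by rewrite tr_block_mx !trmx0.
rewrite [LHS](@mulmx_block F a.+1 b.+1 a.+1 b.+1 a.+1 b.+1).
rewrite !mulmx0 !mul0mx !addr0 !add0r gg hh.
exact/esym/(@scalar_mx_block F a.+1 b.+1 1).
Qed.

Lemma swap_orthogonal a : swapGL F a \in orthogonal_group (a.+1 + a.+1) F.
Proof.
apply/orthogonal_setP; rewrite swapGLE.
have -> : (swap_mx F a)^T = swap_mx F a.
  by rewrite /swap_mx [LHS](@tr_block_mx F a.+1 a.+1 a.+1 a.+1) !trmx0 !trmx1.
exact: swap_mx_sqr.
Qed.

End OrthogonalMatrices.

(** * Orthogonal groups over a field with 1 mod 4 elements *)

Section Orthogonal.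

Variable F : finFieldType.
Hypothesis F1 : #|F| = 1 %[mod 4].
Local Notation q := #|F|.
Let oddq : odd q := odd_card1 F1.
Let two0 : 2%:R != 0 :> F := two_neq0 oddq.
Local Notation O n := (orthogonal_group n F).

Let O2P a b c d : a * d - b * c != 0 ->
  reflect [/\ a ^+ 2 + b ^+ 2 = 1, c ^+ 2 + d ^+ 2 = 1 & a * c + b * d = 0]
          (gl2 a b c d \in O 2).
Proof.
move=> D0; apply: (iffP (orthogonal_setP two0 _)); rewrite gl2E //.
  have -> : (mx2 a b c d)^T = mx2 a c b d.
    by apply/matrixP=> i j; rewrite !mxE; case: i => [[|[|//]] ?]; case: j => [[|[|//]] ?].
  rewrite mx2M -mx2_scalar => /mx2_inj[e1 e2 _ e3].
  by rewrite !expr2.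
case=> e1 e2 e3; have -> : (mx2 a b c d)^T = mx2 a c b d.
  by apply/matrixP=> i j; rewrite !mxE; case: i => [[|[|//]] ?]; case: j => [[|[|//]] ?].
rewrite mx2M -mx2_scalar -!expr2 e1 e2 e3; congr mx2.
by rewrite -e3; ring.
Qed.

Let rot_det (a b : F) : a ^+ 2 + b ^+ 2 = 1 -> a * a - b * - b != 0.
Proof. by rewrite mulrN opprK -!expr2 => ->; rewrite oner_eq0. Qed.

Definition SO2 := (O 2 :&: torus2 F)%G.

Lemma SO2P g : reflect (exists a b, a ^+ 2 + b ^+ 2 = 1 /\ g = gl2 a b (- b) a) (g \in SO2).
Proof.
apply: (iffP setIP) => [[Og /torus2P[a [b [ab0 gE]]]] | [a [b [ab ->]]]].
  exists a, b; split=> //; move: Og; rewrite gE => /O2P[] //.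
  by rewrite mulrN opprK -!expr2.
have D0 := rot_det ab; split.
  by apply/O2P => //; split; [| rewrite sqrrN addrC | ring].
by apply/torus2P; exists a, b; rewrite ab oner_eq0.
Qed.

(** With i^2 = -1 in F, the map a + i b is an embedding into the multiplicative group of F; the
    inverse of a + i b is a - i b. *)
Lemma SO2_cyclic : cyclic SO2.
Proof.
have [i i2] := exists_sqrt_opp1 F1.
apply: (@field_mul_group_cyclic {'GL_2[F]} SO2 F
  (fun g => GLval g ord0 ord0 + i * GLval g ord0 ord_max)).
  move=> _ _ /SO2P[a [b [ab ->]]] /SO2P[c [d [cd ->]]].
  have [D0 D1] := (rot_det ab, rot_det cd).
  rewrite GL_MxE !gl2E // mx2M !mxE /=.
  rewrite mulrN -[- (b * d)]mulrN1 -i2; ring.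
move=> _ /SO2P[a [b [ab ->]]]; rewrite gl2E ?rot_det // !mxE /=; split=> [e|].
  have e' : a - i * b = 1.
    transitivity ((a - i * b) * (a + i * b)); first by rewrite e mulr1.
    by rewrite -subr_sqr exprMn i2 mulN1r opprK.
  have a1 : a = 1.
    apply: (mulfI two0); have -> : 2%:R * a = (a + i * b) + (a - i * b) by ring.
    by rewrite e e' mulr1.
  have b0 : b = 0.
    have /eqP : b ^+ 2 = 0 by rewrite -(addKr (a ^+ 2) (b ^+ 2)) ab a1 expr1n addNr.
    by rewrite expf_eq0 => /eqP.
  by rewrite a1 b0 oppr0 -/(scal2 1) scal2_1.
move/(congr1 (@GLval _ _)); rewrite gl2E ?rot_det // -scal2_1 gl2E ?mulr1 ?mul0r ?subr0 ?oner_eq0 //.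
by case/mx2_inj=> -> -> _ _; rewrite mulr0 addr0.
Qed.

Lemma refl2_O2 : refl2 F \in O 2.
Proof.
apply/O2P; first by rewrite mul0r subr0 mul1r oppr_eq0 oner_eq0.
by rewrite sqrrN !expr1n expr0n /= addr0 add0r; split=> //; ring.
Qed.

Lemma refl2_notin_SO2 : refl2 F \notin SO2.
Proof.
apply/negP=> /SO2P[a [b [ab /(congr1 (@GLval _ _))]]].
rewrite !gl2E ?rot_det // ?mul0r ?subr0 ?mul1r ?oppr_eq0 ?oner_eq0 // => /mx2_inj[a1 _ _ a2].
have /eqP : (1 : F) = -1 by rewrite {1}a1 -a2.
by rewrite -subr_eq0 opprK (negPf two0).
Qed.

Let refl2_det : 1 * -1 - 0 * 0 != 0 :> F.
Proof. by rewrite mul0r subr0 mul1r oppr_eq0 oner_eq0. Qed.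

Lemma refl2_SO2_sqr t : t \in SO2 -> ((refl2 F * t) ^+ 2 = 1)%g.
Proof.
case/SO2P=> a [b [ab ->]]; have D0 := rot_det ab.
rewrite gl2M // expg2 gl2M.
  rewrite -scal2_1; congr gl2; [rewrite -[RHS]ab | | | rewrite -[RHS]ab]; ring.
all: rewrite [X in X != 0](_ : _ = - (a ^+ 2 + b ^+ 2)); last by ring.
all: by rewrite ab oppr_eq0 oner_eq0.
Qed.

(** The rows being orthonormal, the second one is [l] times (-b, a), with [l] the determinant and
    l^2 = 1. *)
Lemma O2_SO2 g : g \in O 2 -> g \in SO2 \/ (refl2 F * g)%g \in SO2.
Proof.
have [a [b [c [d [D0 ->]]]]] := gl2P g; case/O2P=> // ab cd acbd.
pose l := a * d - b * c.
have cE : c = - b * l.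
  rewrite -[LHS]mul1r -ab /l; have -> : - b * (a * d - b * c) = - a * (b * d) + b ^+ 2 * c by ring.
  have -> : b * d = - (a * c) by apply/eqP; rewrite -addr_eq0 addrC acbd.
  by ring.
have dE : d = a * l.
  rewrite -[LHS]mul1r -ab /l; have -> : a * (a * d - b * c) = a ^+ 2 * d - b * (a * c) by ring.
  have -> : a * c = - (b * d) by apply/eqP; rewrite -addr_eq0 acbd.
  by ring.
have : l ^+ 2 == 1.
  rewrite -cd cE dE -[l ^+ 2]mul1r -ab; apply/eqP; ring.
rewrite sqrf_eq1 => /orP[] /eqP l1; [left | right].
  by apply/SO2P; exists a, b; rewrite cE dE l1 !mulr1.
rewrite gl2M //; apply/SO2P; exists a, b; split=> //.
by rewrite cE dE l1; congr gl2; ring.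
Qed.

Lemma card_orthogonal_prod n : #|O n.+1| = (\prod_(0 <= i < n.+1) ufcount i.+1 (1%R : F))%N.
Proof.
rewrite card_orthogonal_group //; elim: n.+1 => [|m IHm].
  by rewrite card_orthomx0 big_geq.
by rewrite card_orthomxS // big_nat_recr //= IHm mulnC.
Qed.

Let refl2_sqr : (refl2 F ^+ 2 = 1)%g.
Proof. by rewrite expg2 gl2M // -scal2_1; congr gl2; ring. Qed.

Lemma sq_O2 : sq_detected (O 2).
Proof.
have /cyclicP[t defT] := SO2_cyclic.
have Tt : t \in SO2 by rewrite defT cycle_id.
have sTO : SO2 \subset O 2 by apply: subsetIl.
have defO : (<[t]> <*> <[refl2 F]>)%g = O 2.
  apply/eqP; rewrite eqEsubset join_subG -defT sTO cycle_subG refl2_O2 /=.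
  apply/subsetP=> g /O2_SO2[Tg | Tg]; first by rewrite mem_gen // inE Tg.
  rewrite -(mulKg (refl2 F) g) groupM ?groupV //; rewrite mem_gen // inE ?Tg //.
  by rewrite cycle_id orbT.
have nTs : refl2 F \in 'N(SO2)%g.
  rewrite inE; apply/subsetP=> _ /imsetP[u Tu ->].
  have reflV : ((refl2 F)^-1 = refl2 F)%g.
    by apply: (mulgI (refl2 F)); rewrite mulgV -refl2_sqr.
  rewrite conjgE reflV -(mulgK u (refl2 F * (u * refl2 F))%g) groupM ?groupV //.
  by rewrite mulgA -!mulgA (mulgA (refl2 F) u) -expg2 refl2_SO2_sqr.
have oO : #|O 2| = (#|SO2| * 2)%N.
  apply/eqP; rewrite eqn_leq; apply/andP; split.
    by rewrite -defO -defT card_joing_cycle_leq // refl2_sqr.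
  rewrite -(Lagrange sTO) leq_pmul2l ?cardG_gt0 // indexg_gt1.
  by apply: contra refl2_notin_SO2 => /subsetP->; rewrite ?refl2_O2.
have oT : (#|SO2| * 2 = 2 * q.-1)%N.
  rewrite -oO card_orthogonal_prod !big_nat_recr //= big_geq // mul1n ufcount1 //.
  by rewrite ufcountSS // expn0 muln1 ufcount0 muln0 addn0.
apply: (sq_dihedral defO) => //.
- exact: refl2_SO2_sqr.
- have [k qE] : exists k, q.-1 = (k * 2)%N.
    by exists (q.-1)./2; rewrite muln2 even_halfK // -oddS prednK ?odd_gt0.
  have : (#|SO2| = q.-1)%N by apply/eqP; rewrite -(eqn_pmul2r (isT : 0 < 2)%N) oT mulnC.
  by rewrite orderE -defT => ->; rewrite qE muln2 odd_double.
by rewrite oO defT.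
Qed.

Let q_gt1 : (1 < q)%N := finNzRing_gt1 F.

Lemma ufcount_gt0 n : (0 < ufcount n.+1 (1%R : F))%N.
Proof.
apply/card_gt0P; exists (delta_mx 0 ord0); rewrite inE /unit_form (bigD1 ord0) //=.
by rewrite mxE !eqxx expr1n big1 ?addr0 // => i /negPf i0; rewrite mxE i0 andbF expr0n.
Qed.

(** The increments are the valuations of the numbers of unit vectors: 1 in odd rank, and that of q^i
    - 1 in rank 2i. Halving the even ranks reduces the conditions of [tower_induction] to those met
    for GL_n. *)
Lemma sq_orthogonal n : (0 < n)%N -> sq_detected (O n).
Proof.
pose c i := logn 2 (ufcount i (1%R : F)); pose v n := (\sum_(0 <= i < n) c i.+1)%N.
have vE m : (0 < m)%N -> logn 2 #|O m| = v m.
  by case: m => // m _; rewrite card_orthogonal_prod logn_prod // => i; apply: ufcount_gt0.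
have c_odd i : c i.*2.+1 = 1%N by apply: logn_ufcount_odd.
have c_even i : (0 < i)%N -> c i.*2 = logn 2 (q ^ i - 1) by apply: logn_ufcount_even.
move: n; apply: (@tower_induction (fun n => sq_detected (O n)) v c).
- by move=> m; rewrite /v big_nat_recr.
- by rewrite /v big_geq.
- case=> [|k] j; first by case: j => [|[|?]].
  rewrite expnS mul2n -(odd_double_half j) => /andP[].
  move: (odd j) (j./2) => [] i; rewrite ?add1n ?add0n => i_gt0 lti.
    by rewrite addnS -doubleD !c_odd.
  rewrite double_gt0 in i_gt0; rewrite ltn_double in lti.
  by rewrite -doubleD !c_even ?addn_gt0 ?i_gt0 ?orbT // logn_pow_sub1_add ?i_gt0.
- case=> // k _; rewrite expnS mul2n (expnS 2 k) mul2n !c_even ?double_gt0 ?expn_gt0 //.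
  rewrite -muln2 logn_pow_sub1_double ?expn_gt0 // logn_add1_mod4 ?addn1 //.
  by rewrite -modnXm F1 modnXm exp1n.
- apply: (@sq_order2odd _ _ 1) => //.
  by rewrite card_orthogonal_prod big_nat_recr //= big_geq // ufcount1.
- exact: sq_O2.
- case=> [|a] [|b] // _ _; rewrite -!vE // => lG; apply: sq_dsum lG => g h.
  exact: dsum_orthogonal.
case=> [|a] // _; rewrite -!vE // => lG; apply: sq_dsum_swap lG => [g h|].
  exact: dsum_orthogonal.
exact: swap_orthogonal.
Qed.

End Orthogonal.

Local Close Scope ring_scope.

Theorem theorem1p2 :
  (forall (gT : finGroupType) (G : {group gT}),
     (forall P : {group gT}, (2.-Sylow(G) P)%g -> cyclic P \/ (2.-abelem P)%g) ->
     two_reduced G)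
  /\ (forall n : nat, two_reduced [set: 'S_n]%G /\ two_reduced 'Alt_('I_n)%G)
  /\ (forall n : nat, (1 < n)%N -> two_reduced 'D_(n.*2)%G)
  /\ (forall (F : finFieldType) (n : nat), #|F| = 3 %[mod 4] -> (0 < n)%N ->
        two_reduced 'GL_n[F]%G)
  /\ (forall (F : finFieldType) (n : nat), #|F| = 1 %[mod 4] -> (0 < n)%N ->
        two_reduced (orthogonal_group n F))
  /\ two_reduced mathieu12.
Proof.
do !split.
- move=> gT G sylG; apply: H2_detected_two_reduced.
  by have [P sylP] := Sylow_exists 2 G; apply: (H2_Sylow sylP (sylG P sylP)).
- exact/H2_detected_two_reduced/H2_Sym.
- exact/H2_detected_two_reduced/H2_Alt.
- by move=> n n_gt1; apply/H2_detected_two_reduced/H2_dihedral.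
- by move=> F n F3 n_gt0; apply: H2_detected_two_reduced; case: (sq_GL F3 n_gt0).
- by move=> F n F1 n_gt0; apply: H2_detected_two_reduced; case: (sq_orthogonal F1 n_gt0).
- exact/H2_detected_two_reduced/H2_mathieu12.
Qed.
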